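(* Let $V$ be a complex vector space of dimension $n\geq 3$ and $\mathbf{G}=\mathrm{Gr}_{2n-3}(\bigwedge^2V)$. Then one has the equality of divisors on $\mathbf{G}$ $$\mathcal{D}_{\mathfrak{Kosz}}=(n-2)\cdot\mathcal{D}_{\mathfrak{Res}}.$$
   Context: For $K\subseteq\bigwedge^2V$, $K^\perp\subseteq\bigwedge^2V^\vee$ is its annihilator, and $W_q(V,K)$ is the middle cohomology of $K\otimes\operatorname{Sym}^qV\xrightarrow{\delta_{2,q}}V\otimes\operatorname{Sym}^{q+1}V\xrightarrow{\delta_{1,q+1}}\operatorname{Sym}^{q+2}V$ (restricted Koszul differential $v_1\wedge v_2\otimes f\mapsto v_2\otimes v_1f-v_1\otimes v_2 f$, then multiplication). $\mathcal{D}_{\mathfrak{Kosz}}$ is the degeneracy locus (with its natural divisor structure) of the map of vector bundles $\gamma\colon\mathcal{U}\otimes\operatorname{Sym}^{n-3}V\to\mathcal{O}_{\mathbf{G}}\otimes\mathrm{Im}(\delta_{2,n-3})$, where $\mathcal{U}$ is the tautological rank $(2n-3)$ subbundle and $\gamma$ is fibrewise $\delta_{2,n-3}$ restricted to $K\otimes\operatorname{Sym}^{n-3}V$; set-theoretically it is $\{K: W_{n-3}(V,K)\neq 0\}$. $\mathcal{D}_{\mathfrak{Res}}$ is the Cayley–Chow divisor of $\mathrm{Gr}_2(V^\vee)\subseteq\mathbf{P}(\bigwedge^2V^\vee)$ in its Plücker embedding, supported on $\{K:\mathbf{P}(K^\perp)\cap\mathrm{Gr}_2(V^\vee)\neq\emptyset\}$.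 *)

(* Defs.v *)
From HB Require Import structures.
From mathcomp Require Import all_boot all_order all_algebra.
From mathcomp Require Import mpoly.
From mathcomp Require Import complex.
From mathcomp Require Import Rstruct.
Set Implicit Arguments. Unset Strict Implicit. Unset Printing Implicit Defensive.
Import Order.TTheory GRing.Theory Num.Theory.
Local Open Scope ring_scope.

Notation CC := (complex Rdefinitions.R).

(* V = CC^n, with basis e_0, ..., e_{n-1}. *)

(* Basis of /\^2 V : e_i /\ e_j with i < j. *)
Definition Wedge2 (n : nat) : finType := {p : 'I_n * 'I_n | (nat_of_ord p.1 < nat_of_ord p.2)%N}.

(* Basis of Sym^q V : monomials x^a with |a| = q. *)
Definition Mon (n q : nat) : finType := {a : {ffun 'I_n -> 'I_q.+1} | \sum_i (a i : nat) == q}%N.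

Definition expo n q (a : Mon n q) (i : 'I_n) : nat := val a i.

Definition mxT (S T : finType) (A : S -> T -> CC) : 'M[CC]_(#|S|, #|T|) :=
  \matrix_(i, j) A (enum_val i) (enum_val j).

(* Koszul differential delta_{2,q} : /\^2 V (x) Sym^q V -> V (x) Sym^{q+1} V,
   e_i /\ e_j (x) f |-> e_j (x) x_i f - e_i (x) x_j f.
   Coefficient of e_k (x) x^b in delta(e_i/\e_j (x) x^a). *)
Definition koszul_delta2 (n q : nat)
    (wa : Wedge2 n * Mon n q) (kb : 'I_n * Mon n q.+1) : CC :=
  let i := (val wa.1).1 in let j := (val wa.1).2 in
  let a := wa.2 in let k := kb.1 in let b := kb.2 in
  (((k == j) && [forall l, expo b l == expo a l + (l == i)]%N)%:R
   - ((k == i) && [forall l, expo b l == expo a l + (l == j)]%N)%:R).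

(* Matrix of delta_{2,q} (rows = source basis, row-vector convention). *)
Definition Delta2 n q := mxT (@koszul_delta2 n q).

(* A (2n-3)-dimensional subspace K of /\^2 V is given by a k x N matrix M
   whose rows are a basis of K (M full rank).  M r w = coordinate of the
   r-th basis vector of K on the basis vector w of /\^2 V. *)
Definition frame (k n : nat) := 'I_k -> Wedge2 n -> CC.

Definition full_rank_frame k n (M : frame k n) : bool :=
  \rank (mxT M) == k.

(* gamma_K : K (x) Sym^q V -> V (x) Sym^{q+1} V, the restriction of delta_{2,q},
   written in the basis (rows of M) (x) monomials. *)
Definition gamma_mx k n q (M : frame k n) :
    'M[CC]_(#|{: 'I_k * Mon n q}|, #|{: 'I_n * Mon n q.+1}|) :=
  mxT (fun (ra : 'I_k * Mon n q) (kb : 'I_n * Mon n q.+1) =>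
         \sum_(w : Wedge2 n) M ra.1 w * koszul_delta2 (w, ra.2) kb).

(* Resultant locus: P(K^perp) meets Gr_2(V^vee) in its Pluecker embedding,
   i.e. there is a nonzero decomposable u /\ v in /\^2 V^vee annihilating K.
   (u /\ v)(e_i /\ e_j) = u_i v_j - u_j v_i. *)
Definition pl (n : nat) (u v : 'I_n -> CC) (w : Wedge2 n) : CC :=
  u (val w).1 * v (val w).2 - u (val w).2 * v (val w).1.

Definition res_locus k n (M : frame k n) : Prop :=
  exists u v : 'I_n -> CC,
    (exists w, pl u v w != 0) /\
    (forall r : 'I_k, \sum_(w : Wedge2 n) M r w * pl u v w = 0).

Definition nvars k n := #|{: 'I_k * Wedge2 n}|.
Definition frame_pt k n (M : frame k n) : 'I_(nvars k n) -> CC :=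
  fun i => M (enum_val i).1 (enum_val i).2.

(* Irreducible multivariate polynomial: non-constant, and every factorisation
   has a constant factor (msize p = 1 + total degree, 0 for p = 0). *)
Definition mirreducible m (p : {mpoly CC[m]}) : Prop :=
  (1 < msize p)%N /\
  forall a b : {mpoly CC[m]}, p = a * b -> (msize a <= 1)%N \/ (msize b <= 1)%N.

(* Main.v *)
Require Import Defs.
From HB Require Import structures.
From Stdlib Require Import Classical FunctionalExtensionality ClassicalEpsilon.
From Stdlib Require Rtopology.
From mathcomp Require Import all_boot all_order perm all_algebra.
From mathcomp Require Import mpoly.
From mathcomp Require Import complex Rstruct.
From mathcomp Require Import ring zify.
Set Implicit Arguments.
Unset Strict Implicit.
Unset Printing Implicit Defensive.
Import Order.TTheory GRing.Theory Num.Theory.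
Local Open Scope ring_scope.

(* Write n = m + 2, q = m - 1 and let X be the resultant locus in the space of
   frames, R its equation.

   Multiplicity.  At a general frame M of X, killed by u /\ v, a characteristic
   polynomial argument gives for each scalar s a syzygy sum_r g_r M_r = 0 of
   degree q in K (x) Sym^q V with g_0(u + t v) = (s - t)^q, while the vectors of
   V (x) Sym^(q+1) V evaluated at (u + t v, v) are killed by gamma.  Pairing
   both families, the derivative of gamma in the direction e_0 /\ e_1 of row 0
   becomes the binomial matrix ((s_i - t_j)^q), which is invertible.  So every
   nonzero minor of gamma of maximal size vanishes to order q + 1 = m along X,
   hence is divisible by R^m.

   Degree.  A toric degeneration of the Grassmannian, with weights i * j, shows
   that a nonzero polynomial vanishing on X has degree at least the Catalan
   number C_m in each row of the frame.  Since m C_m = dim Sym^q V is also the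
   degree of det gamma in a row, the maximal minors are the full determinant
   and det gamma = c R^m.

   Support.  The derivatives of R along row 0 are the Pluecker coordinates of a
   point killed by the frame, modulo R; this shows that smooth zeros of R lie in
   X, and the singular ones follow by compactness of the Grassmannian. *)

(** * Curves and zero functions *)

(** That X has an equation at all is part of the argument. The parametrisation of X by frames with a
    chosen annihilating u /\ v shows that the ideal of X is prime, so a nonzero minor vanishing on X
    has an irreducible factor R in this ideal. If g vanishes on X and R does not divide g,
    elimination along the direction e_0 /\ e_1 of row 0 yields a nonzero polynomial vanishing on all
    translates of X in that direction; a tangent computation shows that none exists. Hence R
    generates the ideal, and its derivative in that direction is not identically zero on X, which is
    what converts orders of vanishing along the direction into powers of R.

    The generic rank of gamma is not known in advance either. The estimates are made for a minor of
    size s, the largest rank of gamma on frames; the degree bounds in each row then force s to be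
    the full number of rows, and this also gives the lower bound for the rank of delta_2. The upper
    bound comes from delta_2 followed by delta_1 being zero, with delta_1 surjective. *)

Section MpolyCurves.
Variable F : comNzRingType.

Definition mcurve n (c : 'I_n -> {poly F}) (p : {mpoly F[n]}) : {poly F} :=
  mmap (@polyC F) c p.

Lemma horner_mcurve n (c : 'I_n -> {poly F}) p t :
  (mcurve c p).[t] = p.@[fun i => (c i).[t]].
Proof.
rewrite mevalE /mcurve /mmap horner_sum; apply: eq_bigr => m _.
rewrite hornerM hornerC /mmap1 horner_prod; congr (_ * _).
by apply: eq_bigr => i _; rewrite horner_exp.
Qed.

Lemma mcurveM n (c : 'I_n -> {poly F}) p q :
  mcurve c (p * q) = mcurve c p * mcurve c q.
Proof. by rewrite /mcurve rmorphM. Qed.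

Lemma mcurveXn n (c : 'I_n -> {poly F}) p k :
  mcurve c (p ^+ k) = mcurve c p ^+ k.
Proof. by rewrite /mcurve rmorphXn. Qed.

Lemma deriv_mcurve n (c : 'I_n -> {poly F}) p :
  (mcurve c p)^`() = \sum_(i < n) mcurve c p^`M(i) * (c i)^`().
Proof.
pose P q := (mcurve c q)^`() = \sum_(i < n) mcurve c q^`M(i) * (c i)^`().
have PM q r : P q -> P r -> P (q * r).
  rewrite /P mcurveM derivM => -> ->; rewrite mulr_suml mulr_sumr -big_split.
  apply: eq_bigr => i _ /=; rewrite mderivM [in RHS]/mcurve mmapD !rmorphM.
  rewrite -!/(mcurve _ _); ring.
have P1 : P 1.
  rewrite /P [in LHS]/mcurve rmorph1 derivC big1 // => i _.
  by rewrite -mpolyC1 mderivC /mcurve mmap0 mul0r.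
rewrite -/(P p); elim/mpolyind: p => [|a m p _ _ IHp].
  rewrite /P [in LHS]/mcurve mmap0 deriv0 big1 // => i _.
  by rewrite mderiv0 /mcurve mmap0 mul0r.
rewrite /P [in LHS]/mcurve mmapD derivD IHp.
under [RHS]eq_bigr do rewrite mderivD /mcurve mmapD mulrDl.
rewrite big_split /=; congr (_ + _).
rewrite mmapZ derivM derivC mul0r add0r -/(mcurve c 'X_[m]).
under [RHS]eq_bigr do rewrite mderivZ mmapZ -mulrA.
rewrite -mulr_sumr; congr (_ * _); rewrite -/(P 'X_[m]) mpolyXE_id.
elim/big_ind: _ => // i _; elim: (m i) => [|k IHk]; first by rewrite expr0.
rewrite exprS; apply: PM => //; rewrite /P [in LHS]/mcurve mmapX mmap1U.
rewrite (bigD1 i) //= big1 ?addr0.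
  rewrite mderivX mnmE eqxx scale1r /mcurve.
  by rewrite (_ : (U_(i) - U_(i))%MM = 0%MM) ?mpolyX0 ?rmorph1 ?mul1r //;
     apply/mnmP => j; rewrite !mnmE subnn.
move=> j ji; rewrite mderivX mnmE eq_sym (negPf ji) scale0r.
by rewrite /mcurve mmap0 mul0r.
Qed.
End MpolyCurves.


Lemma rmorph_mpoly_eq (F : comNzRingType) n (S : nzRingType)
    (f g : {rmorphism {mpoly F[n]} -> S}) :
  (forall c, f c%:MP = g c%:MP) -> (forall i, f 'X_i = g 'X_i) -> f =1 g.
Proof.
move=> fgC fgX p; elim/mpolyind: p => [|a m p _ _ IHp]; first by rewrite !rmorph0.
rewrite !rmorphD IHp -mul_mpolyC !rmorphM fgC mpolyXE_id !rmorph_prod.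
by congr (_ * _ + _); apply: eq_bigr => i _; rewrite !rmorphXn fgX.
Qed.

Section LastVariable.
Variables (F : comNzRingType) (n : nat).
Local Notation widen := (widen_ord (leqnSn n)).

Lemma muniXmax : muni ('X_ord_max : {mpoly F[n.+1]}) = 'X.
Proof.
rewrite /muni mmapX mmap1U; case: splitP => // j /= /eqP.
by rewrite eq_sym ltn_eqF.
Qed.

Lemma muniXwiden (i : 'I_n) : muni ('X_(widen i) : {mpoly F[n.+1]}) = ('X_i)%:P.
Proof.
rewrite /muni mmapX mmap1U; case: splitP => [j eqij|j] /=.
  by congr ('X__)%:P; apply: val_inj.
by rewrite ord1 addn0 => /eqP; rewrite ltn_eqF.
Qed.

Definition nuni (p : {poly {mpoly F[n]}}) : {mpoly F[n.+1]} :=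
  (map_poly (@mwiden n F) p).['X_ord_max].

Lemma nuniC c : nuni c%:P = mwiden c.
Proof. by rewrite /nuni map_polyC hornerC. Qed.

Lemma nuniX : nuni 'X = 'X_ord_max.
Proof. by rewrite /nuni map_polyX hornerX. Qed.

Lemma nuniM : {morph nuni : p q / p * q}.
Proof. by move=> p q; rewrite /nuni rmorphM hornerM. Qed.

Lemma nuniD : {morph nuni : p q / p + q}.
Proof. by move=> p q; rewrite /nuni rmorphD hornerD. Qed.

Lemma mwidenXU (i : 'I_n) : mwiden ('X_i : {mpoly F[n]}) = 'X_(widen i).
Proof. by rewrite mwidenX mnmwiden1. Qed.

Lemma ord_widen_max (P : 'I_n.+1 -> Prop) :
  P ord_max -> (forall i : 'I_n, P (widen i)) -> forall i, P i.
Proof.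
move=> Pmax Pw i; have [->//|ni] := eqVneq i ord_max.
have lt_i : (i < n)%N.
  by rewrite ltn_neqAle -ltnS ltn_ord andbT; apply: contra ni => /eqP ?; apply/eqP/val_inj.
by rewrite (_ : i = widen (Ordinal lt_i)) //; apply: val_inj.
Qed.

Lemma muniK : cancel (@muni n F) nuni.
Proof.
pose f : {rmorphism {mpoly F[n.+1]} -> {mpoly F[n.+1]}} :=
  (horner_eval 'X_ord_max \o map_poly (@mwiden n F)) \o @muni n F.
pose g : {rmorphism {mpoly F[n.+1]} -> {mpoly F[n.+1]}} := idfun.
apply: (@rmorph_mpoly_eq _ _ _ f g) => [c|].
  by rewrite /f /= muniC map_polyC /horner_eval hornerC /= mwidenC.
apply: ord_widen_max => [|i].
  by rewrite /f /= muniXmax map_polyX /horner_eval hornerX.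
by rewrite /f /= muniXwiden map_polyC /horner_eval hornerC /= mwidenXU.
Qed.

Lemma nuniK : cancel nuni (@muni n F).
Proof.
move=> p; elim/poly_ind: p => [|p c IHp].
  by rewrite /nuni map_poly0 horner0 muni0.
rewrite nuniD nuniM nuniC nuniX rmorphD rmorphM /= IHp muniXmax; congr (_ + _).
pose f : {rmorphism {mpoly F[n]} -> {poly {mpoly F[n]}}} :=
  @muni n F \o @mwiden n F.
pose g : {rmorphism {mpoly F[n]} -> {poly {mpoly F[n]}}} := @polyC _.
apply: (@rmorph_mpoly_eq _ _ _ f g) => [a|i]; rewrite /f /=.
  by rewrite mwidenC muniC.
by rewrite mwidenXU muniXwiden.
Qed.

Lemma horner_muni (v : 'I_n.+1 -> F) p :
  (map_poly (meval (fun i => v (widen i))) (muni p)).[v ord_max] = p.@[v].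
Proof.
pose f : {rmorphism {mpoly F[n.+1]} -> F} :=
  (horner_eval (v ord_max) \o map_poly (meval (fun i => v (widen i)))) \o @muni n F.
pose g : {rmorphism {mpoly F[n.+1]} -> F} := meval v.
apply: (@rmorph_mpoly_eq _ _ _ f g) => [c|].
  by rewrite /f /= muniC map_polyC /horner_eval hornerC /= !mevalC.
apply: ord_widen_max => [|i]; rewrite /f /g /= mevalXU.
  by rewrite muniXmax map_polyX /horner_eval hornerX.
by rewrite muniXwiden map_polyC /horner_eval hornerC /= mevalXU.
Qed.
End LastVariable.

Section ZeroFunction.
Variable F : numFieldType.

Lemma poly_eq0_infinite (p : {poly F}) :
  (forall k : nat, p.[k%:R] = 0) -> p = 0.
Proof.
move=> p0; apply/eqP; apply: contraT => np0.
pose s := [seq k%:R : F | k <- iota 0 (size p)].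
have : (size s < size p)%N.
  apply: max_poly_roots => //.
    by apply/allP => x /mapP[k _ ->]; rewrite rootE p0.
  rewrite map_inj_uniq ?iota_uniq // => a b /eqP.
  by rewrite eqr_nat => /eqP.
by rewrite size_map size_iota ltnn.
Qed.

Lemma mpoly_fun_eq0 n (p : {mpoly F[n]}) : (forall v, p.@[v] = 0) -> p = 0.
Proof.
elim: n p => [|n IHn] p p0.
  have := p0 (fun=> 0); rewrite -[p]mpolyKC mevalC => ->.
  by rewrite mpolyC0.
rewrite -(muniK p); suff -> : muni p = 0 by rewrite /nuni map_poly0 horner0.
apply/polyP => i; rewrite coef0; apply: IHn => w.
have : map_poly (meval w) (muni p) = 0.
  apply: poly_eq0_infinite => k.
  pose v (j : 'I_n.+1) : F := oapp w k%:R (insub (val j)).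
  have vmax : v ord_max = k%:R by rewrite /v insubF //= ltnn.
  have vw : (fun j => v (widen_ord (leqnSn n) j)) =1 w.
    by move=> j; rewrite /v /= valK.
  rewrite -vmax -(p0 v) -horner_muni; congr (_.[_]).
  by apply/polyP => j; rewrite !coef_map /=; apply/esym/meval_eq.
by move/polyP/(_ i); rewrite coef0 coef_map.
Qed.

Lemma mpoly_neq0_point n (p : {mpoly F[n]}) : p != 0 -> ~ (forall v, p.@[v] = 0).
Proof. by move/eqP => np p0; apply/np/mpoly_fun_eq0. Qed.
End ZeroFunction.

(** * Unique factorisation in polynomial rings *)

Definition rdvd (B : comNzRingType) (p a : B) := exists c, a = p * c.

Definition prime_elt (B : comUnitRingType) (p : B) :=
  [/\ p != 0, p \isn't a GRing.unit &
      forall a b, rdvd p (a * b) -> rdvd p a \/ rdvd p b].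

Definition irred_elt (B : comUnitRingType) (p : B) :=
  [/\ p != 0, p \isn't a GRing.unit &
      forall a b, p = a * b -> a \is a GRing.unit \/ b \is a GRing.unit].

Section Divisibility.
Variable A : idomainType.
Implicit Types (a b c p : A).

(** Existence of prime factorisations in inductive form: divisibility arguments strip one prime at a
    time and need not record multiplicities. *)
Inductive prime_fact : A -> Prop :=
| PrimeFactUnit u : u \is a GRing.unit -> prime_fact u
| PrimeFactMul p c : prime_elt p -> prime_fact c -> prime_fact (p * c).

(** Gauss's lemma: [p] divides the product of the leading coefficients, hence one of them, and that
    leading term can be removed; induction on the sum of the sizes. *)
Lemma prime_elt_polyC p : prime_elt p -> prime_elt p%:P.
Proof.
case=> p0 pu pP; split; first by rewrite polyC_eq0.
  by rewrite poly_unitE coefC /= (negPf pu) andbF.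
move=> f g; move: {2}(size f + size g)%N (leqnn (size f + size g)%N) => k.
elim: k f g => [|k IHk] f g.
  rewrite leqn0 addn_eq0 size_poly_eq0 => /andP[/eqP-> _] _.
  by left; exists 0; rewrite mulr0.
move=> lefg [h fgE].
have [->|f0] := eqVneq f 0; first by left; exists 0; rewrite mulr0.
have [->|g0] := eqVneq g 0; first by right; exists 0; rewrite mulr0.
have : rdvd p (lead_coef f * lead_coef g).
  by rewrite -lead_coefM fgE lead_coefM lead_coefC; exists (lead_coef h).
have trunc (q : {poly A}) : q != 0 -> (size (q - lead_coef q *: 'X^((size q).-1))%R < size q)%N.
  move=> q0; rewrite -[X in (_ < X)%N](prednK (_ : (0 < size q)%N)) ?size_poly_gt0 //.
  rewrite ltnS; apply/leq_sizeP => j lej; rewrite coefB coefZ coefXn.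
  case: (eqVneq j (size q).-1) => [->|nj] /=; first by rewrite mulr1 subrr.
  by rewrite mulr0 subr0 nth_default // -(prednK (_ : (0 < size q)%N)) ?size_poly_gt0 // ltn_neqAle eq_sym nj.
case/pP => -[c cE].
+ have [] : rdvd p%:P (f - lead_coef f *: 'X^((size f).-1)) \/ rdvd p%:P g.
  - apply: IHk.
      by rewrite -ltnS (leq_trans _ lefg) // ltn_add2r; apply: trunc.
    exists (h - c *: 'X^((size f).-1) * g); rewrite mulrBl mulrBr fgE; congr (_ - _).
    by rewrite cE -!mul_polyC polyCM -!mulrA.
  - case=> d dE; left; exists (d + c *: 'X^((size f).-1)); rewrite mulrDr -dE.
    by rewrite cE -!mul_polyC polyCM -!mulrA subrK.
  - by right.
+ have [] : rdvd p%:P f \/ rdvd p%:P (g - lead_coef g *: 'X^((size g).-1)).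
- apply: IHk.
    by rewrite -ltnS (leq_trans _ lefg) // ltn_add2l; apply: trunc.
  exists (h - f * (c *: 'X^((size g).-1))); rewrite !mulrBr fgE; congr (_ - _).
  by rewrite cE -!mul_polyC polyCM; ring.
- by left.
- case=> d dE; right; exists (d + c *: 'X^((size g).-1)); rewrite mulrDr -dE.
  by rewrite cE -!mul_polyC polyCM -!mulrA subrK.
Qed.

(** [f] is primitive, so each prime of [c], dividing [f * q], divides [q] and cancels. *)
Lemma prime_fact_cancel c (f g q : {poly A}) : prime_fact c ->
  (forall p, prime_elt p -> ~ rdvd p%:P f) ->
  c%:P * g = f * q -> rdvd f g.
Proof.
move=> cP fprim; elim: cP q => [u uU|p d pP _ IHd] q eq_fq.
  exists (u^-1%:P * q); rewrite mulrCA -eq_fq mulrA -polyCM mulVr //.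
  by rewrite mul1r.
have [] : rdvd p%:P f \/ rdvd p%:P q.
- have [_ _] := prime_elt_polyC pP; apply.
  by exists (d%:P * g); rewrite -eq_fq polyCM mulrA.
- by move=> /(fprim _ pP).
- case=> q' q'E; apply: (IHd q').
  have [/mulfI pI _ _] := prime_elt_polyC pP; apply: pI.
  by rewrite mulrA -polyCM eq_fq q'E mulrCA.
Qed.

(** Clears denominators in a factorisation of [f] over the fraction field: the primes of [c] are
    divided out of [s] or [t], which keeps both degrees. *)
Lemma prime_fact_split c (f s t : {poly A}) : prime_fact c ->
  c%:P * f = s * t ->
  exists s' t', [/\ f = s' * t', size s' = size s & size t' = size t].
Proof.
move=> cP; elim: cP s t => [u uU|p d pP _ IHd] s t eq_st.
  exists (u^-1%:P * s), t; split=> //.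
    by rewrite -mulrA -eq_st mulrA -polyCM mulVr // mul1r.
  by rewrite mul_polyC size_scale // invr_eq0; apply: contraTneq uU => ->; rewrite unitr0.
have [pP0 _ pPP] := prime_elt_polyC pP; have pI := mulfI pP0.
have szp q : size (p%:P * q) = size q.
  by rewrite mul_polyC size_scale // -polyC_eq0.
have [] : rdvd p%:P s \/ rdvd p%:P t.
- by apply: pPP; exists (d%:P * f); rewrite -eq_st polyCM mulrA.
- case=> s1 s1E; have [|s' [t' [fE szs szt]]] := IHd s1 t.
    by apply: pI; rewrite mulrA -polyCM eq_st s1E mulrA.
  by exists s', t'; rewrite s1E szp.
- case=> t1 t1E; have [|s' [t' [fE szs szt]]] := IHd s t1.
    by apply: pI; rewrite mulrA -polyCM eq_st t1E mulrCA.
  by exists s', t'; rewrite t1E szp.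
Qed.
End Divisibility.

(** Gcd and Bezout are available up to nonzero constants of [A]. If the gcd of [f] and [a] is
    constant, Bezout puts a constant multiple of [b] in the ideal of [f]; otherwise irreducibility
    makes the cofactor of the gcd in [f] constant, so [f] divides [a] up to a constant. Primitivity
    of [f] removes the constants. *)
Lemma irred_poly_prime (A : idomainType) (f : {poly A}) :
  (forall c : A, c != 0 -> prime_fact c) ->
  irred_elt f -> (1 < size f)%N -> prime_elt f.
Proof.
move=> pfA [f0 fu fI] szf; split=> // a b [e abE].
have fprim p : prime_elt p -> ~ rdvd p%:P f.
  move=> [p0 pu _] [h fE]; case: (fI _ _ fE).
    by rewrite poly_unitE coefC /= (negPf pu) andbF.
  move=> hu; move: szf; rewrite fE mul_polyC size_scale //.
  by move: hu; rewrite poly_unitE => /andP[/eqP-> _].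
have [cop|ncop] := boolP (coprimep f a).
  have /Bezout_coprimepP[[u v] /=] := cop.
  rewrite -size_poly_eq1 => /size_poly1P[c c0 cE]; right.
  apply: (prime_fact_cancel (pfA c c0) fprim (q := u * b + v * e)).
  by rewrite -cE mulrDl mulrDr -!mulrA abE; ring.
left; set d := gcdp f a.
have szd : (1 < size d)%N.
  rewrite ltn_neqAle eq_sym; move: ncop; rewrite /coprimep => -> /=.
  by rewrite size_poly_gt0 gcdp_eq0 negb_and f0.
have := dvdp_gcdl f a; rewrite -/d Pdiv.Idomain.dvdp_eq => /eqP dfE.
have := dvdp_gcdr f a; rewrite -/d Pdiv.Idomain.dvdp_eq => /eqP daE.
set cf := lead_coef d ^+ _ in dfE; set ca := lead_coef d ^+ _ in daE.
have d0 : d != 0 by rewrite -size_poly_gt0 (ltn_trans _ szd).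
have cf0 : cf != 0 by rewrite expf_neq0 // lead_coef_eq0.
have ca0 : ca != 0 by rewrite expf_neq0 // lead_coef_eq0.
move: dfE daE; rewrite -!mul_polyC => dfE daE.
have [s' [t' [fE szs szt]]] := prime_fact_split (pfA _ cf0) dfE.
have : size (f %/ d) = 1%N.
  case: (fI _ _ fE); rewrite poly_unitE => /andP[/eqP sz1 _].
    by rewrite -szs.
  by move: szd; rewrite -szt sz1.
move/eqP/size_poly1P => [u u0 uE]; rewrite uE in dfE.
apply: (prime_fact_cancel (pfA (ca * u) _) fprim (q := a %/ d * cf%:P)).
  by rewrite mulf_neq0.
by rewrite polyCM mulrAC daE -mulrA [d * _]mulrC -dfE; ring.
Qed.

Lemma rdvd_muni (F : comNzRingType) n (p q : {mpoly F[n.+1]}) :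
  rdvd (muni p) (muni q) -> rdvd p q.
Proof.
case=> d dE; exists (nuni d); rewrite -[p in RHS](muniK p) -nuniM -dE.
by rewrite (muniK q).
Qed.

Section MpolyPrime.
Variable F : fieldType.

Lemma mpoly_unit_msize n (p : {mpoly F[n]}) :
  (p \is a GRing.unit) = (msize p == 1%N).
Proof.
apply/idP/idP => [/unitrPr[q pq1]|/msize_poly1P[c c0 ->]].
  have [p0 q0] : p != 0 /\ q != 0.
    by split; apply: contra_eq_neq pq1 => ->; rewrite ?mul0r ?mulr0 eq_sym oner_eq0.
  have := msizeM p0 q0; rewrite pq1 msize1.
  move: p0 q0; rewrite -!msize_poly_eq0; case: (msize p) (msize q) => [|[|x]] [|y] //= _ _.
  by rewrite addnS.
by apply/unitrPr; exists (c^-1)%:MP; rewrite -mpolyCM mulfV // mpolyC1.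
Qed.

Lemma mpoly_prime_fact n :
  (forall p : {mpoly F[n]}, irred_elt p -> prime_elt p) ->
  forall p : {mpoly F[n]}, p != 0 -> prime_fact p.
Proof.
move=> irrP p; move: {2}(msize p) (leqnn (msize p)) => k.
elim: k p => [|k IHk] p.
  by rewrite leqn0 msize_poly_eq0 => ->.
move=> lep p0; have [pu|pu] := boolP (p \is a GRing.unit).
  exact: PrimeFactUnit.
case: (classic (irred_elt p)) => [/irrP pP|pN].
  by rewrite -[p]mulr1; apply: PrimeFactMul => //; apply/PrimeFactUnit/unitr1.
have [a [b [pE au bu]]] : exists a b, [/\ p = a * b, a \isn't a GRing.unit & b \isn't a GRing.unit].
  apply: NNPP => nab; apply: pN; split=> // a b pE.
  have [au|au] := boolP (a \is a GRing.unit); first by left.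
  have [bu|bu] := boolP (b \is a GRing.unit); first by right.
  by case: nab; exists a, b.
have [a0 b0] : a != 0 /\ b != 0.
  by apply/andP; rewrite -negb_or -mulf_eq0 -pE.
have szab : (msize a <= k)%N /\ (msize b <= k)%N.
  move: lep au bu; rewrite pE msizeM // !mpoly_unit_msize.
  move: a0 b0; rewrite -!msize_poly_eq0. by move: (msize a) (msize b) => x y; lia.
have := IHk a szab.1 a0; have := IHk b szab.2 b0; rewrite pE.
move=> bP; elim=> [u uu|q c qP _ IHc]; last by rewrite -mulrA; apply: PrimeFactMul.
case: bP => [v vu|q c qP cP]; first by apply/PrimeFactUnit; rewrite unitrM uu.
rewrite mulrCA; apply: PrimeFactMul => //.
elim: cP => [v vu|q' c' q'P _ IH]; first by apply/PrimeFactUnit; rewrite unitrM uu.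
by rewrite mulrCA; apply: PrimeFactMul.
Qed.

(** Induction on the number of variables, the last one being the variable of a univariate ring; a
    polynomial free of it is a constant there and falls under the induction hypothesis. *)
Theorem mpoly_irred_prime n (p : {mpoly F[n]}) : irred_elt p -> prime_elt p.
Proof.
elim: n p => [|n IHn] p [p0 pu pI].
  move: pu p0; rewrite -[p]mpolyKC mpoly_unit_msize msizeC mpolyC_eq0.
  by move=> h h'; move: h; rewrite h'.
have muni_unit (q : {mpoly F[n.+1]}) : (muni q \is a GRing.unit) = (q \is a GRing.unit) :> bool.
  apply/idP/idP => [/unitrPr[r qr]|/unitrPr[r qr]]; apply/unitrPr.
    exists (nuni r); rewrite -[q]muniK -nuniM qr /nuni.
    by rewrite -polyC1 map_polyC hornerC /= rmorph1.
  by exists (muni r); rewrite -rmorphM qr rmorph1.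
have muni_irr : irred_elt (muni p).
  split; rewrite ?muni_unit //.
    by apply: contra_neq p0 => p0; rewrite -[p]muniK p0 /nuni map_poly0 horner0.
  move=> a b pE; have pE' : p = nuni a * nuni b by rewrite -nuniM -pE muniK.
  case: (pI _ _ pE') => [au|bu]; [left|right].
    by have := muni_unit (nuni a); rewrite (nuniK a) au.
  by have := muni_unit (nuni b); rewrite (nuniK b) bu.
suff [_ _ mP] : prime_elt (muni p).
  split=> // a b [c abE].
  have dab : rdvd (muni p) (muni a * muni b).
    by exists (muni c); have := congr1 (@muni n F) abE; rewrite !muniM.
  by case: (mP _ _ dab) => /rdvd_muni; [left|right].
have [sz1|sz1] := leqP (size (muni p)) 1; last first.
  by apply: irred_poly_prime => //; apply: mpoly_prime_fact.
have [m0 mu mI] := muni_irr.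
rewrite (size1_polyC sz1) in m0 mu mI *; set c := (muni p)`_0 in m0 mu mI *.
apply: prime_elt_polyC; apply: IHn; split.
- by rewrite -polyC_eq0.
- apply: contra mu => /unitrPr[d cd]; apply/unitrPr; exists d%:P.
  by rewrite -polyCM cd.
- move=> a b cE; have [||] := mI a%:P b%:P; first by rewrite -polyCM cE.
    by rewrite poly_unitE coefC => /andP[_]; left.
  by rewrite poly_unitE coefC => /andP[_]; right.
Qed.
End MpolyPrime.

(** A Bezout relation then gives a nonzero element of [A] in the ideal of [f] and [h], which plays
    the role of their resultant. *)
Lemma prime_poly_coprime (A : idomainType) (f h : {poly A}) :
  prime_elt f -> (1 < size f)%N -> ~ rdvd f h -> coprimep f h.
Proof.
move=> [f0 _ fP] szf nfh; apply: contra_notT nfh => ncop; set d := gcdp f h.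
have szd : (1 < size d)%N.
  rewrite ltn_neqAle eq_sym; move: ncop; rewrite /coprimep => -> /=.
  by rewrite size_poly_gt0 gcdp_eq0 negb_and f0.
have := dvdp_gcdl f h; rewrite -/d Pdiv.Idomain.dvdp_eq => /eqP dfE.
have := dvdp_gcdr f h; rewrite -/d Pdiv.Idomain.dvdp_eq => /eqP dhE.
set cf := lead_coef d ^+ _ in dfE; set ch := lead_coef d ^+ _ in dhE.
have d0 : d != 0 by rewrite -size_poly_gt0 (ltn_trans _ szd).
have cf0 : cf != 0 by rewrite expf_neq0 // lead_coef_eq0.
have ch0 : ch != 0 by rewrite expf_neq0 // lead_coef_eq0.
move: dfE dhE; rewrite -!mul_polyC => dfE dhE.
have [] : rdvd f (f %/ d) \/ rdvd f d.
- by apply: fP; exists cf%:P; rewrite -dfE mulrC.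
- case=> q qE; move: dfE; rewrite qE mulrC -mulrA => /(mulfI f0) cfE.
  have : q * d != 0 by rewrite -cfE polyC_eq0.
  rewrite mulf_eq0 negb_or => /andP[q0 _].
  have := size_mul q0 d0; rewrite -cfE size_polyC cf0.
  by move: szd q0; rewrite -size_poly_gt0; move: (size q) (size d) => x y; lia.
case=> q qE; have [] : rdvd f ch%:P \/ rdvd f h.
- by apply: fP; exists (h %/ d * q); rewrite dhE {2}qE mulrCA.
- case=> e eE; have : f * e != 0 by rewrite -eE polyC_eq0.
  rewrite mulf_eq0 negb_or => /andP[_ e0].
  have := size_mul f0 e0; rewrite -eE size_polyC ch0.
  by move: szf e0; rewrite -size_poly_gt0; move: (size f) (size e) => x y; lia.
- by [].
Qed.

(** * Elimination along a direction *)

Section Translation.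
Variables (F : numFieldType) (n : nat).
Local Notation A := {mpoly F[n]}.
Implicit Types (C M : 'I_n -> F) (p R g : A) (P : {poly A}).

Definition evalMy M y : {poly A} -> F := fun P => (map_poly (meval M) P).[y].

(** [p] at M + y C for an indeterminate base point M, as a polynomial in y over the polynomials in
    M. *)
Definition shift_line C : A -> {poly A} :=
  mmap (@polyC A \o @mpolyC n F) (fun i => ('X_i)%:P + (C i)%:MP%:P * 'X).

(** The automorphism M -> M + y C of the polynomials in M and y, with inverse given by - C. It
    carries the prime constant [R] to [shift_line C R], which is therefore prime. *)
Definition shift_poly C (P : {poly A}) : {poly A} :=
  (map_poly (shift_line C) P).['X].

Lemma shift_line_is_additive C : additive (shift_line C).
Proof. exact: mmap_is_additive. Qed.

HB.instance Definition _ C :=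
  GRing.isAdditive.Build A {poly A} (shift_line C) (shift_line_is_additive C).

Lemma shift_line_is_multiplicative C : multiplicative (shift_line C).
Proof. exact: mmap_is_multiplicative. Qed.

HB.instance Definition _ C :=
  GRing.isMultiplicative.Build A {poly A} (shift_line C)
    (shift_line_is_multiplicative C).

Lemma shift_poly0 C : shift_poly C 0 = 0.
Proof. by rewrite /shift_poly map_poly0 horner0. Qed.

Lemma shift_polyD C : {morph shift_poly C : P Q / P + Q}.
Proof. by move=> P Q; rewrite /shift_poly rmorphD hornerD. Qed.

Lemma shift_polyM C : {morph shift_poly C : P Q / P * Q}.
Proof. by move=> P Q; rewrite /shift_poly rmorphM hornerM. Qed.

Lemma shift_polyC C p : shift_poly C p%:P = shift_line C p.
Proof. by rewrite /shift_poly map_polyC hornerC. Qed.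

Lemma shift_polyX C : shift_poly C 'X = 'X.
Proof. by rewrite /shift_poly map_polyX hornerX. Qed.

Lemma evalMy0 M y : evalMy M y 0 = 0.
Proof. by rewrite /evalMy map_poly0 horner0. Qed.

Lemma evalMyD M y : {morph evalMy M y : P Q / P + Q}.
Proof. by move=> P Q; rewrite /evalMy rmorphD hornerD. Qed.

Lemma evalMyM M y : {morph evalMy M y : P Q / P * Q}.
Proof. by move=> P Q; rewrite /evalMy rmorphM hornerM. Qed.

Lemma evalMyN M y : {morph evalMy M y : P / - P}.
Proof. by move=> P; rewrite /evalMy rmorphN hornerN. Qed.

Lemma evalMyC M y p : evalMy M y p%:P = p.@[M].
Proof. by rewrite /evalMy map_polyC hornerC. Qed.

Lemma evalMyX M y : evalMy M y 'X = y.
Proof. by rewrite /evalMy map_polyX hornerX. Qed.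

Lemma evalMy_shift_line C M y p :
  evalMy M y (shift_line C p) = p.@[fun i => M i + C i * y].
Proof.
pose f : {rmorphism A -> F} :=
  (horner_eval y \o map_poly (meval M)) \o shift_line C.
pose h : {rmorphism A -> F} := meval (fun i => M i + C i * y).
apply: (@rmorph_mpoly_eq _ _ _ f h) => [c|i]; rewrite /f /h /=.
  by rewrite /horner_eval /shift_line mmapC /= map_polyC hornerC /= !mevalC.
rewrite mevalXU; change (evalMy M y (shift_line C 'X_i) = M i + C i * y).
rewrite /shift_line mmapX mmap1U evalMyD evalMyM.
by rewrite !evalMyC evalMyX mevalC mevalXU.
Qed.

Local Opaque evalMy shift_poly.

Lemma evalMy_shift C M y P :
  evalMy M y (shift_poly C P) = evalMy (fun i => M i + C i * y) y P.
Proof.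
elim/poly_ind: P => [|P c IHP]; first by rewrite shift_poly0 !evalMy0.
rewrite shift_polyD shift_polyM shift_polyX shift_polyC.
rewrite evalMyD [RHS]evalMyD evalMyM [X in _ = X + _]evalMyM !evalMyX evalMyC.
by apply: congr2; [apply: congr2 => //; exact: IHP | exact: evalMy_shift_line].
Qed.

Local Transparent evalMy.
Lemma evalMy_eq0 P : (forall M y, evalMy M y P = 0) -> P = 0.
Proof.
move=> P0; apply/polyP => i; rewrite coef0; apply: mpoly_fun_eq0 => M.
have : map_poly (meval M) P = 0.
  by apply: poly_eq0_infinite => k; apply: P0.
by move/polyP/(_ i); rewrite coef0 coef_map.
Qed.

Lemma evalMy_inj P Q : (forall M y, evalMy M y P = evalMy M y Q) -> P = Q.
Proof.
move=> eqPQ; apply/eqP; rewrite -subr_eq0; apply/eqP/evalMy_eq0 => M y.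
by rewrite evalMyD evalMyN eqPQ subrr.
Qed.

Lemma evalMy_ext M M' y P : M =1 M' -> evalMy M y P = evalMy M' y P.
Proof.
move=> eqM; congr (_.[_]); apply/polyP => i; rewrite !coef_map /=.
exact: meval_eq.
Qed.

Local Opaque evalMy.
Lemma shift_polyK C : cancel (shift_poly C) (shift_poly (fun i => - C i)).
Proof.
move=> P; apply: evalMy_inj => M y; rewrite !evalMy_shift.
by apply: evalMy_ext => i; rewrite -addrA -mulrDl addNr mul0r addr0.
Qed.

Lemma shift_polyKV C : cancel (shift_poly (fun i => - C i)) (shift_poly C).
Proof.
move=> P; apply: evalMy_inj => M y; rewrite !evalMy_shift.
by apply: evalMy_ext => i; rewrite -addrA -mulrDl subrr mul0r addr0.
Qed.

Lemma shift_line_prime C R : irred_elt R -> prime_elt (shift_line C R).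
Proof.
pose N := fun i => - C i.
have lineK p : shift_poly N (shift_line C p) = p%:P.
  by rewrite -shift_polyC (shift_polyK C).
move/mpoly_irred_prime/prime_elt_polyC => -[R0 Ru RP]; split.
- by apply: contra_neq R0 => R0; rewrite -lineK R0 shift_poly0.
- apply: contra Ru => /unitrPr[q qE]; apply/unitrPr; exists (shift_poly N q).
  by rewrite -lineK -shift_polyM qE -polyC1 shift_polyC rmorph1.
- have back (a : {poly A}) :
    rdvd R%:P (shift_poly N a) -> rdvd (shift_line C R) a.
    case=> d dE; exists (shift_poly C d).
    by rewrite -(shift_polyKV C a) dE shift_polyM shift_polyC.
  move=> a b [c abE].
  have /RP[/back|/back] : rdvd R%:P (shift_poly N a * shift_poly N b).
    by exists (shift_poly N c); rewrite -shift_polyM abE shift_polyM lineK.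
  by left.
  by right.
Qed.

Lemma shift_line0 C p : (shift_line C p).[0] = p.
Proof.
pose f : {rmorphism A -> A} := horner_eval 0 \o shift_line C.
pose h : {rmorphism A -> A} := idfun.
apply: (@rmorph_mpoly_eq _ _ _ f h) => [c|i]; rewrite /f /h /= /horner_eval.
  by rewrite /shift_line mmapC hornerC.
by rewrite /shift_line mmapX mmap1U hornerD hornerM !hornerC hornerX mulr0 addr0.
Qed.

(* The resultant along the direction C, as a pointwise statement. *)
Lemma irred_no_common_zero C R g (M0 : 'I_n -> F) y0 :
  irred_elt R -> ~ rdvd R g ->
  R.@[fun i => M0 i + C i * y0] <> R.@[M0] ->
  exists2 r : A, r != 0 & forall M y, R.@[fun i => M i + C i * y] = 0 ->
    g.@[fun i => M i + C i * y] = 0 -> r.@[M] = 0.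
Proof.
move=> Rirr nRg R_y.
have fP := shift_line_prime C Rirr.
set f := shift_line C R in fP; set h := shift_line C g.
have szf : (1 < size f)%N.
  rewrite ltnNge; apply: contra_notN R_y => /size1_polyC fE.
  have eqf y : R.@[fun i => M0 i + C i * y] = (f`_0).@[M0].
    by rewrite -evalMy_shift_line -/f fE evalMyC coefC.
  rewrite eqf -(eqf 0); apply: meval_eq => i; by rewrite mulr0 addr0.
suff [r r0 [u [v uvE]]] : exists2 r : A, r != 0 & exists u v : {poly A}, u * f + v * h = r%:P.
  exists r => // M y fz hz.
  have killed w p : p.@[fun i => M i + C i * y] = 0 ->
      evalMy M y (w * shift_line C p) = 0.
    by move=> pz; rewrite evalMyM (evalMy_shift_line C M y p) pz mulr0.
  rewrite -(evalMyC M y) -uvE evalMyD.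
  by rewrite -[RHS]addr0; apply: congr2; [exact: (killed u R fz)|exact: (killed v g hz)].
have [/Bezout_coprimepP[[u v] /=]|ncop] := boolP (coprimep f h).
  by rewrite -size_poly_eq1 => /size_poly1P[c c0 cE]; exists c => //; exists u, v.
case/negP: ncop; apply: (prime_poly_coprime fP szf).
(* At y = 0 the shifts return to [R] and [g], so the cofactor specialises as well. *)
case=> e hE; apply: nRg; exists e.[0].
apply: (etrans (esym (shift_line0 C g))).
apply: (etrans (congr1 (horner^~ 0) hE)).
apply: (etrans (hornerM _ _ _)).
by apply: (congr1 (fun z => z * e.[0])); apply: shift_line0.
Qed.
End Translation.

(** * Functions that are polynomial on segments *)

Section Regular.
Variables (F : numFieldType) (I : Type).
Implicit Types (f g : (I -> F) -> F) (a b z : I -> F).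

Definition segm a b (t : F) : I -> F := fun i => a i + t * (b i - a i).

(** Polynomiality on segments is all that the genericity arguments need: it is stable under the ring
    operations, and two nonempty nonvanishing loci always meet on a segment joining them. *)
Definition regular f :=
  forall a b, exists P : {poly F}, forall t, f (segm a b t) = P.[t].

Lemma segm0 a b : segm a b 0 = a.
Proof. by apply: functional_extensionality => i; rewrite /segm mul0r addr0. Qed.

Lemma segm1 a b : segm a b 1 = b.
Proof. by apply: functional_extensionality => i; rewrite /segm mul1r addrC subrK. Qed.

Lemma regular_const c : regular (fun=> c).
Proof. by move=> a b; exists c%:P => t; rewrite hornerC. Qed.

Lemma regular_coord i : regular (fun z => z i).
Proof.
move=> a b; exists ((a i)%:P + 'X * (b i - a i)%:P) => t.
by rewrite hornerD hornerM hornerX !hornerC.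
Qed.

Lemma regularD f g : regular f -> regular g -> regular (fun z => f z + g z).
Proof.
move=> rf rg a b; have [P fP] := rf a b; have [Q gQ] := rg a b.
by exists (P + Q) => t; rewrite hornerD fP gQ.
Qed.

Lemma regularM f g : regular f -> regular g -> regular (fun z => f z * g z).
Proof.
move=> rf rg a b; have [P fP] := rf a b; have [Q gQ] := rg a b.
by exists (P * Q) => t; rewrite hornerM fP gQ.
Qed.

Lemma regularN f : regular f -> regular (fun z => - f z).
Proof. by move=> rf a b; have [P fP] := rf a b; exists (- P) => t; rewrite hornerN fP. Qed.

Lemma regularB f g : regular f -> regular g -> regular (fun z => f z - g z).
Proof. by move=> rf rg; apply: regularD => //; apply: regularN. Qed.

Lemma regular_sum (J : Type) (r : seq J) (P : pred J) (f : J -> (I -> F) -> F) :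
  (forall j, regular (f j)) -> regular (fun z => \sum_(j <- r | P j) f j z).
Proof.
move=> rf; elim: r => [|j r IHr] a b.
  by exists 0 => t; rewrite big_nil horner0.
have [Q fQ] := IHr a b; have [T fT] := rf j a b.
exists (if P j then T + Q else Q) => t; rewrite big_cons fQ fT.
by case: ifP => //; rewrite hornerD.
Qed.

Lemma regular_prod (J : Type) (r : seq J) (P : pred J) (f : J -> (I -> F) -> F) :
  (forall j, regular (f j)) -> regular (fun z => \prod_(j <- r | P j) f j z).
Proof.
move=> rf; elim: r => [|j r IHr] a b.
  by exists 1 => t; rewrite big_nil hornerC.
have [Q fQ] := IHr a b; have [T fT] := rf j a b.
exists (if P j then T * Q else Q) => t; rewrite big_cons fQ fT.
by case: ifP => //; rewrite hornerM.
Qed.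

Lemma regularX f k : regular f -> regular (fun z => f z ^+ k).
Proof.
by move=> rf a b; have [P fP] := rf a b; exists (P ^+ k) => t; rewrite horner_exp fP.
Qed.

Lemma regular_det k (f : 'I_k -> 'I_k -> (I -> F) -> F) :
  (forall i j, regular (f i j)) ->
  regular (fun z => \det (\matrix_(i, j) f i j z)).
Proof.
move=> rf; rewrite /determinant; apply: regular_sum => s.
apply: regularM; first exact: regular_const.
move=> a b; have [P fP] := @regular_prod _ (index_enum 'I_k) xpredT (fun i => f i ((s : {perm 'I_k}) i)) (fun i => rf i _) a b.
by exists P => t; rewrite -fP; apply: eq_bigr => i _; rewrite mxE.
Qed.

Lemma regular_meval n (p : {mpoly F[n]}) (f : 'I_n -> (I -> F) -> F) :
  (forall i, regular (f i)) -> regular (fun z => p.@[fun i => f i z]).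
Proof.
move=> rf a b; have [P] : exists P : {poly F}, forall t,
    \sum_(m <- msupp p) p@_m * \prod_(i < n) f i (segm a b t) ^+ m i = P.[t].
  apply: (@regular_sum _ _ _ (fun m z => p@_m * \prod_(i < n) f i z ^+ m i)) => m.
  by apply: regularM; [exact: regular_const|apply: regular_prod => i; exact: regularX].
by move=> PE; exists P => t; rewrite mevalE.
Qed.

Lemma regular_ext f g : (forall z, f z = g z) -> regular f -> regular g.
Proof. by move=> fg rf a b; have [P fP] := rf a b; exists P => t; rewrite -fg. Qed.

Lemma poly_common_point (P : {poly F}) : P != 0 -> exists k : nat, P.[k%:R] != 0.
Proof.
move/eqP => P0; apply: NNPP => nk; apply/P0/poly_eq0_infinite => k.
by apply/eqP; apply: contraT => Pk; case: nk; exists k.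
Qed.

Lemma regular_neq0_and f g a b : regular f -> regular g ->
  f a != 0 -> g b != 0 -> exists c, f c != 0 /\ g c != 0.
Proof.
move=> rf rg fa gb; have [P fP] := rf a b; have [Q gQ] := rg a b.
have P0 : P != 0.
  by apply: contraNneq fa => P0; rewrite -(segm0 a b) fP P0 horner0.
have Q0 : Q != 0.
  by apply: contraNneq gb => Q0; rewrite -(segm1 a b) gQ Q0 horner0.
have [k] := poly_common_point (mulf_neq0 P0 Q0).
by rewrite hornerM mulf_eq0 negb_or -fP -gQ => /andP[]; exists (segm a b k%:R).
Qed.

Lemma regular_neq0_all (J : finType) (f : J -> (I -> F) -> F) :
  (forall j, regular (f j)) -> (forall j, exists a, f j a != 0) ->
  exists c, forall j, f j c != 0.
Proof.
move=> rf fn0; have [c] : exists c, \prod_(j : J) f j c != 0.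
  elim: (index_enum J) => [|j r [c fc]].
    by exists (fun=> 0); rewrite big_nil oner_eq0.
  have [a fa] := fn0 j.
  have [d [fd pd]] := regular_neq0_and (rf j)
    (@regular_prod _ r xpredT f rf) fa fc.
  by exists d; rewrite big_cons mulf_neq0.
move/prodf_neq0 => fc; exists c => j; exact: fc.
Qed.

Lemma regular_dense f g b : regular f -> regular g -> g b != 0 ->
  (forall z, g z != 0 -> f z = 0) -> forall z, f z = 0.
Proof.
move=> rf rg gb fg z; apply/eqP; apply: contraT => fz.
have [c [fc gc]] := regular_neq0_and rf rg fz gb.
by rewrite fg ?eqxx in fc.
Qed.
End Regular.

(** * Polynomials on frames *)

Section MpolyDeriv.
Variables (F : numFieldType) (n : nat).
Implicit Types p : {mpoly F[n]}.

Lemma msize_mderiv i p : (msize p^`M(i) <= (msize p).-1)%N.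
Proof.
rewrite msizeE; apply/bigmax_leqP_seq => m; rewrite mcoeff_msupp mcoeff_mderiv => pm _.
have : (m + U_(i))%MM \in msupp p.
  by rewrite mcoeff_msupp; apply: contraNneq pm => ->; rewrite mul0rn.
move/msize_mdeg_lt; rewrite mdegD mdeg1; case: (msize p) => // s.
by rewrite addn1 ltnS.
Qed.

Lemma mderiv_eq0_const p : (forall i, p^`M(i) = 0) -> p = (p@_0)%:MP.
Proof.
move=> dp; apply/mpolyP => m; rewrite mcoeffC.
have [->|m0] := eqVneq m 0%MM; first by rewrite mulr1.
rewrite mulr0; have [i mi] : exists i, m i != 0%N.
  apply/existsP; apply: contraNT m0; rewrite negb_exists => /forallP mz.
  by apply/eqP/mnmP => i; rewrite mnmE; apply/eqP; rewrite -[_ == _]negbK; apply: mz.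
have := congr1 (mcoeff (m - U_(i))%MM) (dp i); rewrite mcoeff0 mcoeff_mderiv.
have -> : (m - U_(i) + U_(i) = m)%MM.
  apply: submK; apply/mnm_lepP => j; rewrite mnmE; case: eqP => // <-.
  by rewrite lt0n.
by move/eqP; rewrite mulrn_eq0 /= => /eqP.
Qed.

(** All iterated partial derivatives of [p] vanish at [v], so its Taylor expansion there is zero;
    the induction on the size replaces the expansion. *)
Lemma mpoly_eq0_of_deriv_closed (P : {mpoly F[n]} -> Prop) v p :
  (forall p, P p -> p.@[v] = 0) -> (forall p i, P p -> P p^`M(i)) -> P p -> p = 0.
Proof.
move=> P0 Pd; move: {2}(msize p) (leqnn (msize p)) => s.
elim: s p => [|s IHs] p; first by rewrite leqn0 msize_poly_eq0 => /eqP.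
move=> szp Pp; have dp i : p^`M(i) = 0.
  by apply: IHs (Pd _ i Pp); apply: leq_trans (msize_mderiv _ _) _; case: (msize p) szp.
by have := P0 p Pp; rewrite (mderiv_eq0_const dp) mevalC => ->; rewrite mpolyC0.
Qed.
End MpolyDeriv.

Section Frames.
Variables (k n : nat).
Local Notation J := ('I_k * Wedge2 n)%type.
Implicit Types (M S : frame k n) (p : {mpoly CC[nvars k n]}) (u v : 'I_n -> CC).

Definition ev p M : CC := p.@[frame_pt M].

Definition pairing (f : Wedge2 n -> CC) u v := \sum_w f w * pl u v w.

Definition dM (r : 'I_k) (w : Wedge2 n) p := p^`M(enum_rank (r, w)).

Definition fcurve (c : 'I_k -> Wedge2 n -> {poly CC}) p : {poly CC} :=
  mcurve (fun i => c (enum_val i).1 (enum_val i).2) p.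

Lemma horner_fcurve c p t : (fcurve c p).[t] = ev p (fun r w => (c r w).[t]).
Proof. exact: horner_mcurve. Qed.

Lemma deriv_fcurve c p t : (fcurve c p)^`().[t] =
  \sum_r \sum_w ev (dM r w p) (fun r w => (c r w).[t]) * (c r w)^`().[t].
Proof.
rewrite /fcurve deriv_mcurve horner_sum pair_big /=.
rewrite (reindex (@enum_rank J)) /=; last exact/onW_bij/enum_rank_bij.
apply: eq_bigr => -[r w] _; rewrite hornerM horner_mcurve /= enum_rankK /=.
by congr (_ * _).
Qed.

Lemma ev_ext p M M' : (forall r w, M r w = M' r w) -> ev p M = ev p M'.
Proof. by move=> eqM; apply: meval_eq => i; apply: eqM. Qed.

Lemma evM p p' M : ev (p * p') M = ev p M * ev p' M.
Proof. exact: mevalM. Qed.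

Lemma evX p e M : ev (p ^+ e) M = ev p M ^+ e.
Proof. by rewrite /ev rmorphXn. Qed.

Lemma pairing_eq f f' u v : (forall w, f w = f' w) -> pairing f u v = pairing f' u v.
Proof. by move=> eqf; apply: eq_bigr => w _; rewrite eqf. Qed.

Lemma pairingZ a f u v : pairing (fun w => a * f w) u v = a * pairing f u v.
Proof. by rewrite /pairing mulr_sumr; apply: eq_bigr => w _; rewrite mulrA. Qed.

Lemma pairing_add f f' u v :
  pairing (fun w => f w + f' w) u v = pairing f u v + pairing f' u v.
Proof. by rewrite /pairing -big_split; apply: eq_bigr => w _; rewrite mulrDl. Qed.

Lemma pairing_delta w0 a u v :
  pairing (fun w => a *+ (w == w0)) u v = a * pl u v w0.
Proof.
rewrite /pairing (bigD1 w0) //= eqxx mulr1n big1 ?addr0 // => w /negPf->.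
by rewrite mulr0n mul0r.
Qed.

Definition in_res M u v := (exists w, pl u v w != 0) /\ (forall r, pairing (M r) u v = 0).

Lemma in_resP M : res_locus M <-> exists u v, in_res M u v.
Proof. by split=> [[u [v [h1 h2]]]|[u [v [h1 h2]]]]; exists u, v. Qed.

(** Vanishing on the translate of X by [S]. *)
Definition vanish_at S p :=
  forall M u v, in_res M u v -> ev p (fun r w => M r w + S r w) = 0.

Definition upd (r0 : 'I_k) (w0 : Wedge2 n) : frame k n :=
  fun r w => ((r == r0) && (w == w0))%:R.

Lemma sum_upd (g : 'I_k -> Wedge2 n -> CC) r0 w0 :
  \sum_r \sum_w g r w * upd r0 w0 r w = g r0 w0.
Proof.
rewrite (bigD1 r0) //= (bigD1 w0) //= /upd !eqxx mulr1 big1 => [|w /negPf->].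
  rewrite addr0 big1 ?addr0 // => r /negPf rr0; rewrite big1 // => w _.
  by rewrite rr0 mulr0.
by rewrite andbF mulr0.
Qed.

Lemma vanish_tangent S p (c : 'I_k -> Wedge2 n -> {poly CC}) M :
  (forall t : CC, exists u v, in_res (fun r w => (c r w).[t]) u v) ->
  vanish_at S p ->
  (forall r w, (c r w).[0] = M r w) ->
  \sum_r \sum_w ev (dM r w p) (fun r w => M r w + S r w) * (c r w)^`().[0] = 0.
Proof.
move=> cres vp c0; pose cS r w := c r w + (S r w)%:P.
have ev0 : fcurve cS p = 0.
  apply: poly_eq0_infinite => j; rewrite horner_fcurve.
  have [u [v res_uv]] := cres j%:R; rewrite -[RHS](vp _ u v res_uv).
  by apply: ev_ext => r w; rewrite hornerD hornerC.
have := deriv_fcurve cS p 0; rewrite ev0 deriv0 horner0 => e0.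
rewrite [RHS]e0; apply: eq_bigr => r _; apply: eq_bigr => w _.
rewrite derivD derivC addr0; congr (_ * _); apply: ev_ext => r' w'.
by rewrite hornerD hornerC c0.
Qed.

(** The frames killed by a fixed u /\ v form a linear space, so the gradient in a row is orthogonal
    to every vector killed by u /\ v. The vector [d] with entries [pl u v w'] at [w] and
    [- pl u v w] at [w'] is one of them. *)
Lemma grad_proportional S p M u v r w w' : vanish_at S p -> in_res M u v ->
  pl u v w' * ev (dM r w p) (fun r w => M r w + S r w) =
  pl u v w * ev (dM r w' p) (fun r w => M r w + S r w).
Proof.
move=> vp [uv0 resM].
pose d r' x : CC := pl u v w' * upd r w r' x - pl u v w * upd r w' r' x.
have pd r' : pairing (d r') u v = 0.
  rewrite (@pairing_eq _ (fun x => pl u v w' *+ ((r' == r) && (x == w))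
     - pl u v w *+ ((r' == r) && (x == w')))) ; last first.
    by move=> x; rewrite /d /upd !mulr_natr.
  rewrite (@pairing_add _ (fun x => - (pl u v w *+ ((r' == r) && (x == w'))))).
  case: (r' == r) => /=; last by rewrite /pairing !big1 ?addr0 // => x _; rewrite ?oppr0 mul0r.
  rewrite pairing_delta (@pairing_eq _ (fun x => (- pl u v w) *+ (x == w'))); last first.
    by move=> x; rewrite mulNrn.
  by rewrite pairing_delta; ring.
have dsum : \sum_r' \sum_x ev (dM r' x p) (fun r w => M r w + S r w) * d r' x = 0.
  rewrite -[RHS](@vanish_tangent S p (fun r' x => (M r' x)%:P + (d r' x)%:P * 'X) M) //.
  - apply: eq_bigr => r' _; apply: eq_bigr => x _; congr (_ * _).
    by rewrite derivD derivC add0r derivM derivX derivC mul0r add0r mulr1 hornerC.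
  - move=> t; exists u, v; split=> // r'.
    rewrite (@pairing_eq _ (fun x => M r' x + t * d r' x)).
      by rewrite (@pairing_add _ (fun x => t * d r' x)) pairingZ resM pd mulr0 addr0.
    by move=> x; rewrite hornerD hornerM hornerX !hornerC mulrC.
  - by move=> r' x; rewrite hornerD hornerM hornerX !hornerC mulr0 addr0.
apply/eqP; rewrite -subr_eq0 -[X in _ == X]dsum; apply/eqP.
rewrite -(sum_upd (fun r' x => ev (dM r' x p) (fun r w => M r w + S r w)) r w).
rewrite -(sum_upd (fun r' x => ev (dM r' x p) (fun r w => M r w + S r w)) r w').
rewrite !mulr_sumr -sumrB; apply: eq_bigr => r' _.
rewrite !mulr_sumr -sumrB; apply: eq_bigr => x _; rewrite /d; ring.
Qed.

(** Moves u /\ v to (u + t u') /\ (v + t v') and corrects column [w0] of the frame to stay in X. As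
    [u'] and [v'] vanish at the two indices of [w0], the coordinate divided by is constant in t and
    the correction is polynomial. *)
Lemma tangent_move S p M u v u' v' w0 : vanish_at S p -> in_res M u v ->
  pl u v w0 != 0 ->
  (forall i, (i == (val w0).1) || (i == (val w0).2) -> u' i = 0 /\ v' i = 0) ->
  \sum_r ev (dM r w0 p) (fun r w => M r w + S r w) *
     (pairing (M r) u' v + pairing (M r) u v') = 0.
Proof.
move=> vp [uv0 resM] plw0 uv'0.
pose A r := pairing (M r) u' v + pairing (M r) u v'.
pose Q r : {poly CC} := (A r)%:P * 'X + (pairing (M r) u' v')%:P * ('X * 'X).
pose ut (t : CC) i := u i + t * u' i; pose vt (t : CC) i := v i + t * v' i.
have QE r t : (Q r).[t] = pairing (M r) (ut t) (vt t).
  rewrite /Q hornerD !hornerM !hornerX !hornerC /A.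
  have -> : pairing (M r) (ut t) (vt t) = pairing (M r) u v
      + (pairing (M r) u' v + pairing (M r) u v') * t + pairing (M r) u' v' * (t * t).
    rewrite /pairing -!big_split /= !mulr_suml -!big_split /=.
    by apply: eq_bigr => w _; rewrite /pl /ut /vt; ring.
  by rewrite resM add0r.
have plt t : pl (ut t) (vt t) w0 = pl u v w0.
  have [|u1 v1] := uv'0 (val w0).1; first by rewrite eqxx.
  have [|u2 v2] := uv'0 (val w0).2; first by rewrite eqxx orbT.
  by rewrite /pl /ut /vt u1 v1 u2 v2 !mulr0 !addr0.
pose c r w : {poly CC} := (M r w)%:P - ((pl u v w0)^-1 *+ (w == w0))%:P * Q r.
have cres (t : CC) : exists u v, in_res (fun r w => (c r w).[t]) u v.
  exists (ut t), (vt t); split; first by exists w0; rewrite plt.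
  move=> r; rewrite (@pairing_eq _ (fun x => M r x + (- ((pl u v w0)^-1 * (Q r).[t])) *+ (x == w0))).
    rewrite pairing_add pairing_delta -QE plt.
    by rewrite mulNr mulrAC mulVf // mul1r subrr.
  move=> x; rewrite /c hornerD hornerN hornerM !hornerC.
  by case: (x == w0); rewrite ?mulr1n // mulr0n mul0r oppr0 mulr0n.
have c0 r w : (c r w).[0] = M r w.
  rewrite /c hornerD hornerN hornerM !hornerC /Q hornerD !hornerM.
  by rewrite !hornerX !mulr0 addr0 mulr0 subr0.
have dc r w : (c r w)^`().[0] = - ((pl u v w0)^-1 * A r) *+ (w == w0).
  rewrite /c derivB derivC sub0r derivM derivC mul0r add0r hornerN hornerM hornerC.
  rewrite /Q derivD !derivM !derivC !mul0r !add0r derivX !hornerE /=.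
  rewrite !(mulr0, addr0, mul0r, mulr1, mul0rn) /=.
  by case: (w == w0); rewrite ?mulr1n // !mulr0n mul0r oppr0.
have e0 := @vanish_tangent S p c M cres vp c0.
apply: (mulfI (_ : - (pl u v w0)^-1 != 0)).
  by rewrite oppr_eq0 invr_eq0.
rewrite mulr0 -[RHS]e0 mulr_sumr; apply: eq_bigr => r _.
rewrite (bigD1 w0) //= big1 ?addr0 => [|w /negPf ww0].
  by rewrite dc eqxx mulr1n /A; ring.
by rewrite dc ww0 mulr0n mulr0.
Qed.

End Frames.

(** * Parametrisation and irreducibility of X *)

Section Parametrization.
Variables (k n : nat) (w0 : Wedge2 n).
Local Notation J := ('I_k * Wedge2 n)%type.
Local Notation Z := (J + ('I_n + 'I_n))%type.
Implicit Types (M S : frame k n) (p : {mpoly CC[nvars k n]}) (u v : 'I_n -> CC)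
  (z : Z -> CC) (w : Wedge2 n).

Definition zN z : frame k n := fun r w => z (inl (r, w)).
Definition zu z : 'I_n -> CC := fun i => z (inr (inl i)).
Definition zv z : 'I_n -> CC := fun i => z (inr (inr i)).

Definition mkz M u v : Z -> CC := fun x =>
  match x with
  | inl (r, w) => M r w
  | inr (inl i) => u i
  | inr (inr i) => v i
  end.

(** Each row of an arbitrary frame is scaled by the [w1] coordinate of u /\ v and then corrected in
    column [w1] so that u /\ v kills it; the scaling avoids a division. *)
Definition Phi w1 z : frame k n := fun r w =>
  pl (zu z) (zv z) w1 * zN z r w - pairing (zN z r) (zu z) (zv z) *+ (w == w1).

Lemma regular_pl2 (a b : 'I_n -> (Z -> CC) -> CC) w :
  (forall i, regular (a i)) -> (forall i, regular (b i)) ->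
  regular (fun z => pl (fun i => a i z) (fun i => b i z) w).
Proof. by move=> ra rb; apply: regularB; apply: regularM. Qed.

Lemma regular_pl w : regular (fun z => pl (zu z) (zv z) w).
Proof.
by apply: (@regular_pl2 (fun i z => z (inr (inl i))) (fun i z => z (inr (inr i))));
   move=> i; apply: regular_coord.
Qed.

Lemma regular_pairing (f : Wedge2 n -> (Z -> CC) -> CC) (a b : 'I_n -> (Z -> CC) -> CC) :
  (forall w, regular (f w)) ->
  (forall i, regular (a i)) -> (forall i, regular (b i)) ->
  regular (fun z => pairing (fun w => f w z) (fun i => a i z) (fun i => b i z)).
Proof.
by move=> rf ra rb; apply: regular_sum => w; apply: regularM => //; apply: regular_pl2.
Qed.

Lemma regular_Phi w1 r w : regular (fun z => Phi w1 z r w).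
Proof.
apply: regularB.
  by apply: regularM; [exact: regular_pl|exact: regular_coord].
case: (w == w1); last exact: regular_const.
by apply: (@regular_pairing (fun w z => z (inl (r, w)))
  (fun i z => z (inr (inl i))) (fun i z => z (inr (inr i)))) => x; apply: regular_coord.
Qed.

Lemma regular_ev_Phi p w1 : regular (fun z => ev p (Phi w1 z)).
Proof. by apply: regular_meval => i; apply: regular_Phi. Qed.

Lemma Phi_res w1 z : pl (zu z) (zv z) w1 != 0 -> in_res (Phi w1 z) (zu z) (zv z).
Proof.
move=> pl1; split; first by exists w1.
move=> r; rewrite (@pairing_eq _ _ (fun x => pl (zu z) (zv z) w1 * zN z r x
    + (- pairing (zN z r) (zu z) (zv z)) *+ (x == w1))).
  by rewrite pairing_add pairing_delta pairingZ; ring.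
by move=> x; rewrite mulNrn.
Qed.

Lemma res_Phi w1 M u v : in_res M u v -> pl u v w1 != 0 ->
  exists2 z, forall r w, Phi w1 z r w = M r w & zu z = u /\ zv z = v.
Proof.
move=> [_ resM] pl1; exists (mkz (fun r w => (pl u v w1)^-1 * M r w) u v) => // r w.
rewrite /Phi /= /zN /=.
rewrite (_ : pairing _ _ _ = 0) ?mul0rn ?subr0 ?mulrA ?divff ?mul1r //.
by rewrite (@pairingZ _ (pl u v w1)^-1 (M r)) resM mulr0.
Qed.

Lemma pl0_neq0 : exists z, pl (zu z) (zv z) w0 != 0.
Proof.
exists (mkz (fun _ _ => 0) (fun i => (i == (val w0).1)%:R) (fun i => (i == (val w0).2)%:R)).
rewrite /pl /zu /zv /= !eqxx mulr1 (negPf (_ : (val w0).2 != (val w0).1)).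
  by rewrite mul0r subr0 oner_eq0.
by rewrite eq_sym; apply: contraTneq (valP w0) => ->; rewrite ltnn.
Qed.

Definition vanishing p := forall M, res_locus M -> ev p M = 0.

(** Any two charts overlap: a frame of X with nonzero [w1] coordinate is deformed in the chart [w1]
    to one with nonzero [w0] coordinate as well, which also lies in the chart [w0]. Vanishing on a
    nonempty open part of one chart therefore propagates to all of X. *)
Lemma vanish_at_chart S p g z2 : regular g -> g z2 != 0 ->
  (forall z, pl (zu z) (zv z) w0 != 0 -> g z != 0 ->
     ev p (fun r w => Phi w0 z r w + S r w) = 0) -> vanish_at S p.
Proof.
move=> rg gz2 v0.
have rS w1 : regular (fun z => ev p (fun r w => Phi w1 z r w + S r w)).
  by apply: regular_meval => i; apply: regularD; [exact: regular_Phi|exact: regular_const].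
have {}v0 z : pl (zu z) (zv z) w0 != 0 -> ev p (fun r w => Phi w0 z r w + S r w) = 0.
  move=> plz; have [z3 [g1 g2]] := regular_neq0_and (regular_pl w0) rg plz gz2.
  apply: (@regular_dense _ _ (fun z => ev p (fun r w => Phi w0 z r w + S r w))
    (fun z => pl (zu z) (zv z) w0 * g z) z3) => //.
  - by apply: regularM => //; apply: regular_pl.
  - by rewrite mulf_neq0.
  - by move=> y; rewrite mulf_eq0 negb_or => /andP[y1 y0]; apply: v0.
move=> M u v resM; have [[w1 pl1] _] := resM.
have [z ME _] := res_Phi resM pl1.
rewrite -(@ev_ext _ _ _ (fun r w => Phi w1 z r w + S r w)); last first.
  by move=> r w; rewrite ME.
have [z0 pl00] := pl0_neq0.
have [|z1 [g1 g0]] := @regular_neq0_and _ _ _ _ (mkz M u v) z0 (regular_pl w1) (regular_pl w0) _ pl00.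
  by [].
apply: (@regular_dense _ _ (fun z => ev p (fun r w => Phi w1 z r w + S r w))
  (fun z => pl (zu z) (zv z) w1 * pl (zu z) (zv z) w0) z1).
- exact: rS.
- by apply: regularM; apply: regular_pl.
- by rewrite mulf_neq0.
- move=> y; rewrite mulf_eq0 negb_or => /andP[y1 y0].
  have [y' yE [yu yv]] := res_Phi (Phi_res y1) y0.
  rewrite -(@ev_ext _ _ _ (fun r w => Phi w0 y' r w + S r w)); last first.
    by move=> r w; rewrite yE.
  by apply: v0; rewrite yu yv.
Qed.

Lemma vanishing_at0 p : vanish_at (fun _ _ => 0) p <-> vanishing p.
Proof.
split=> vp.
  move=> M /in_resP[u [v resM]]; rewrite -[RHS](vp M u v resM).
  by apply: ev_ext => r w; rewrite addr0.
move=> M u v resM; rewrite -[RHS](vp M); last by apply/in_resP; exists u, v.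
by apply: ev_ext => r w; rewrite addr0.
Qed.

Lemma vanishing_chart p g z1 : regular g -> g z1 != 0 ->
  (forall z, pl (zu z) (zv z) w0 != 0 -> g z != 0 -> ev p (Phi w0 z) = 0) ->
  vanishing p.
Proof.
move=> rg gz1 v0; apply/vanishing_at0/(vanish_at_chart rg gz1) => z plz gz.
by rewrite -[RHS](v0 z) //; apply: ev_ext => r w; rewrite addr0.
Qed.

Lemma not_vanishing p : ~ vanishing p ->
  exists2 z, pl (zu z) (zv z) w0 != 0 & ev p (Phi w0 z) != 0.
Proof.
move=> nv; apply: NNPP => nz; apply: nv.
apply: (@vanishing_chart _ (fun=> 1) (fun=> 0)) => [||z zpl _].
- exact: regular_const.
- exact: oner_neq0.
by apply/eqP; apply: contraT => evz; case: nz; exists z.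
Qed.

Lemma vanishing_generic p g z1 : ~ vanishing p -> regular g -> g z1 != 0 ->
  exists z, [/\ pl (zu z) (zv z) w0 != 0, ev p (Phi w0 z) != 0 & g z != 0].
Proof.
move=> /not_vanishing[z2 pl2 ev2] rg gz1.
have [z [+ gz]] := regular_neq0_and
  (regularM (regular_pl w0) (regular_ev_Phi p w0)) rg (mulf_neq0 pl2 ev2) gz1.
by rewrite mulf_eq0 negb_or => /andP[? ?]; exists z.
Qed.

(** A single parameter of the chart avoids the zeros of both factors, unless one of them vanishes on
    X. *)
Lemma vanishing_prime p p' : vanishing (p * p') -> vanishing p \/ vanishing p'.
Proof.
move=> vpp; apply: NNPP => /not_or_and[np np'].
have [z2 _ ev2] := not_vanishing np'.
have [z [plz pz pz']] := vanishing_generic np (regular_ev_Phi p' w0) ev2.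
have /eqP := vpp (Phi w0 z) (proj2 (in_resP _) (ex_intro _ _ (ex_intro _ _ (Phi_res plz)))).
by rewrite evM mulf_eq0 (negPf pz) (negPf pz').
Qed.

End Parametrization.

(** * Transversality and dominance *)

Section Dominance.
Variable m : nat.
Local Notation k := (m + m).+1.
Local Notation n := m.+2.
Local Notation J := ('I_k * Wedge2 n)%type.
Local Notation Z := (J + ('I_n + 'I_n))%type.
Implicit Types (M S : frame k n) (p : {mpoly CC[nvars k n]}) (u v : 'I_n -> CC).

Definition w01 : Wedge2 n := exist _ (ord0, lift ord0 ord0) isT.
Definition tail (j : 'I_m) : 'I_n := lift ord0 (lift ord0 j).
Definition delta (i : 'I_n) : 'I_n -> CC := fun l => (l == i)%:R.

(* Invertible exactly when the rows other than [ord0] cut the Grassmannian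
   transversally at [u /\ v], in the chart where the [w01]-coordinate is nonzero. *)
Definition transv M u v : 'M[CC]_(m + m) := \matrix_(r, c)
  match split c with
  | inl j => pairing (M (lift ord0 r)) (delta (tail j)) v
  | inr j => pairing (M (lift ord0 r)) u (delta (tail j))
  end.

Lemma regular_transv :
  regular (fun z : Z -> CC => \det (transv (Phi w01 z) (zu z) (zv z))).
Proof.
apply: (@regular_det _ _ _ (fun r c (z : Z -> CC) => match split c with
  | inl j => pairing (Phi w01 z (lift ord0 r)) (delta (tail j)) (zv z)
  | inr j => pairing (Phi w01 z (lift ord0 r)) (zu z) (delta (tail j))
  end)) => r c; case: split => j.
- apply: (@regular_pairing _ _ (fun w z => Phi w01 z (lift ord0 r) w)
    (fun i _ => delta (tail j) i) (fun i z => z (inr (inr i)))) => [w|i|i].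
  + exact: regular_Phi.
  + exact: regular_const.
  + exact: regular_coord.
- apply: (@regular_pairing _ _ (fun w z => Phi w01 z (lift ord0 r) w)
    (fun i z => z (inr (inl i))) (fun i _ => delta (tail j) i)) => [w|i|i].
  + exact: regular_Phi.
  + exact: regular_coord.
  + exact: regular_const.
Qed.

Definition w1tail (j : 'I_m) : Wedge2 n := exist _ (lift ord0 ord0, tail j) isT.
Definition w0tail (j : 'I_m) : Wedge2 n := exist _ (ord0, tail j) isT.

Definition Ntransv : frame k n := fun r w =>
  match unlift ord0 r with
  | None => 0
  | Some r' => match split r' with
     | inl j => (w == w1tail j)%:R
     | inr j => (w == w0tail j)%:R
     end
  end.

(** At u = e_0, v = e_1, the rows e_1 /\ e_j and e_0 /\ e_j of [Ntransv] make the matrix diagonal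
    with entries -1 and 1. *)
Lemma transv_neq0 : exists z : Z -> CC,
  \det (transv (Phi w01 z) (zu z) (zv z)) != 0.
Proof.
exists (mkz Ntransv (delta ord0) (delta (lift ord0 ord0))).
set z := mkz _ _ _.
have pN (x : Wedge2 n) a b : pairing (fun w => (w == x)%:R) a b = pl a b x.
  by rewrite -[RHS]mul1r -(pairing_delta x 1 a b).
have NE r w : Phi w01 z r w = Ntransv r w.
  rewrite /Phi; have -> : pl (zu z) (zv z) w01 = 1.
    by rewrite /pl /zu /zv /= /delta /= ?eqxx ?mulr1 ?mul0r ?subr0.
  rewrite mul1r (_ : pairing _ _ _ = 0) ?mul0rn ?subr0 //.
  rewrite (@pairing_eq _ _ (Ntransv r)) // /Ntransv.
  case: unliftP => [r' _|_]; last by rewrite /pairing big1 // => *; rewrite mul0r.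
  by case: split => j; rewrite pN /pl /zu /zv /= /delta /= ?eqxx ?mul0r ?mulr0 ?subr0.
have -> : transv (Phi w01 z) (zu z) (zv z)
    = diag_mx (\row_c match split c with inl _ => -1 | inr _ => 1 end).
  apply/matrixP => r c; rewrite !mxE.
  have NE' a b : pairing (Phi w01 z (lift ord0 r)) a b = pairing (Ntransv (lift ord0 r)) a b.
    by apply: pairing_eq => w; apply: NE.
  have rcE : (r == c) = (split r == split c) by rewrite (inj_eq (can_inj (@splitK _ _))).
  have pNt a b : pairing (Ntransv (lift ord0 r)) a b =
      match split r with inl j => pl a b (w1tail j) | inr j => pl a b (w0tail j) end.
    by rewrite /Ntransv liftK; case: split => j; apply: pN.
  rewrite rcE; case: (split c) => j; rewrite NE' pNt; case: (split r) => i.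
  all: rewrite /pl /zu /zv /= /delta /= ?(mul0r, mulr0, mul1r, mulr1, subr0, sub0r).
  - have -> : (tail i == tail j) = (inl i == inl j :> 'I_m + 'I_m).
      by rewrite (inj_eq lift_inj) (inj_eq lift_inj).
    by rewrite mulNrn.
  - by rewrite ?oppr0.
  - by rewrite ?oppr0.
  - by rewrite (inj_eq lift_inj) (inj_eq lift_inj).
rewrite det_diag; apply/prodf_neq0 => c _; rewrite mxE.
by case: split => _; rewrite ?oppr_eq0 oner_eq0.
Qed.

Lemma pairing_neg f u v : pairing f v u = - pairing f u v :> CC.
Proof. by rewrite /pairing -sumrN; apply: eq_bigr => w _; rewrite /pl; ring. Qed.

(* The image of [Phi] meets a general line of direction [upd ord0 w01]. *)
Lemma dominance p :
  (forall c : CC, vanish_at (fun r w => c * upd ord0 w01 r w) p) -> p = 0.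
Proof.
have [z0 pl00] := @pl0_neq0 (m + m).+1 _ w01.
(* This class of polynomials vanishes at a point of X; what remains is its stability under partial
   derivatives. *)
pose P p' := forall c : CC, vanish_at (fun r w => c * upd ord0 w01 r w) p'.
apply: (@mpoly_eq0_of_deriv_closed _ _ P (frame_pt (Phi w01 z0))) => [p' Pp'|p' i Pp' c].
  rewrite -[RHS](Pp' 0 _ _ _ (Phi_res pl00)); apply: ev_ext => r w.
  by rewrite mul0r addr0.
have [z1 Jz1] := transv_neq0.
apply: (vanish_at_chart regular_transv Jz1) => z plz Jz.
rewrite -(enum_valK i); case: (enum_val i) => r w {i}; rewrite -/(dM r w p').
set S : frame k n := fun r w => c * upd ord0 w01 r w.
pose D r w := ev (dM r w p') (fun r w => Phi w01 z r w + S r w).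
rewrite -/(D r w).
have res := Phi_res plz; have vp := Pp' c.
have D0 : D ord0 w01 = 0.
  pose cv (r : 'I_k) w : {poly CC} := (Phi w01 z r w + S r w)%:P + (upd ord0 w01 r w)%:P * 'X.
  have cv0 : fcurve cv p' = 0.
    apply: poly_eq0_infinite => j; rewrite horner_fcurve.
    rewrite -[RHS](Pp' (c + j%:R) _ _ _ res); apply: ev_ext => r' w'.
    by rewrite hornerD hornerM hornerX !hornerC /S mulrDl addrA [_ * j%:R]mulrC.
  have := deriv_fcurve cv p' 0; rewrite cv0 deriv0 horner0 => e0.
  rewrite -(sum_upd D) [RHS]e0; apply: eq_bigr => r' _; apply: eq_bigr => w' _.
  congr (_ * _); last first.
    by rewrite /cv derivD derivC add0r derivM derivC mul0r add0r derivX mulr1 hornerC.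
  by apply: ev_ext => r'' w''; rewrite hornerD hornerM hornerX !hornerC mulr0 addr0.
(* In each row the gradient is a multiple of the Pluecker vector, whose [w01] component is
   nonzero. *)
have Dgrad r' w' : D r' w01 = 0 -> D r' w' = 0.
  move=> Dr0; apply: (mulfI plz); rewrite mulr0.
  by rewrite (grad_proportional r' w' w01 vp res) -/(D r' w01) Dr0 mulr0.
apply: Dgrad; case: (unliftP ord0 r) => [r' ->|->] //.
(* Moving u and v in the tail directions gives 2m linear relations between the [w01] derivatives in
   the rows other than row 0; their matrix is [transv]. *)
pose x : 'rV[CC]_(m + m) := \row_r' D (lift ord0 r') w01.
suff -> : D (lift ord0 r') w01 = x 0 r'.
  suff -> : x = 0 by rewrite mxE.
  apply/eqP; rewrite -[x]mulmx1 -(mulmxV (_ : transv (Phi w01 z) (zu z) (zv z) \in unitmx)).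
    rewrite mulmxA (_ : x *m _ = 0) ?mul0mx //; apply/rowP => c'.
    have pair0 (f : Wedge2 n -> CC) a : pairing f a (fun=> 0) = 0 :> CC.
      by rewrite /pairing big1 // => y _; rewrite /pl !mulr0 subrr mulr0.
    have pair0' (f : Wedge2 n -> CC) a : pairing f (fun=> 0) a = 0 :> CC.
      by rewrite pairing_neg pair0 oppr0.
    have tail_off (j : 'I_m) i : (i == (val w01).1) || (i == (val w01).2) ->
        delta (tail j) i = 0 by case/orP => /eqP->.
    rewrite !mxE; under eq_bigr do rewrite !mxE.
    case: (split c') => j.
    - have := @tangent_move _ _ S p' _ _ _ (delta (tail j)) (fun=> 0) w01 vp res plz.
      move=> /(_ (fun i hi => conj (tail_off j i hi) (erefl _))); rewrite big_ord_recl -/(D _ _) D0 mul0r add0r => e0.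
      by rewrite -[RHS]e0; apply: eq_bigr => r'' _; rewrite pair0 addr0.
    - have := @tangent_move _ _ S p' _ _ _ (fun=> 0) (delta (tail j)) w01 vp res plz.
      move=> /(_ (fun i hi => conj (erefl _) (tail_off j i hi))); rewrite big_ord_recl -/(D _ _) D0 mul0r add0r => e0.
      by rewrite -[RHS]e0; apply: eq_bigr => r'' _; rewrite pair0' add0r.
  by rewrite unitmxE unitfE.
by rewrite mxE.
Qed.
End Dominance.

(** * Order of vanishing of minors *)

Section BorderedOrder.
Variable F : numFieldType.

(** The skeleton decomposition: an invertible compression of size at least the rank determines the
    whole matrix. *)
Lemma mulmx_rank_factor s a b (G : 'M[F]_(a, b)) (X : 'M_(s, a)) (Y : 'M_(b, s)) :
  (\rank G <= s)%N -> X *m G *m Y \in unitmx ->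
  G = G *m Y *m invmx (X *m G *m Y) *m (X *m G).
Proof.
move=> rG ZU; set Z := X *m G *m Y.
have sXG : (s <= \rank (X *m G))%N.
  by rewrite -{1}(mxrank_unit ZU) mxrankM_maxl.
have /submxP[D GD] : (G <= X *m G)%MS.
  by rewrite -(geq_leqif (mxrank_leqif_sup (submxMl X G))) (leq_trans rG sXG).
have -> : G *m Y *m invmx Z = D.
  by rewrite {1}GD -(mulmxA D) -/Z -mulmxA mulmxV // mulmx1.
by [].
Qed.

(* A bordered determinant computes the Schur complement, so that the corank
   forces vanishing of every maximal nonzero minor. *)
Lemma det_order s a b c (G0 G1 : 'M[F]_(a, b)) (X : 'M_(s, a)) (Y : 'M_(b, s))
    (L : 'M_(c, a)) (R : 'M_(b, c)) :
  L *m G0 = 0 -> G0 *m R = 0 -> L *m G1 *m R \in unitmx ->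
  (forall t, \rank (G0 + t *: G1)%R <= s)%N ->
  exists Q : {poly F}, forall t,
    \det (X *m (G0 + t *: G1) *m Y) = t ^+ c * Q.[t].
Proof.
move=> LG GR NU rG; set N := L *m G1 *m R in NU.
pose Z t := X *m (G0 + t *: G1) *m Y.
pose Zp : 'M[{poly F}]_s :=
  map_mx polyC (X *m G0 *m Y) + 'X *: map_mx polyC (X *m G1 *m Y).
have hdet r (B : 'M[{poly F}]_r) t : (\det B).[t] = \det (map_mx (horner_eval t) B).
  by rewrite det_map_mx.
have ZpE t : map_mx (horner_eval t) Zp = Z t.
  apply/matrixP => i j; rewrite /Z mulmxDr mulmxDl -scalemxAr -scalemxAl !mxE.
  by rewrite /horner_eval hornerD hornerM hornerX !hornerC.
have dZ t : (\det Zp).[t] = \det (Z t) by rewrite hdet ZpE.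
pose Bp := block_mx Zp (map_mx polyC (X *m G1 *m R)) (map_mx polyC (L *m G1 *m Y)) 0.
pose e : F := (-1) ^+ c * \det N.
have e0 : e != 0.
  by rewrite mulf_neq0 ?expf_neq0 ?oppr_eq0 ?oner_eq0 // -unitfE -unitmxE.
have [dz0|dz0] := eqVneq (\det Zp) 0.
  by exists 0 => t; rewrite horner0 mulr0 -/(Z t) -dZ dz0 horner0.
(* When t and det Z(t) are nonzero, the Schur complement of Z(t) in the bordered matrix is - W with
   N = t W, so t^c det(- W) is the constant [e]. The factor [\det Zp * 'X] disposes of the other
   values of t. *)
have key : 'X^c * \det Bp = e%:P * \det Zp.
    apply/eqP; rewrite -subr_eq0; set D := _ - _.
    suff : D * (\det Zp * 'X) = 0.
      by move/eqP; rewrite !mulf_eq0 (negPf dz0) polyX_eq0 !orbF.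
    apply: poly_eq0_infinite => j; move: (j%:R) => t {j}.
    rewrite !hornerM hornerX dZ; have [->|t0] := eqVneq t 0; first by rewrite !mulr0.
    have [->|z0] := eqVneq (\det (Z t)) 0; first by rewrite mul0r mulr0.
    have ZU : Z t \in unitmx by rewrite unitmxE unitfE.
    rewrite [D.[t]](_ : _ = 0) ?mul0r // /D hornerD hornerN !hornerM hornerC hornerXn dZ hdet.
    pose W := L *m G1 *m Y *m invmx (Z t) *m (X *m G1 *m R).
    (* t N is L (G0 + t G1) R; rewriting the middle matrix through the block Z(t), each of L (G0 + t
       G1) and (G0 + t G1) R contributes a factor t. *)
    have NE : N = t *: W.
      apply: (scalerI t0); rewrite -[t *: N](_ : L *m (G0 + t *: G1) *m R = _); last first.
        by rewrite mulmxDr mulmxDl LG mul0mx add0r -scalemxAr -scalemxAl.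
      rewrite [in LHS](@mulmx_rank_factor _ _ _ _ X Y (rG t) ZU) -/(Z t).
      have eqL : L *m (G0 + t *: G1) = t *: (L *m G1).
        by rewrite mulmxDr LG add0r scalemxAr.
      have eqR : (G0 + t *: G1) *m R = t *: (G1 *m R).
        by rewrite mulmxDl GR add0r scalemxAl.
      rewrite !mulmxA eqL -!mulmxA eqR /W -!(scalemxAl, scalemxAr) -!mulmxA.
      by [].
    have -> : map_mx (horner_eval t) Bp =
        block_mx 1%:M 0 (L *m G1 *m Y *m invmx (Z t)) 1%:M *m
        block_mx (Z t) (X *m G1 *m R) 0 (- W).
      rewrite mulmx_block map_block_mx ZpE !mul1mx !mul0mx !addr0.
      rewrite mulmxKV // /W -!mulmxA subrr map_mx0.
      by congr block_mx; apply/matrixP => i j; rewrite !mxE /horner_eval hornerC.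
    rewrite det_mulmx det_lblock !det1 !mul1r det_ublock.
    rewrite /e NE detZ -scaleN1r detZ; ring.
exists ((e^-1)%:P * \det Bp) => t; rewrite -/(Z t) -dZ hornerM hornerC.
have := congr1 (horner^~ t) key; rewrite /= !hornerM hornerC hornerXn => eq_t.
by apply: (mulfI e0); rewrite -eq_t [RHS]mulrCA; congr (_ * _); rewrite mulVKf.
Qed.
End BorderedOrder.

(** * Syzygies at transversal points *)

Section CharPolySyzygy.
Variable A : idomainType.

Lemma det_eq0_ker m (D : 'M[A]_m) (xi : 'cV_m) : xi != 0 -> D *m xi = 0 -> \det D = 0.
Proof.
move=> xi0 Dxi; have [i xii] : exists i, xi i 0 != 0.
  apply/existsP; apply: contraNT xi0; rewrite negb_exists => /forallP xiz.
  by apply/eqP/colP => i; rewrite mxE; apply/eqP; rewrite -[_ == _]negbK; apply: xiz.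
apply: (mulIf xii); rewrite mul0r.
have := congr1 (mulmx (\adj D)) Dxi; rewrite mulmxA mul_adj_mx mulmx0 mul_scalar_mx.
by move/colP/(_ i); rewrite !mxE.
Qed.

Lemma poly_divX (p : {poly A}) : p.[0] = 0 -> p = 'X * drop_poly 1 p.
Proof.
move=> p0; rewrite -[LHS](poly_take_drop 1) mulrC expr1 (_ : take_poly 1 p = 0) ?add0r //.
apply/polyP => i; rewrite coef_take_poly coef0; case: i => // /=.
by rewrite -horner_coef0.
Qed.

(** Each entry is the determinant of [B] with one row replaced by [Y], a matrix that still kills
    [xi]. *)
Lemma mulmx_adj_ker m (B : 'M[A]_m) (Y : 'rV_m) (xi : 'cV_m) :
  xi != 0 -> B *m xi = 0 -> Y *m xi = 0 -> Y *m \adj B = 0.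
Proof.
move=> xi0 Bxi Yxi; apply/rowP => i; rewrite !mxE.
pose D : 'M_m := \matrix_(a, b) if a == i then Y 0 b else B a b.
rewrite -[RHS](@det_eq0_ker _ D xi xi0).
  rewrite (expand_det_row D i); apply: eq_bigr => j _; rewrite !mxE eqxx.
  congr (_ * _); rewrite /cofactor; congr (_ * \det _).
  apply/matrixP => a b; rewrite !mxE eq_sym (negPf (neq_lift _ _)) //.
apply/colP => a; rewrite !mxE; have [->|ai] := eqVneq a i.
  have := congr1 (fun M : 'M_1 => M 0 0) Yxi; rewrite !mxE => e.
  by rewrite -[RHS]e; apply: eq_bigr => b _; rewrite mxE eqxx.
have := congr1 (fun M : 'cV_m => M a 0) Bxi; rewrite !mxE => e.
by rewrite -[RHS]e; apply: eq_bigr => b _; rewrite mxE (negPf ai).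
Qed.

(* [B] and [Y] only see the hyperplane orthogonal to [xi], so the adjugate of
   [T + B] applied to [Y] is divisible by [T]; this saves one degree. *)
Lemma charpoly_syzygy m (B : 'M[A]_m) (Y : 'rV_m) (xi : 'cV_m) (T : A) :
  xi != 0 -> B *m xi = 0 -> Y *m xi = 0 ->
  exists (g : A) (p : 'rV[A]_m),
    [/\ p *m (T%:M + B) = - g *: Y, p *m xi = 0 &
        forall (C : idomainType) (phi : {rmorphism A -> C}),
          map_mx phi B = 0 -> phi g = phi T ^+ m.-1].
Proof.
move=> xi0 Bxi Yxi.
(* With an indeterminate in place of [T], both det W and y adj W vanish at 0 and can be divided by
   it; [T] is substituted only afterwards. *)
pose W : 'M[{poly A}]_m := 'X%:M + map_mx (@polyC A) B.
have hW0 : map_mx (horner_eval 0) W = B.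
  apply/matrixP => i j; rewrite !mxE /horner_eval hornerD hornerC hornerMn hornerX.
  by rewrite mul0rn add0r.
have dW0 : (\det W).[0] = 0.
  have -> : (\det W).[0] = horner_eval 0 (\det W) by [].
  by rewrite -det_map_mx hW0 (det_eq0_ker xi0 Bxi).
pose y := map_mx (@polyC A) Y.
pose xi' := map_mx (@polyC A) xi.
pose ph := y *m \adj W.
have ph0 i : (ph 0 i).[0] = 0.
  have -> : (ph 0 i).[0] = (map_mx (horner_eval 0) ph) 0 i by rewrite [RHS]mxE.
  rewrite map_mxM map_mx_adj hW0 (_ : map_mx _ y = Y); last first.
    by apply/rowP => j; rewrite /y !mxE; apply: hornerC.
  by rewrite (mulmx_adj_ker xi0) // mxE.
pose g := drop_poly 1 (\det W); pose pt : 'rV[{poly A}]_m := \row_i (- drop_poly 1 (ph 0 i)).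
have gE : 'X * g = \det W by rewrite -poly_divX.
have ptE : 'X *: pt = - ph.
  by apply/rowP => i; rewrite 2!mxE [RHS]mxE mulrN -poly_divX.
have X0 : 'X != 0 :> {poly A} by rewrite polyX_eq0.
have scXI r s (U V : 'M[{poly A}]_(r, s)) : 'X *: U = 'X *: V -> U = V.
  by move=> UV; apply/matrixP => i j; apply: (mulfI X0); move/matrixP/(_ i j): UV; rewrite !mxE.
have ptW : pt *m W = - g *: y.
  apply: scXI; rewrite scalemxAl ptE mulNmx -mulmxA mul_adj_mx -gE.
  by rewrite mul_mx_scalar scaleNr scalerN scalerA.
have Wxi : W *m xi' = 'X *: xi'.
  by rewrite mulmxDl mul_scalar_mx -map_mxM Bxi map_mx0 addr0.
have ptxi : pt *m xi' = 0.
  apply: scXI; rewrite scalemxAr -Wxi mulmxA ptW -scalemxAl -map_mxM Yxi map_mx0.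
  by rewrite !scaler0.
have hTC r s (U : 'M[A]_(r, s)) : map_mx (horner_eval T) (map_mx (@polyC A) U) = U.
  by apply/matrixP => i j; rewrite !mxE /horner_eval hornerC.
exists g.[T], (map_mx (horner_eval T) pt); split => //.
  have -> : T%:M + B = map_mx (horner_eval T) W.
    rewrite map_mxD hTC; congr (_ + _); apply/matrixP => i j.
    by rewrite !mxE raddfMn; congr (_ *+ _); exact/esym/hornerX.
  rewrite -map_mxM ptW; apply/rowP => j.
  rewrite !mxE; apply: (etrans (hornerM _ _ _)); rewrite hornerN; congr (_ * _).
  exact: hornerC.
  by rewrite -(hTC _ _ xi) -map_mxM ptxi map_mx0.
move=> C phi phiB.
(* Where [phi] kills [B], the matrix [W] becomes scalar. *)
have gX : 'X * map_poly phi g = 'X^m.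
  rewrite -(map_polyX phi) -rmorphM gE -det_map_mx map_mxD -map_mx_comp.
  rewrite (_ : map_mx _ B = 0) ?addr0; last first.
    apply/matrixP => i j; rewrite !mxE /= map_polyC; move/matrixP/(_ i j): phiB.
    by rewrite !mxE => e; apply: (etrans (congr1 (@polyC C) e)).
  rewrite map_scalar_mx; apply: (etrans (det_scalar _ _)); congr (_ ^+ _).
rewrite -horner_map; case: m {B Y xi xi0 Bxi Yxi W hW0 dW0 y xi' ph ph0 pt g gE ptE X0 scXI ptW Wxi ptxi hTC phiB} (map_poly phi g) gX => [|m] g gX /=.
  have /eqP := congr1 (horner^~ 0) gX.
  by rewrite hornerM hornerX mul0r hornerC eq_sym oner_eq0.
by rewrite (mulfI _ (etrans gX (exprS _ _))) ?polyX_eq0 // hornerXn.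
Qed.
End CharPolySyzygy.

Section KoszulEvaluation.
Variables (n q : nat).
Implicit Types (x y : 'I_n -> CC) (w : Wedge2 n).

Definition mon q' (b : Mon n q') x : CC := \prod_i x i ^+ expo b i.

Lemma expo_sum q' (a : Mon n q') : (\sum_i expo a i)%N = q'.
Proof. exact/eqP/(valP a). Qed.

Lemma expo_inj q' (a b : Mon n q') : (forall i, expo a i = expo b i) -> a = b.
Proof. by move=> eab; apply/val_inj/ffunP => i; apply/val_inj/eab. Qed.

Lemma mk_mon q' (f : 'I_n -> nat) : (\sum_i f i)%N = q' ->
  exists b : Mon n q', forall i, expo b i = f i.
Proof.
move=> fq; have fle i : (f i < q'.+1)%N by rewrite ltnS -fq (bigD1 i) //= leq_addr.
pose g : {ffun 'I_n -> 'I_q'.+1} := [ffun i => Ordinal (fle i)].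
have gP : (\sum_i (g i : nat) == q')%N.
  by apply/eqP; rewrite -[RHS]fq; apply: eq_bigr => i _; rewrite ffunE.
by exists (exist (fun a : {ffun 'I_n -> 'I_q'.+1} => \sum_i (a i : nat) == q')%N g gP) => i; rewrite /expo /= ffunE.
Qed.

(** Evaluating the symmetric factor at [x] and the vector factor on [y] turns the differential into
    the pairing with x /\ y. Matrix identities are then checked on these evaluations, which separate
    rows by [evcol_free]. *)
Lemma koszul_eval (wa : Wedge2 n * Mon n q) x y :
  \sum_kb koszul_delta2 wa kb * (y kb.1 * mon kb.2 x) = pl x y wa.1 * mon wa.2 x.
Proof.
case: wa => w a /=.
have part (i j : 'I_n) : \sum_(kb : 'I_n * Mon n q.+1)
    ((kb.1 == j) && [forall l, expo kb.2 l == expo a l + (l == i)]%N)%:R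
      * (y kb.1 * mon kb.2 x) = x i * y j * mon a x.
  have [b bE] : exists b : Mon n q.+1, forall l, expo b l = (expo a l + (l == i))%N.
    apply: mk_mon; rewrite big_split /= expo_sum (bigD1 i) //= eqxx big1 ?addn0 ?addn1 //.
    by move=> l /negPf->.
  rewrite (bigD1 (j, b)) //= eqxx /= (_ : [forall l, _] = true); last first.
    by apply/forallP => l; rewrite bE.
  rewrite mul1r big1 ?addr0 => [|[j' b'] /= njb].
    have -> : mon b x = x i * mon a x.
      rewrite /mon; under eq_bigr do rewrite bE exprD; rewrite big_split /= mulrC.
      congr (_ * _); rewrite (bigD1 i) //= eqxx expr1 big1 ?mulr1 // => l /negPf->.
      by rewrite expr0.
    by ring.
  case: eqP => [ej|] /=; last by rewrite mul0r.
  case: forallP => [eb|]; last by rewrite mul0r.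
  case/eqP: njb; rewrite ej; congr (_, _); apply: expo_inj => l.
  by rewrite bE; apply/eqP/eb.
rewrite /koszul_delta2 /=.
under eq_bigr do rewrite mulrBl; rewrite sumrB !part /pl; ring.
Qed.

Lemma mon_free q' (c : Mon n q' -> CC) :
  (forall x, \sum_b c b * mon b x = 0) -> forall b, c b = 0.
Proof.
move=> c0; pose X (b : Mon n q') : 'X_{1..n} := [multinom expo b i | i < n].
have Xinj b b' : (X b == X b') = (b == b').
  apply/eqP/eqP => [eX|->//]; apply: expo_inj => i.
  by move/mnmP/(_ i): eX; rewrite !mnmE.
have p0 : \sum_b c b *: 'X_[X b] = 0 :> {mpoly CC[n]}.
  apply: mpoly_fun_eq0 => x; rewrite raddf_sum /= -[RHS](c0 x).
  apply: eq_bigr => b _; rewrite mevalZ mevalX; congr (_ * _).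
  by apply: eq_bigr => i _; rewrite mnmE.
move=> b; have := congr1 (mcoeff (X b)) p0; rewrite mcoeff0 raddf_sum /=.
rewrite (bigD1 b) //= mcoeffZ mcoeffX eqxx mulr1 big1 ?addr0 // => b' bb'.
by rewrite mcoeffZ mcoeffX Xinj (negPf bb') mulr0.
Qed.

Definition colT (T : finType) (f : T -> CC) : 'cV[CC]_#|T| := \col_i f (enum_val i).
Definition rowT (T : finType) (f : T -> CC) : 'rV[CC]_#|T| := \row_i f (enum_val i).

Lemma sum_enum_val (T : finType) (f : T -> CC) : \sum_(i < #|T|) f (enum_val i) = \sum_t f t.
Proof. by rewrite [RHS](reindex (@enum_val T T)) //; apply/onW_bij/enum_val_bij. Qed.

Lemma mul_mxT_colT (S T : finType) (A : S -> T -> CC) f :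
  mxT A *m colT f = colT (fun s => \sum_t A s t * f t).
Proof.
apply/colP => i; rewrite !mxE -[RHS]sum_enum_val.
by apply: eq_bigr => j _; rewrite !mxE.
Qed.

Lemma mul_rowT_colT (T : finType) (f g : T -> CC) :
  rowT f *m colT g = (\sum_t f t * g t)%:M.
Proof.
apply/matrixP => i j; rewrite !ord1 !mxE mulr1n -[RHS]sum_enum_val.
by apply: eq_bigr => t _; rewrite !mxE.
Qed.

Lemma eq_colT (T : finType) (f g : T -> CC) : f =1 g -> colT f = colT g.
Proof. by move=> fg; apply/colP => i; rewrite !mxE. Qed.

Definition evcol q' x y := colT (fun kb : 'I_n * Mon n q' => y kb.1 * mon kb.2 x).

Lemma Delta2_evcol x y :
  Delta2 n q *m evcol q.+1 x y = colT (fun wa => pl x y wa.1 * mon wa.2 x).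
Proof. by rewrite mul_mxT_colT; apply: eq_colT => wa; apply: koszul_eval. Qed.

Lemma gamma_evcol k (M : frame k n) x y :
  gamma_mx q M *m evcol q.+1 x y = colT (fun ra => pairing (M ra.1) x y * mon ra.2 x).
Proof.
rewrite mul_mxT_colT; apply: eq_colT => -[r a] /=.
under eq_bigr do rewrite mulr_suml.
rewrite exchange_big /= /pairing mulr_suml; apply: eq_bigr => w _.
rewrite -[RHS]mulrA -[X in _ = _ * X](koszul_eval (w, a)) mulr_sumr.
by apply: eq_bigr => kb _; rewrite -[LHS]mulrA.
Qed.

Lemma evcol_free q' s (A B : 'M_(s, #|{: 'I_n * Mon n q'}|)) :
  (forall x y, A *m evcol q' x y = B *m evcol q' x y) -> A = B.
Proof.
move=> AB; apply/eqP; rewrite -subr_eq0; apply/eqP/matrixP => i j; rewrite [RHS]mxE.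
rewrite -(enum_valK j); case: (enum_val j) => l b.
pose e (l' : 'I_n) : CC := (l' == l)%:R.
pose c (b' : Mon n q') : CC := (A - B) i (enum_rank (l, b')).
apply: (@mon_free q' c) => x.
have := congr1 (fun C : 'cV_s => C i 0) (AB x e) => /eqP.
rewrite -subr_eq0 => /eqP; rewrite !mxE -sumrB => h; rewrite -[RHS]h.
rewrite (reindex (@enum_rank ('I_n * Mon n q')%type)) /=; last exact/onW_bij/enum_rank_bij.
transitivity (\sum_(p : 'I_n * Mon n q') e p.1 * (c p.2 * mon p.2 x)).
  rewrite -(pair_bigA _ (fun l' b' => e l' * (c b' * mon b' x))) (bigD1 l) //=.
  rewrite [X in _ + X]big1 ?addr0 => [|l' /negPf ll']; last first.
    by apply: big1 => b' _; rewrite /e ll' mul0r.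
  by apply: eq_bigr => b' _; rewrite /e eqxx mul1r.
apply: eq_bigr => -[l' b'] _; rewrite /c !mxE enum_rankK /= /e.
by have [->|] := eqVneq l' l; rewrite ?mul1r ?mulrBl ?mul0r ?mulr0 ?subrr.
Qed.

Lemma gamma_Delta2 k (M : frame k n) :
  gamma_mx q M =
  mxT (fun (ra : 'I_k * Mon n q) (wb : Wedge2 n * Mon n q) =>
         M ra.1 wb.1 * (ra.2 == wb.2)%:R) *m Delta2 n q.
Proof.
apply: evcol_free => x y; rewrite gamma_evcol -mulmxA Delta2_evcol mul_mxT_colT.
apply: eq_colT => -[r a] /=.
rewrite -(pair_bigA _ (fun w b => M r w * (a == b)%:R * (pl x y w * mon b x))) /=.
rewrite /pairing mulr_suml; apply: eq_bigr => w _.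
rewrite (bigD1 a) //= eqxx mulr1 mulrA big1 ?addr0 // => b /negPf.
by rewrite eq_sym => ->; rewrite mulr0 mul0r.
Qed.

(** The rank condition says that [P] is injective on the image of delta_2, so [H] inverts it there;
    gamma factors through delta_2 and inherits the inverse. *)
Lemma Delta2_section s (P : 'M_(#|{: 'I_n * Mon n q.+1}|, s)) :
  \rank (Delta2 n q *m P) = \rank (Delta2 n q) ->
  exists H, Delta2 n q = Delta2 n q *m P *m H.
Proof.
move=> rP; have sub : ((Delta2 n q *m P)^T <= (Delta2 n q)^T)%MS.
  by rewrite trmx_mul submxMl.
have /eqmxP/eqmx_sym eqM : ((Delta2 n q *m P)^T == (Delta2 n q)^T)%MS.
  by rewrite -(geq_leqif (mxrank_leqif_eq sub)) !mxrank_tr rP.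
have /submxP[H HE] : ((Delta2 n q)^T <= (Delta2 n q *m P)^T)%MS by rewrite eqM.
by exists H^T; rewrite -[LHS]trmxK HE trmx_mul trmxK.
Qed.

Lemma gamma_section k s (P : 'M_(#|{: 'I_n * Mon n q.+1}|, s)) H (M : frame k n) :
  Delta2 n q = Delta2 n q *m P *m H -> gamma_mx q M *m P *m H = gamma_mx q M.
Proof. by move=> DH; rewrite gamma_Delta2 -!mulmxA [in RHS]DH !mulmxA. Qed.
End KoszulEvaluation.

Section HomogeneousPart.
Variable n : nat.

Lemma homogeneous_part q (p : {mpoly CC[n]}) :
  exists c : Mon n q -> CC, forall x,
    (mcurve (fun i => x i *: 'X) p)`_q = \sum_a c a * mon a x.
Proof.
elim/mpolyind: p => [|a m p _ _ [c cE]].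
  exists (fun=> 0) => x; rewrite /mcurve mmap0 coef0 big1 // => a _.
  by rewrite mul0r.
have [c' cE'] : exists c : Mon n q -> CC, forall x,
    (mcurve (fun i => x i *: 'X) 'X_[m] : {poly CC})`_q = \sum_a c a * mon a x.
  have cur x : mcurve (fun i => x i *: 'X) 'X_[m] =
      (\prod_i x i ^+ m i) *: 'X^(mdeg m) :> {poly CC}.
    rewrite /mcurve mmapX /mmap1 mdegE -prodrXr -scaler_prod.
    by apply: eq_bigr => i _; rewrite exprZn.
  have [mq|mq] := eqVneq (mdeg m) q.
    have [b bE] : exists b : Mon n q, forall i, expo b i = m i.
      by apply: mk_mon; rewrite -mdegE.
    exists (fun b' => (b' == b)%:R) => x.
    rewrite cur coefZ mq coefXn eqxx mulr1 (bigD1 b) //= eqxx mul1r.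
    rewrite [X in _ + X]big1 ?addr0 => [|b' /negPf->]; last by rewrite mul0r.
    by apply: eq_bigr => i _; rewrite bE.
  exists (fun=> 0) => x; rewrite cur coefZ coefXn eq_sym (negPf mq) mulr0 big1 // => b _.
  by rewrite mul0r.
exists (fun b => a * c' b + c b) => x.
rewrite /mcurve mmapD mmapZ coefD coefCM (cE' x) (cE x) mulr_sumr -big_split /=.
by apply: eq_bigr => b _; rewrite mulrDl mulrA.
Qed.

End HomogeneousPart.

Section Bilinear.
Variable n : nat.
Implicit Types (f : Wedge2 n -> CC) (x y : 'I_n -> CC).

Lemma pairing_expand f x y :
  pairing f x y = \sum_i y i * pairing f x (fun l => (l == i)%:R).
Proof.
rewrite /pairing; under [RHS]eq_bigr do rewrite mulr_sumr.
rewrite exchange_big; apply: eq_bigr => w _ /=.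
have sumd j : \sum_i y i * (j == i)%:R = y j.
  rewrite (bigD1 j) //= eqxx mulr1 big1 ?addr0 // => i /negPf.
  by rewrite eq_sym => ->; rewrite mulr0.
rewrite /pl -[in LHS](sumd (val w).2) -[in LHS](sumd (val w).1) !mulr_sumr -sumrB mulr_sumr.
by apply: eq_bigr => i _; ring.
Qed.

Lemma pairing_sum (J : finType) (c : J -> CC) (f : J -> Wedge2 n -> CC) x y :
  pairing (fun w => \sum_j c j * f j w) x y = \sum_j c j * pairing (f j) x y.
Proof.
rewrite /pairing; under eq_bigr do rewrite mulr_suml.
rewrite exchange_big; apply: eq_bigr => j _; rewrite mulr_sumr.
by apply: eq_bigr => w _; rewrite mulrA.
Qed.

Lemma pairing_anti f x : pairing f x x = 0.
Proof. by rewrite /pairing big1 // => w _; rewrite /pl [X in X - _]mulrC subrr mulr0. Qed.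

End Bilinear.

Section Coordinates.
Variable m : nat.
Local Notation n := m.+2.
Variables u v : 'I_n -> CC.
Local Notation om := (pl u v (w01 m)).
Hypothesis om0 : om != 0.
Implicit Types (f : Wedge2 n -> CC) (x y : 'I_n -> CC) (l : 'I_m).
Local Notation o0 := (ord0 : 'I_n).
Local Notation o1 := (lift ord0 ord0 : 'I_n).

(** Coordinates in the basis formed by u, v and the tail vectors, by Cramer's rule on the indices 0
    and 1. *)
Definition ucoord x := (x o0 * v o1 - x o1 * v o0) / om.
Definition vcoord x := (u o0 * x o1 - u o1 * x o0) / om.
Definition zcoord x l := x (tail l) - ucoord x * u (tail l) - vcoord x * v (tail l).

Lemma sum_tail (F : 'I_n -> CC) : \sum_i F i = F o0 + (F o1 + \sum_l F (tail l)).
Proof. by rewrite !big_ord_recl. Qed.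

Lemma pairing_coord f x y :
  pairing f x y = ucoord y * pairing f x u + vcoord y * pairing f x v
                  + \sum_l zcoord y l * pairing f x (delta (tail l)).
Proof.
set c := fun i => pairing f x (delta i).
have E y' : pairing f x y' = \sum_i y' i * c i by exact: pairing_expand.
rewrite !E !sum_tail.
have -> : \sum_l zcoord y l * c (tail l) = \sum_l y (tail l) * c (tail l)
   - ucoord y * (\sum_l u (tail l) * c (tail l)) - vcoord y * (\sum_l v (tail l) * c (tail l)).
  by rewrite !mulr_sumr -!sumrB; apply: eq_bigr => l _; rewrite /zcoord; ring.
have e0 : ucoord y * u o0 + vcoord y * v o0 = y o0.
  by move: om0; rewrite /ucoord /vcoord /pl /= => h; field.
have e1 : ucoord y * u o1 + vcoord y * v o1 = y o1.
  by move: om0; rewrite /ucoord /vcoord /pl /= => h; field.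
rewrite -e0 -e1; ring.
Qed.

Lemma pairing_coordl f x y :
  pairing f x y = ucoord x * pairing f u y + vcoord x * pairing f v y
                  + \sum_l zcoord x l * pairing f (delta (tail l)) y.
Proof.
rewrite (pairing_neg f y x) (pairing_coord f y x) (pairing_neg f y u) (pairing_neg f y v).
rewrite !opprD -sumrN !mulrN; congr (_ + _); apply: eq_bigr => l _.
by rewrite [in RHS]pairing_neg mulrN.
Qed.

Lemma ucoord_comb a b : ucoord (fun i => a * u i + b * v i) = a.
Proof. by move: om0; rewrite /ucoord /pl /= => h; field. Qed.

Lemma vcoord_comb a b : vcoord (fun i => a * u i + b * v i) = b.
Proof. by move: om0; rewrite /vcoord /pl /= => h; field. Qed.

Lemma zcoord_comb a b l : zcoord (fun i => a * u i + b * v i) l = 0.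
Proof. by rewrite /zcoord ucoord_comb vcoord_comb; ring. Qed.

End Coordinates.

Section Syzygy.
Variable q : nat.
Local Notation m := q.+1.
Local Notation k := (m + m).+1.
Local Notation n := m.+2.
Variables (M : frame k n) (u v : 'I_n -> CC).
Local Notation om := (pl u v (w01 m)).
Hypothesis om0 : om != 0.
Hypothesis Muv : forall r, pairing (M r) u v = 0.
Local Notation T := (transv M u v).
Hypothesis T0 : \det T != 0.
Variable s : CC.
Local Notation A := {mpoly CC[n]}.
Local Notation o0 := (ord0 : 'I_n).
Local Notation o1 := (lift ord0 ord0 : 'I_n).
Local Notation cu := (ucoord u v).
Local Notation cv := (vcoord u v).
Local Notation cz := (zcoord u v).

Let ab : 'rV[CC]_(m + m) := \row_c
  match split c with
  | inl j => pairing (M ord0) (delta (tail j)) v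
  | inr j => pairing (M ord0) u (delta (tail j))
  end.
(** Transversality normalises the rows: [K j] takes the value 1 on (e_j, v), s on (u, e_j) and 0 on
    the other pairs (e_l, v), (u, e_l); [Ks] is row 0 corrected by the other rows so as to vanish on
    all these pairs. *)
Let C : 'M[CC]_(m, m + m) := row_mx 1%:M s%:M *m invmx T.
Let d : 'rV[CC]_(m + m) := ab *m invmx T.
Let K (j : 'I_m) w := \sum_r C j r * M (lift ord0 r) w.
Let Ks w := M ord0 w - \sum_r d 0 r * M (lift ord0 r) w.

Let Tu : T \in unitmx. Proof. by rewrite unitmxE unitfE. Qed.

Let KE j x y : pairing (K j) x y = \sum_r C j r * pairing (M (lift ord0 r)) x y.
Proof. exact: pairing_sum. Qed.

Let K_uv j : pairing (K j) u v = 0.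
Proof. by rewrite pairing_sum big1 // => r _; rewrite Muv mulr0. Qed.

Let pairingKs x y : pairing Ks x y =
  pairing (M ord0) x y - \sum_r d 0 r * pairing (M (lift ord0 r)) x y.
Proof.
rewrite -pairing_sum /pairing -sumrB; apply: eq_bigr => w _.
by rewrite -mulrBl.
Qed.

Let Ks_uv : pairing Ks u v = 0.
Proof. by rewrite pairingKs Muv big1 ?subrr // => r _; rewrite Muv mulr0. Qed.

Let CT : C *m T = row_mx 1%:M s%:M.
Proof. by rewrite /C mulmxKV. Qed.

Let dT : d *m T = ab.
Proof. by rewrite /d mulmxKV. Qed.

Let K_ev j l : pairing (K j) (delta (tail l)) v = (j == l)%:R.
Proof.
have := congr1 (fun X : 'M_(m, m + m) => X j (lshift m l)) CT.
rewrite row_mxEl !mxE => <-; rewrite pairing_sum; apply: eq_bigr => r _.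
by rewrite [T _ _]mxE (unsplitK (inl l)).
Qed.

Let K_ue j l : pairing (K j) u (delta (tail l)) = s *+ (j == l).
Proof.
have := congr1 (fun X : 'M_(m, m + m) => X j (rshift m l)) CT.
rewrite row_mxEr !mxE => <-; rewrite pairing_sum; apply: eq_bigr => r _.
by rewrite [T _ _]mxE (unsplitK (inr l)).
Qed.

Let Ks_ev l : pairing Ks (delta (tail l)) v = 0.
Proof.
have := congr1 (fun X : 'rV_(m + m) => X 0 (lshift m l)) dT.
rewrite !mxE (unsplitK (inl l)) pairingKs => <-.
apply/eqP; rewrite subr_eq0; apply/eqP/eq_bigr => r _.
by rewrite [T _ _]mxE (unsplitK (inl l)).
Qed.

Let Ks_ue l : pairing Ks u (delta (tail l)) = 0.
Proof.
have := congr1 (fun X : 'rV_(m + m) => X 0 (rshift m l)) dT.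
rewrite !mxE (unsplitK (inr l)) pairingKs => <-.
apply/eqP; rewrite subr_eq0; apply/eqP/eq_bigr => r _.
by rewrite [T _ _]mxE (unsplitK (inr l)).
Qed.

Let Kxv j x : pairing (K j) x v = cz x j.
Proof.
rewrite (pairing_coordl om0) K_uv pairing_anti !mulr0 !add0r (bigD1 j) //= K_ev eqxx mulr1.
by rewrite big1 ?addr0 // => l /negPf; rewrite K_ev eq_sym => ->; rewrite mulr0.
Qed.

Let Kxu j x : pairing (K j) x u = - (s * cz x j).
Proof.
rewrite pairing_neg (pairing_coord om0) K_uv pairing_anti !mulr0 !add0r (bigD1 j) //= K_ue eqxx.
rewrite big1 ?addr0 ?mulr1n 1?[s * _]mulrC // => l /negPf.
by rewrite K_ue eq_sym => ->; rewrite mulr0.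
Qed.

Let Kxe j x l : pairing (K j) x (delta (tail l)) =
  (s * cu x - cv x) *+ (j == l) +
  \sum_i cz x i * pairing (K j) (delta (tail i)) (delta (tail l)).
Proof.
rewrite (pairing_coordl om0) K_ue [pairing _ v _]pairing_neg K_ev; congr (_ + _).
by case: (j == l); rewrite ?mulr1n ?mulr0n; ring.
Qed.

Let Ksxv x : pairing Ks x v = 0.
Proof.
rewrite (pairing_coordl om0) Ks_uv pairing_anti !mulr0 !add0r big1 // => l _.
by rewrite Ks_ev mulr0.
Qed.

Let Ksxu x : pairing Ks x u = 0.
Proof.
rewrite pairing_neg (pairing_coord om0) Ks_uv pairing_anti !mulr0 !add0r big1 ?oppr0 // => l _.
by rewrite Ks_ue mulr0.
Qed.

Let Ksxe x l : pairing Ks x (delta (tail l)) =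
  \sum_i cz x i * pairing Ks (delta (tail i)) (delta (tail l)).
Proof.
by rewrite (pairing_coordl om0) Ks_ue [pairing _ v _]pairing_neg Ks_ev oppr0 !mulr0 !add0r.
Qed.

Let cuA : A := (om^-1)%:MP * ('X_o0 * (v o1)%:MP - 'X_o1 * (v o0)%:MP).
Let cvA : A := (om^-1)%:MP * ((u o0)%:MP * 'X_o1 - (u o1)%:MP * 'X_o0).
Let czA (l : 'I_m) : A := 'X_(tail l) - cuA * (u (tail l))%:MP - cvA * (v (tail l))%:MP.

Let cuAE x : cuA.@[x] = cu x.
Proof. by rewrite /cuA mevalM mevalC mevalB !mevalM !mevalC !mevalXU mulrC. Qed.
Let cvAE x : cvA.@[x] = cv x.
Proof. by rewrite /cvA mevalM mevalC mevalB !mevalM !mevalC !mevalXU mulrC. Qed.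
Let czAE x l : (czA l).@[x] = cz x l.
Proof. by rewrite /czA !mevalB mevalXU (mevalM _ cuA) (mevalM _ cvA) !mevalC cuAE cvAE. Qed.

Let B : 'M[A]_m := \matrix_(j, l)
  \sum_i czA i * (pairing (K j) (delta (tail i)) (delta (tail l)))%:MP.
Let Y : 'rV[A]_m := \row_l
  \sum_i czA i * (pairing Ks (delta (tail i)) (delta (tail l)))%:MP.
Let xi : 'cV[A]_m := \col_l czA l.
Let TA : A := s%:MP * cuA - cvA.

Let TAE x : TA.@[x] = s * cu x - cv x.
Proof. by rewrite /TA (mevalB _ (s%:MP * cuA)) (mevalM _ _ cuA) mevalC cuAE cvAE. Qed.

Let antisym_sum (c : 'I_m -> A) f :
  \sum_l (\sum_i c i * (pairing f (delta (tail i)) (delta (tail l)))%:MP) * c l = 0.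
Proof.
set S := LHS.
have SN : S = - S.
  rewrite {1}/S; under eq_bigr do rewrite mulr_suml.
  rewrite exchange_big /= /S -sumrN; apply: eq_bigr => l _.
  rewrite mulr_suml -sumrN; apply: eq_bigr => i _.
  by rewrite [in LHS]pairing_neg mpolyCN; ring.
have : S *+ 2 = 0 by rewrite mulr2n {1}SN addNr.
move/eqP; rewrite -mulr_natl mulf_eq0 -mpolyC_nat mpolyC_eq0 pnatr_eq0 /=.
by move/eqP.
Qed.

(* In the coordinates x = x1 u + x2 v + sum_l z_l e_l, with T = s x1 - x2, the
   syzygy equations read p (T + B) = - g Y with B z = 0 and Y z = 0. *)
Lemma syzygy_functions : exists f : 'I_k -> A,
  (forall x y, \sum_r (f r).@[x] * pairing (M r) x y = 0) /\
  forall x, (forall l, cz x l = 0) -> (f ord0).@[x] = (s * cu x - cv x) ^+ q.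
Proof.
have xi0 : xi != 0.
  apply/eqP => /colP/(_ ord0); rewrite !mxE => /(congr1 (meval (delta (tail ord0)))).
  rewrite czAE meval0 /zcoord /ucoord /vcoord /delta /=.
  by rewrite !mul0r !mulr0 !subr0 !mul0r !subr0 => /eqP; rewrite oner_eq0.
have Bxi : B *m xi = 0.
  apply/colP => j; rewrite !mxE -[RHS](antisym_sum czA (K j)).
  by apply: eq_bigr => l _; rewrite !mxE.
have Yxi : Y *m xi = 0.
  apply/matrixP => j j'; rewrite !ord1 !mxE -[RHS](antisym_sum czA Ks).
  by apply: eq_bigr => l _; rewrite !mxE.
have [g [p [pTB pxi gphi]]] := charpoly_syzygy TA xi0 Bxi Yxi.
(* The syzygy with coefficient g on [Ks] and p_j on [K j], rewritten on the rows of [M]; only [Ks]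
   involves row 0. *)
pose f (r : 'I_k) : A := match unlift ord0 r with
  | None => g
  | Some r' => - g * (d 0 r')%:MP + \sum_j p 0 j * (C j r')%:MP end.
exists f; split => [x y|x zx]; last first.
  rewrite /f unlift_none -TAE; apply: gphi.
  apply/matrixP => j l; rewrite !mxE raddf_sum big1 // => i _.
  by rewrite /= mevalM czAE zx mul0r.
have fE z : \sum_r (f r).@[x] * pairing (M r) x z =
    g.@[x] * pairing Ks x z + \sum_j (p 0 j).@[x] * pairing (K j) x z.
  rewrite big_ord_recl /f unlift_none pairingKs.
  under eq_bigr do rewrite liftK mevalD mevalM mevalN mevalC mulrDl.
  under [X in _ = _ + X]eq_bigr do rewrite KE mulr_sumr.
  rewrite big_split /= [in RHS]exchange_big /= mulrBr addrA; congr (_ + _).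
    congr (_ + _); rewrite [in RHS]mulr_sumr -[RHS]sumrN.
    apply: eq_bigr => r _. by ring.
  apply: eq_bigr => r _; rewrite raddf_sum mulr_suml; apply: eq_bigr => j _.
  by rewrite /= mevalM mevalC mulrA.
have pz : \sum_j (p 0 j).@[x] * cz x j = 0.
  move/matrixP/(_ 0 0): pxi; rewrite !mxE => /(congr1 (meval x)).
  rewrite meval0 raddf_sum /= => e; rewrite -[RHS]e; apply: eq_bigr => j _.
  by rewrite mevalM mxE czAE.
rewrite fE (pairing_coord om0 Ks) Ksxu Ksxv !mulr0 !add0r.
under [X in _ + X]eq_bigr do rewrite (pairing_coord om0) Kxu Kxv mulrDr mulrDr.
rewrite !big_split /=.
rewrite [X in _ + (X + _ + _)](_ : _ = 0); last first.
  transitivity (- (cu y * s) * \sum_j (p 0 j).@[x] * cz x j); last by rewrite pz mulr0.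
  by rewrite mulr_sumr; apply: eq_bigr => j _; ring.
rewrite [X in _ + (_ + X + _)](_ : _ = 0); last first.
  transitivity (cv y * \sum_j (p 0 j).@[x] * cz x j); last by rewrite pz mulr0.
  by rewrite mulr_sumr; apply: eq_bigr => j _; ring.
rewrite !add0r mulr_sumr; under [X in _ + X]eq_bigr do rewrite mulr_sumr.
rewrite [X in _ + X]exchange_big -big_split /= big1 // => l _.
move/matrixP/(_ 0 l): pTB; rewrite !mxE => /(congr1 (meval x)).
rewrite mevalM mevalN => e.
have YE : (\sum_i czA i * (pairing Ks (delta (tail i)) (delta (tail l)))%:MP).@[x] =
  pairing Ks x (delta (tail l)).
  by rewrite raddf_sum Ksxe; apply: eq_bigr => i _; rewrite /= mevalM mevalC czAE.
rewrite YE in e.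
have eL : (\sum_i p 0 i * (TA%:M + B) i l).@[x] =
   \sum_j (p 0 j).@[x] * pairing (K j) x (delta (tail l)).
  rewrite raddf_sum; apply: eq_bigr => j _; rewrite /= mevalM Kxe !mxE mevalD raddfMn raddf_sum /=; congr (_ * _).
  rewrite TAE; congr (_ + _).
  by apply: eq_bigr => i _; rewrite mevalM mevalC czAE.
rewrite eL in e.
transitivity (cz y l * (g.@[x] * pairing Ks x (delta (tail l)) +
  \sum_j (p 0 j).@[x] * pairing (K j) x (delta (tail l)))).
  rewrite mulrDr; congr (_ + _); first by ring.
  by rewrite mulr_sumr; apply: eq_bigr => j _; ring.
by rewrite e mulNr subrr mulr0.
Qed.

(** The pairing is linear in x, so the equations hold degree by degree and the degree q parts form a
    syzygy; on the plane of u and v the value was already homogeneous of degree q. *)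
Lemma koszul_syzygy : exists g : 'I_k -> Mon n q -> CC,
  (forall x y, \sum_r (\sum_a g r a * mon a x) * pairing (M r) x y = 0) /\
  forall t, \sum_a g ord0 a * mon a (fun i => u i + t * v i) = (s - t) ^+ q.
Proof.
have [f [fS f0]] := syzygy_functions.
have cE r : exists c : Mon n q -> CC, forall x,
    (mcurve (fun i => x i *: 'X) (f r))`_q = \sum_a c a * mon a x.
  exact: homogeneous_part.
pose g r := sval (constructive_indefinite_description _ (cE r)).
have gE r : forall x, (mcurve (fun i => x i *: 'X) (f r))`_q = \sum_a g r a * mon a x.
  exact: (svalP (constructive_indefinite_description _ (cE r))).
exists g; split=> [x y|t].
  pose L := \sum_r mcurve (fun i => x i *: 'X) (f r) * (pairing (M r) x y)%:P.
  have scal_pairing (z : CC) h : pairing h (fun i => x i * z) y = z * pairing h x y.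
    by rewrite /pairing mulr_sumr; apply: eq_bigr => w _; rewrite /pl; ring.
  have LX : 'X * L = 0.
    apply: poly_eq0_infinite => z; rewrite hornerM hornerX -[RHS](fS (fun i => x i * z%:R) y).
    rewrite /L horner_sum mulr_sumr; apply: eq_bigr => r _.
    rewrite hornerM hornerC horner_mcurve scal_pairing mulrCA; congr (_ * _).
    by apply: meval_eq => i; rewrite hornerZ hornerX.
  have L0 : L = 0 by apply/eqP; move/eqP: LX; rewrite mulf_eq0 polyX_eq0.
  have := congr1 (fun P : {poly CC} => P`_q) L0; rewrite coef0 => e; rewrite -[RHS]e.
  by rewrite /L coef_sum; apply: eq_bigr => r _; rewrite coefMC gE.
rewrite -gE; set P := mcurve _ _.
suff -> : P = (s - t) ^+ q *: 'X^q by rewrite coefZ coefXn eqxx mulr1.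
apply/eqP; rewrite -subr_eq0; apply/eqP/poly_eq0_infinite => z; rewrite hornerD hornerN.
rewrite hornerZ hornerXn -exprMn horner_mcurve (_ : meval _ _ =
   (f ord0).@[fun i => z%:R * u i + z%:R * t * v i]); last first.
  by apply: meval_eq => i; rewrite hornerZ hornerX; ring.
rewrite f0 => [|l]; last exact: zcoord_comb.
by rewrite ucoord_comb // vcoord_comb // mulrBl mulrC [t * _]mulrC subrr.
Qed.
End Syzygy.

Section BinomialMatrix.
Variables (F : numFieldType) (q : nat).

Lemma vandermonde_unit (a : 'rV[F]_q.+1) : injective (a 0) ->
  Vandermonde q.+1 a \in unitmx.
Proof.
move=> ainj; rewrite unitmxE unitfE det_Vandermonde.
apply/prodf_neq0 => i _; apply/prodf_neq0 => j ij.
by rewrite subr_eq0 (inj_eq ainj) -val_eqE /= gtn_eqF.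
Qed.

(** The binomial formula factors it as Vandermonde, signed binomial coefficients on a diagonal,
    Vandermonde; [r] reverses the exponents of [a], which run as q - l. *)
Lemma binomial_matrix_unit (a b : 'rV[F]_q.+1) : injective (a 0) -> injective (b 0) ->
  (\matrix_(i < q.+1, j < q.+1) (a 0 i - b 0 j) ^+ q) \in unitmx.
Proof.
move=> ainj binj.
pose r : 'S_q.+1 := perm (inv_inj (@rev_ordK q.+1)).
pose D : 'rV[F]_q.+1 := \row_l ((-1) ^+ l *+ 'C(q, l)).
have -> : (\matrix_(i < q.+1, j < q.+1) (a 0 i - b 0 j) ^+ q) =
    (perm_mx r *m Vandermonde q.+1 a)^T *m diag_mx D *m Vandermonde q.+1 b.
  apply/matrixP => i j; rewrite !mxE exprBn; apply: eq_bigr => l _.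
  rewrite mul_mx_diag !mxE (bigD1 (r l)) //= big1 ?addr0 => [|h /negPf hl]; last first.
    by rewrite !mxE eq_sym hl mul0r.
  rewrite !mxE eqxx mul1r permE /= subSS -mulrnAl; ring.
rewrite !unitmx_mul unitmx_tr unitmx_mul unitmx_perm !vandermonde_unit // andbT.
rewrite unitmxE det_diag unitfE; apply/prodf_neq0 => l _; rewrite mxE.
by rewrite mulrn_eq0 signr_eq0 orbF -lt0n bin_gt0 -ltnS.
Qed.
End BinomialMatrix.

Section Transversal.
Variable q : nat.
Local Notation m := q.+1.
Local Notation k := (m + m).+1.
Local Notation n := m.+2.
Variables (M : frame k n) (u v : 'I_n -> CC).
Local Notation om := (pl u v (w01 m)).
Hypothesis om0 : om != 0.
Hypothesis Muv : forall r, pairing (M r) u v = 0.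
Hypothesis T0 : \det (transv M u v) != 0.
Variables (c : nat) (P : 'M[CC]_(#|{: 'I_n * Mon n q.+1}|, c)).
Hypothesis rP : \rank (Delta2 n q *m P) = \rank (Delta2 n q).

Lemma gamma_mxD (M1 M2 : frame k n) (t : CC) :
  gamma_mx q (fun r w => M1 r w + t * M2 r w) = gamma_mx q M1 + t *: gamma_mx q M2.
Proof.
apply/matrixP => i j; rewrite !mxE mulr_sumr -big_split; apply: eq_bigr => w _ /=.
by rewrite mulrDl mulrA.
Qed.

Lemma transversal_order s (X : 'M_(s, #|{: 'I_k * Mon n q}|)) (Y : 'M_(c, s)) :
  (forall M' : frame k n, \rank (gamma_mx q M' *m P) <= s)%N ->
  exists Q : {poly CC}, forall t,
    \det (X *m (gamma_mx q (fun r w => M r w + t * upd ord0 (w01 m) r w) *m P) *m Y) =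
    t ^+ q.+1 * Q.[t].
Proof.
move=> rs; have [H DH] := Delta2_section rP.
have gE (s0 : CC) := koszul_syzygy om0 Muv T0 s0.
pose g s0 := sval (constructive_indefinite_description _ (gE s0)).
have gP s0 : (forall x y, \sum_r (\sum_a g s0 r a * mon a x) * pairing (M r) x y = 0) /\
  forall t, \sum_a g s0 ord0 a * mon a (fun i => u i + t * v i) = (s0 - t) ^+ q.
  exact: (svalP (constructive_indefinite_description _ (gE s0))).
(* The parameters s = 0, ..., q give q + 1 syzygies, matched below with the q + 1 evaluation points
   u + j v. *)
pose L : 'M[CC]_(q.+1, #|{: 'I_k * Mon n q}|) :=
  \matrix_(i, j) g i%:R (enum_val j).1 (enum_val j).2.
have rowL i : row i L = rowT (fun ra => g i%:R ra.1 ra.2).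
  by apply/rowP => j; rewrite !mxE.
pose x (j : 'I_q.+1) i := u i + j%:R * v i.
pose R0 : 'M[CC]_(_, q.+1) := \matrix_(l, j) evcol q.+1 (x j) v l 0.
have colR j : col j R0 = evcol q.+1 (x j) v.
  by apply/colP => l; rewrite !mxE.
have pairx f j : pairing f (x j) v = pairing f u v.
  rewrite /pairing /x; apply: eq_bigr => w _; rewrite /pl; ring.
have row_gamma i (M' : frame k n) x' y' :
  row i L *m (gamma_mx q M' *m evcol q.+1 x' y') =
  (\sum_r (\sum_a g i%:R r a * mon a x') * pairing (M' r) x' y')%:M.
  rewrite rowL gamma_evcol mul_rowT_colT; congr _%:M.
  rewrite -(pair_bigA _ (fun r a => g i%:R r a * (pairing (M' r) x' y' * mon a x'))) /=.
  apply: eq_bigr => r _; rewrite mulr_suml; apply: eq_bigr => a _; ring.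
have LG : L *m gamma_mx q M = 0.
  apply: evcol_free => x' y'; rewrite mul0mx -mulmxA.
  apply/row_matrixP => i; rewrite row_mul row_gamma (proj1 (gP _)) row0.
  by apply/matrixP => a b; rewrite !mxE mul0rn.
pose U : frame k n := upd ord0 (w01 m).
have [Q QE] : exists Q : {poly CC}, forall t,
    \det (X *m (gamma_mx q M *m P + t *: (gamma_mx q U *m P)) *m Y) = t ^+ q.+1 * Q.[t].
  apply: (@det_order _ s _ _ _ _ _ X Y L (H *m R0)).
  - by rewrite mulmxA LG mul0mx.
  - rewrite mulmxA (gamma_section _ DH); apply/matrixP => i j.
    have := congr1 (fun C : 'cV_ _ => C i 0) (gamma_evcol q M (x j) v).
    rewrite -colR -[X in X = _](_ : (gamma_mx q M *m R0) i j = _); last first.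
      by rewrite !mxE; apply: eq_bigr => l _; rewrite !mxE.
    by move=> ->; rewrite !mxE pairx Muv mul0r.
  - rewrite -mulmxA [_ *m (H *m _)]mulmxA (gamma_section _ DH).
    pose a : 'rV[CC]_q.+1 := \row_i i%:R.
    have ainj : injective (a 0) by move=> i j; rewrite !mxE => /eqP; rewrite eqr_nat => /eqP/val_inj.
    rewrite (_ : L *m _ = om *: \matrix_(i < q.+1, j < q.+1) (a 0 i - a 0 j) ^+ q).
      by rewrite unitmxZ ?unitfE // binomial_matrix_unit.
    apply/matrixP => i j; transitivity ((row i L *m (gamma_mx q U *m evcol q.+1 (x j) v)) 0 0).
      by rewrite -colR colE !mulmxA -colE -!row_mul !mxE.
    rewrite row_gamma !mxE mulr1n (bigD1 ord0) //= [X in _ + X]big1 ?addr0 => [|r /negPf r0].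
      rewrite [X in X * _](proj2 (gP i%:R) j%:R) mulrC; congr (_ * _).
      rewrite pairx -[RHS]mul1r -pairing_delta; apply: pairing_eq => w.
      by rewrite /U /upd eqxx; case: eqP.
    rewrite (_ : pairing _ _ _ = 0) ?mulr0 // /pairing big1 // => w _.
    by rewrite /U /upd r0 mul0r.
  - by move=> t; rewrite scalemxAl -mulmxDl -gamma_mxD.
by exists Q => t; rewrite -QE gamma_mxD mulmxDl -scalemxAl.
Qed.
End Transversal.

(** * The equation of the resultant divisor *)

Section PolynomialFunctions.
Variables k n : nat.
Implicit Types F G : frame k n -> CC.

Definition polyfun F := exists p : {mpoly CC[nvars k n]}, forall M, ev p M = F M.

Lemma polyfun_const c : polyfun (fun=> c).
Proof. by exists c%:MP => M; rewrite /ev mevalC. Qed.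

Lemma polyfun_coord r w : polyfun (fun M => M r w).
Proof.
by exists 'X_(enum_rank (r, w)) => M; rewrite /ev mevalXU /frame_pt enum_rankK.
Qed.

Lemma polyfunM F G : polyfun F -> polyfun G -> polyfun (fun M => F M * G M).
Proof. by case=> p pF [p' pG]; exists (p * p') => M; rewrite -pF -pG evM. Qed.

Lemma polyfun_sum (J : Type) (r : seq J) (P : pred J) (F : J -> frame k n -> CC) :
  (forall j, polyfun (F j)) -> polyfun (fun M => \sum_(j <- r | P j) F j M).
Proof.
move=> pF; elim: r => [|j r [p pE]].
  by exists 0 => M; rewrite big_nil /ev meval0.
have [p' p'E] := pF j; exists (if P j then p' + p else p) => M.
by rewrite big_cons -pE -p'E; case: (P j); rewrite ?/ev ?mevalD.
Qed.

Lemma polyfun_prod (J : Type) (r : seq J) (P : pred J) (F : J -> frame k n -> CC) :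
  (forall j, polyfun (F j)) -> polyfun (fun M => \prod_(j <- r | P j) F j M).
Proof.
move=> pF; elim: r => [|j r [p pE]].
  by exists 1 => M; rewrite big_nil /ev meval1.
have [p' p'E] := pF j; exists (if P j then p' * p else p) => M.
by rewrite big_cons -pE -p'E; case: (P j); rewrite ?evM.
Qed.

Lemma polyfun_det s (F : 'I_s -> 'I_s -> frame k n -> CC) :
  (forall i j, polyfun (F i j)) -> polyfun (fun M => \det (\matrix_(i, j) F i j M)).
Proof.
move=> pF; have [p pE] : polyfun (fun M => \sum_(s0 : 'S_s) (-1) ^+ s0 * \prod_i F i (s0 i) M).
  apply: polyfun_sum => s0; apply: polyfunM; first exact: polyfun_const.
  by apply: polyfun_prod => i; apply: pF.
exists p => M; rewrite pE; apply: eq_bigr => s0 _; congr (_ * _).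
by apply: eq_bigr => i _; rewrite mxE.
Qed.

Lemma polyfun_minor q c (P : 'M[CC]_(_, c)) s (X : 'M_(s, _)) (Y : 'M_(c, s)) :
  polyfun (fun M => \det (X *m (gamma_mx q M *m P) *m Y)).
Proof.
have pg i j : polyfun (fun M => gamma_mx q M i j).
  have [p pE] : polyfun (fun M => \sum_w M (enum_val i).1 w *
      koszul_delta2 (w, (enum_val i).2) (enum_val j)).
    apply: polyfun_sum => w; apply: polyfunM; first exact: polyfun_coord.
    exact: polyfun_const.
  by exists p => M; rewrite pE mxE.
have pxg i j : polyfun (fun M => (X *m gamma_mx q M) i j).
  have [p pE] : polyfun (fun M => \sum_l X i l * gamma_mx q M l j).
    apply: polyfun_sum => l; apply: polyfunM; first exact: polyfun_const.
    exact: pg.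
  by exists p => M; rewrite pE mxE.
have [p pE] : polyfun (fun M => \det (\matrix_(i, j)
    \sum_l (X *m gamma_mx q M) i l * (P *m Y) l j)).
  apply: (@polyfun_det _ (fun i j M => \sum_l (X *m gamma_mx q M) i l * (P *m Y) l j)) => i j.
  apply: polyfun_sum => l; apply: polyfunM; first exact: pxg.
  exact: polyfun_const.
exists p => M; rewrite pE; congr (\det _); apply/matrixP => i j.
by rewrite mulmxA -mulmxA !mxE.
Qed.
End PolynomialFunctions.

Lemma prime_elt_irred (B : idomainType) (p : B) : prime_elt p -> irred_elt p.
Proof.
case=> p0 pu pp; split=> // a b pab.
have unit_of c d : p = c * d -> rdvd p c -> d \is a GRing.unit.
  move=> pcd [e ce]; apply/unitrPr; exists e.
  apply: (mulfI p0); rewrite mulr1 mulrCA -ce mulrC; exact/esym.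
have [pa|pb] : rdvd p a \/ rdvd p b by apply: pp; exists 1; rewrite mulr1.
  by right; apply: unit_of pab pa.
by left; apply: unit_of pb; rewrite mulrC.
Qed.

Section ResultantPrime.
Variable m : nat.
Local Notation k := (m + m).+1.
Local Notation n := m.+2.
Local Notation Z := ('I_k * Wedge2 n + ('I_n + 'I_n))%type.
Local Notation A := {mpoly CC[nvars k n]}.
Implicit Types (M : frame k n) (p R g h : A).
Local Notation U := (upd ord0 (w01 m)).

Lemma res_locus0 : exists M : frame k n, res_locus M.
Proof.
have [z zpl] := @pl0_neq0 k n (w01 m).
by exists (Phi (w01 m) z); apply/in_resP; exists (zu z), (zv z); apply: Phi_res.
Qed.

(** The ideal of X is prime and, X being nonempty, contains no unit. *)
Lemma vanishing_prime_factor p : p != 0 -> vanishing p ->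
  exists R h, [/\ irred_elt R, vanishing R & p = R * h].
Proof.
move=> p0; have := mpoly_prime_fact (@mpoly_irred_prime _ _) p0.
elim=> {p p0} [u uu vu|p c pp _ IH].
  have [M rM] := res_locus0.
  case/unitrPr: uu => u' /(congr1 (fun p => ev p M)).
  by rewrite evM vu // mul0r /ev meval1 => /eqP; rewrite eq_sym oner_eq0.
case/(vanishing_prime (w01 m)) => [vp|/IH[R [h [iR vR ->]]]].
  by exists p, c; split=> //; apply: prime_elt_irred.
by exists R, (p * h); split; [exact: iR | exact: vR | exact: mulrCA].
Qed.

Section Generator.
Variable R : A.
Hypotheses (iR : irred_elt R) (vR : vanishing R).

Lemma vanishing_at_upd M u v c : in_res M u v ->
  ev R (fun r w => (M r w + c * U r w) + U r w * - c) = 0.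
Proof.
move=> Muv; rewrite -[RHS](vR (proj2 (in_resP M) (ex_intro _ u (ex_intro _ v Muv)))).
by apply: ev_ext => r w; ring.
Qed.

(** Otherwise [R] would vanish on all translates of X along [U], against dominance. *)
Lemma moves_along_upd : exists M0 y, ev R (fun r w => M0 r w + U r w * y) <> ev R M0.
Proof.
apply: NNPP => nm; case: iR => /eqP R0 _ _; apply: R0.
apply: dominance => c M u v Muv; apply: NNPP => ne; apply: nm.
exists M, c; rewrite (vR (proj2 (in_resP M) (ex_intro _ u (ex_intro _ v Muv)))).
by move=> e; apply: ne; rewrite -[RHS]e; apply: ev_ext => r w; rewrite mulrC.
Qed.

(** If [R] did not divide [g], elimination along [U] would give a nonzero [r] vanishing at the base
    point of every line that meets X, that is, on all translates of X along [U]. *)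
Lemma vanishing_rdvd g : vanishing g -> rdvd R g.
Proof.
move=> vg; apply: NNPP => nRg.
have [M0 [y0 mv]] := moves_along_upd.
have [r r0 rz] := @irred_no_common_zero _ _ (frame_pt U) R g (frame_pt M0) y0 iR nRg mv.
case/eqP: r0; apply: dominance => c M u v Muv.
apply: (rz _ (- c)); first exact: (vanishing_at_upd c Muv).
rewrite -[RHS](vg M); last by apply/in_resP; exists u, v.
by apply: meval_eq => i; rewrite /frame_pt; ring.
Qed.

(** Otherwise [R] would divide its own derivative, which has smaller degree and would be zero; [R]
    would then be constant along [U]. *)
Lemma deriv_not_vanishing : ~ vanishing (dM ord0 (w01 m) R).
Proof.
move=> /vanishing_rdvd[h dE].
have R0 : R != 0 by case: iR.
have d0 : dM ord0 (w01 m) R = 0.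
  have [h0|h0] := eqVneq h 0; first by rewrite dE h0 mulr0.
  have := msize_mderiv (enum_rank (ord0 : 'I_k, w01 m)) R; rewrite -/(dM _ _ _) dE msizeM //.
  have := msize_poly_eq0 R; have := msize_poly_eq0 h; rewrite (negPf R0) (negPf h0).
  by move: (msize R) (msize h) => a b /eqP ? /eqP ?; lia.
have [M0 [y]] := moves_along_upd; apply.
pose c (r : 'I_k) (w : Wedge2 n) : {poly CC} := (M0 r w)%:P + (U r w)%:P * 'X.
have cE t : ev R (fun r w => M0 r w + U r w * t) = (fcurve c R).[t].
  by rewrite horner_fcurve; apply: ev_ext => r w; rewrite !hornerE.
have : (fcurve c R)^`() = 0.
  apply: poly_eq0_infinite => t; rewrite deriv_fcurve.
  under eq_bigr => r _ do under eq_bigr => w _ do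
    rewrite /c derivD derivC add0r derivM derivC mul0r add0r derivX mulr1 hornerC.
  by rewrite (sum_upd (fun r w => ev (dM r w R) _)) d0 /ev meval0.
have [M0E ->] : ev R M0 = (fcurve c R).[0] /\ ev R (fun r w => M0 r w + U r w * y) = (fcurve c R).[y].
  by split=> //; rewrite -cE; apply: ev_ext => r w; rewrite mulr0 addr0.
rewrite M0E; move: (fcurve c R) => p dp.
suff : p = (p`_0)%:P by move=> ->; rewrite !hornerC.
apply/polyP => -[|i]; rewrite coefC //=; apply/eqP.
have /eqP := congr1 (fun P : {poly CC} => P`_i) dp.
by rewrite coef_deriv coef0 mulrn_eq0.
Qed.

(** With p = R^f h and f < e, restrict to the line along [U] at a general point of X. There [R] has
    a simple zero, so order e of [p] forces [h] to vanish at that point; hence [h] vanishes on X and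
    [R] divides it. *)
Lemma power_divides e p :
  (forall z : Z -> CC, pl (zu z) (zv z) (w01 m) != 0 ->
     \det (transv (Phi (w01 m) z) (zu z) (zv z)) != 0 ->
     exists Q : {poly CC}, forall t,
       ev p (fun r w => Phi (w01 m) z r w + t * U r w) = t ^+ e * Q.[t]) ->
  rdvd (R ^+ e) p.
Proof.
move=> ord_p; suff : forall f, (f <= e)%N -> rdvd (R ^+ f) p by apply.
elim=> [|f IHf] lef; first by exists p; rewrite expr0 mul1r.
have [h pE] := IHf (ltnW lef).
suff /vanishing_rdvd[h' hE] : vanishing h by exists h'; rewrite pE hE exprSr mulrA.
have [z1 trz1] := @transv_neq0 m.
have [z2 [_ dz2 trz2]] := vanishing_generic (w01 m) deriv_not_vanishing (@regular_transv m) trz1.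
apply: (@vanishing_chart _ _ (w01 m) _ (fun z : Z -> CC =>
  ev (dM ord0 (w01 m) R) (Phi (w01 m) z) * \det (transv (Phi (w01 m) z) (zu z) (zv z))) z2).
- by apply: regularM; [apply: regular_ev_Phi|apply: regular_transv].
- by rewrite mulf_neq0.
move=> z zpl; rewrite mulf_eq0 negb_or => /andP[dz trz].
have [Q QE] := ord_p z zpl trz.
pose c (r : 'I_k) (w : Wedge2 n) : {poly CC} := (Phi (w01 m) z r w)%:P + (U r w)%:P * 'X.
have cE p' t : ev p' (fun r w => Phi (w01 m) z r w + t * U r w) = (fcurve c p').[t].
  by rewrite horner_fcurve; apply: ev_ext => r w; rewrite !hornerE mulrC.
have c0 p' : (fcurve c p').[0] = ev p' (Phi (w01 m) z).
  by rewrite -cE; apply: ev_ext => r w; rewrite mul0r addr0.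
have R0 : (fcurve c R).[0] = 0.
  by rewrite c0; apply: vR; apply/in_resP; exists (zu z), (zv z); apply: Phi_res.
have dR : (fcurve c R)^`().[0] = ev (dM ord0 (w01 m) R) (Phi (w01 m) z).
  rewrite deriv_fcurve.
  under eq_bigr => r _ do under eq_bigr => w _ do
    rewrite /c derivD derivC add0r derivM derivC mul0r add0r derivX mulr1 hornerC.
  rewrite (sum_upd (fun r w => ev (dM r w R) _)); apply: ev_ext => r w.
  by rewrite !hornerE.
have RX := poly_divX R0; move: RX dR; set H := drop_poly 1 _ => RX.
rewrite RX derivM derivX mul1r hornerD hornerM hornerX mul0r addr0 => H0.
have XE : 'X^f * (H ^+ f * fcurve c h) = 'X^f * ('X^(e - f) * Q).
  apply/eqP; rewrite -subr_eq0; apply/eqP/poly_eq0_infinite => t.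
  rewrite hornerD hornerN mulrA -exprMn -RX mulrA -exprD subnKC ?(ltnW lef) //.
  rewrite !hornerM hornerXn -QE pE cE /fcurve mcurveM mcurveXn !hornerM subrr //.
have Xf : 'X^f != 0 :> {poly CC} by rewrite -size_poly_eq0 size_polyXn.
have /(congr1 (horner^~ 0)) := mulfI Xf XE.
rewrite !hornerM horner_exp H0 hornerXn expr0n subn_eq0 leqNgt lef mul0r c0 => /eqP.
by rewrite mulf_eq0 expf_eq0 (negPf dz) andbF /= => /eqP.
Qed.
End Generator.
End ResultantPrime.

(** * Lattice paths and row degrees *)

(* A lattice path from (0,1) to (m,m+1) staying above the diagonal is coded by
   the column heights [f]; its cells are the pairs where [excess] vanishes. *)
Definition chain_fun m (f : nat -> nat) :=
  [/\ f 0%N = 0%N, {in [pred c | c <= m]%N &, {homo f : c d / (c <= d)%N}} &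
      forall c, (0 < c <= m)%N -> (f c < c)%N].

Section Cells.
Variables (m : nat) (f : nat -> nat).
Hypothesis cf : chain_fun m f.
Implicit Types (I J c : nat).

Let f0 : f 0%N = 0%N. Proof. by case: cf. Qed.
Let fle c d : (c <= d -> d <= m -> f c <= f d)%N.
Proof. by case: cf => _ fh _ cd dm; apply: fh => //=; rewrite inE (leq_trans cd dm). Qed.
Let flt c : (0 < c <= m -> f c < c)%N. Proof. by case: cf => _ _; apply. Qed.

(** Truncated differences: what the separable weight alpha I + beta J exceeds I * J by. It vanishes
    exactly on the path. *)
Definition excess I J := (\sum_(0 <= c < J) (f c - I) + \sum_(J <= c < m.+1) (I - f c))%N.
Definition alpha I := (\sum_(0 <= c < m.+1) (I - f c))%N.
Definition beta J := (\sum_(0 <= c < J) f c)%N.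

Lemma alpha_beta I J : (J <= m.+1)%N -> (alpha I + beta J = I * J + excess I J)%N.
Proof.
move=> Jm; rewrite /alpha (@big_cat_nat _ _ _ J) //= addnAC /excess addnA; congr (_ + _)%N.
rewrite /beta -big_split /= (_ : (I * J)%N = \sum_(0 <= c < J) I); last first.
  by rewrite sum_nat_const_nat subn0 mulnC.
by rewrite -big_split /=; apply: eq_bigr => c _; lia.
Qed.

Lemma excess_eq0 I J : (I < J <= m.+1)%N ->
  (excess I J == 0%N) = (f J.-1 <= I)%N && ((J <= m) ==> (I <= f J))%N.
Proof.
case/andP=> IJ Jm; rewrite /excess addn_eq0 !sum_nat_seq_eq0; congr (_ && _).
  apply/allP/idP => [/(_ J.-1)|h c].
    by rewrite mem_index_iota subn_eq0 /=; apply; lia.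
  rewrite mem_index_iota /= subn_eq0 => cJ; apply: leq_trans h; apply: fle; lia.
apply/allP/implyP => [h Jm'|h c].
  by have := h J; rewrite mem_index_iota subn_eq0 /=; apply; lia.
rewrite mem_index_iota /= subn_eq0 => cJ; apply: leq_trans (h _) _; first by lia.
by apply: fle; lia.
Qed.

(** Makes the second product of a Pluecker coordinate of the toric curve negligible. *)
Lemma excess_transposed I J : (0 < I < J)%N -> (J <= m)%N -> (0 < excess J I)%N.
Proof.
move=> IJ Jm; rewrite /excess addn_gt0; apply/orP; right.
have fI := flt (c := I); rewrite (@big_ltn _ _ _ I) //; last lia.
by rewrite addn_gt0; apply/orP; left; lia.
Qed.

Lemma excess01 : excess 0 1 = 0%N.
Proof.
apply/eqP; rewrite excess_eq0 //= f0 /=; exact: implybT.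
Qed.

Lemma cell_left c : (0 < c <= m)%N -> excess (f c) c = 0%N.
Proof.
move=> cm; apply/eqP; rewrite excess_eq0; last by have := flt cm; lia.
by apply/andP; split; [apply: fle; lia | apply/implyP].
Qed.

Lemma cell_right c : (0 < c <= m)%N -> excess (f c) c.+1 = 0%N.
Proof.
move=> cm; apply/eqP; rewrite excess_eq0 /=; last by have := flt cm; lia.
by rewrite leqnn; apply/implyP => ?; apply: fle; lia.
Qed.

Lemma cell_sum_inj I J I' J' : (I < J <= m.+1)%N -> (I' < J' <= m.+1)%N ->
  excess I J = 0%N -> excess I' J' = 0%N -> (I + J = I' + J')%N -> I = I' /\ J = J'.
Proof.
wlog JJ : I J I' J' / (J <= J')%N => [H|] c1 c2 e1 e2 s.
  have [/H|/ltnW/H] := leqP J J'; first exact.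
  by case/(_ _ _ c2 c1 e2 e1 (esym s)).
have [JE|nJ] := eqVneq J J'; first by split => //; lia.
move/eqP: e1; rewrite excess_eq0 // => /andP[_ /implyP h1].
move/eqP: e2; rewrite excess_eq0 // => /andP[h2 _].
have h3 : (f J <= f J'.-1)%N by apply: fle; lia.
have h4 : (I <= f J)%N by apply: h1; lia.
by lia.
Qed.

(** With [cell_sum_inj]: the path meets each antidiagonal exactly once, so it has 2m + 1 cells, as
    many as a frame has rows. *)
Lemma cell_of_sum s : (s <= m + m)%N ->
  exists I J, [/\ (I < J <= m.+1)%N, excess I J = 0%N & (I + J = s.+1)%N].
Proof.
move=> sm; pose P J := ((0 < J) && ((J <= m) ==> (s < f J + J)) && (J <= m.+1))%N.
have exP : exists J, P J by exists m.+1; rewrite /P; apply/andP; split; lia.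
have [J /andP[/andP[J0 /implyP h1] Jm] Jmin] := ex_minnP exP.
have h2 : (f J.-1 + J.-1 <= s)%N.
  rewrite leqNgt; apply/negP => h; have : (J <= J.-1)%N; last lia.
  apply: Jmin; rewrite /P; apply/andP; split; last lia.
  apply/andP; split; last exact/implyP.
  case: J J0 h h1 Jm => // -[|J] //=; rewrite f0; lia.
have [JS|JS] := leqP J m.
  have := h1 JS; have := flt (c := J); exists (s.+1 - J)%N, J; split; try lia.
  apply/eqP; rewrite excess_eq0; last lia.
  by apply/andP; split; [lia | apply/implyP; lia].
exists (s.+1 - J)%N, J; split; try lia.
apply/eqP; rewrite excess_eq0; last lia.
by apply/andP; split; [lia | apply/implyP; lia].
Qed.

End Cells.

Lemma chain_fun_separated m f g c : chain_fun m f -> chain_fun m g ->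
  (0 < c <= m)%N -> (f c < g c)%N -> (0 < excess m g (f c) c.+1)%N.
Proof.
move=> cf cg cm fg; rewrite lt0n excess_eq0 //=; first by rewrite leqNgt fg.
by case: cf => _ _ /(_ c cm); lia.
Qed.

(** Nondecreasing sequences of length [l], bounded by [v], whose entry i is at most i, built from
    the last entry. They are counted by ballot numbers, and by the Catalan number for l = v. *)
Fixpoint chains l v : seq (seq nat) :=
  if l is l'.+1 then flatten [seq [seq rcons s x | s <- chains l' x] | x <- iota 0 (minn v l').+1]
  else [:: [::]].

Lemma chainsS l v : chains l.+1 v =
  flatten [seq [seq rcons s x | s <- chains l x] | x <- iota 0 (minn v l).+1].
Proof. by []. Qed.

Lemma size_chains_mem l v s : s \in chains l v -> size s = l.
Proof.
elim: l v s => [|l IHl] v s; first by rewrite inE => /eqP->.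
rewrite chainsS; case/flatten_mapP => x _ /mapP[s' /IHl e ->]; by rewrite size_rcons e.
Qed.

Lemma uniq_chains l v : uniq (chains l v).
Proof.
elim: l v => [|l IHl] v //; rewrite chainsS.
elim: (iota 0 _) (iota_uniq 0 (minn v l).+1) => [|x r IHr] //= /andP[xr ur].
rewrite cat_uniq IHr // andbT map_inj_uniq ?IHl //=; last by move=> s s' /rcons_inj[].
apply/hasPn => s /flatten_mapP[y yr /mapP[s' _ ->]].
apply/mapP => -[s'' _ /rcons_inj[_ e]].
by move: xr; rewrite -e yr.
Qed.

Lemma chains_last l v s : s \in chains l v -> (forall i, i < l -> nth 0 s i <= v)%N.
Proof.
elim: l v s => [|l IHl] v s //; rewrite chainsS => /flatten_mapP[x xv /mapP[s' s'in ->]] i il.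
rewrite mem_iota /= in xv; have ss := size_chains_mem s'in.
rewrite nth_rcons ss; case: (ltngtP i l) => h; [|lia|lia].
by apply: leq_trans (IHl _ _ s'in i h) _; lia.
Qed.

Lemma chains_mono l v s : s \in chains l v ->
  (forall i j, i <= j -> j < l -> nth 0 s i <= nth 0 s j)%N.
Proof.
elim: l v s => [|l IHl] v s //; rewrite chainsS => /flatten_mapP[x xv /mapP[s' s'in ->]] i j ij jl.
have ss := size_chains_mem s'in; rewrite !nth_rcons ss.
case: (ltngtP j l) => h; [|lia|].
  by rewrite (leq_ltn_trans ij h); apply: IHl s'in _ _ ij h.
by case: (ltngtP i l) => // h'; exact: chains_last s'in _ h'.
Qed.

Lemma chains_bound l v s : s \in chains l v -> (forall i, i < l -> nth 0 s i <= i)%N.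
Proof.
elim: l v s => [|l IHl] v s //; rewrite chainsS => /flatten_mapP[x xv /mapP[s' s'in ->]] i il.
rewrite mem_iota /= in xv; have ss := size_chains_mem s'in.
rewrite nth_rcons ss; case: (ltngtP i l) => h; [|lia|lia].
exact: IHl s'in i h.
Qed.

(** The shift turns s_i <= i into f c < c. As [0.-1] is 0, f 0 and f 1 both read entry 0, which is
    0; for m = 0 the default value is read. *)
Lemma chain_funP m s : s \in chains m m -> chain_fun m (fun c => nth 0 s c.-1)%N.
Proof.
case: m => [|m] sin.
  split => // [|c d _ _ _|c]; last by lia.
    by move: sin; rewrite inE => /eqP->.
  by move: sin; rewrite inE => /eqP->; rewrite !nth_nil.
split => [|c d|c /andP[c0 cm]].
- by apply/eqP; rewrite -leqn0; apply: chains_bound sin _ _.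
- rewrite !inE => cm dm cd; apply: chains_mono sin _ _ _ _; lia.
by have := chains_bound sin (i := c.-1); lia.
Qed.

(** The ballot formula in additive form; the factor [(0 < v)] cancels the binomial when [v.-1]
    truncates. *)
Lemma size_chains l v : (v <= l)%N ->
  (size (chains l v) + 'C(l + v, v.-1) * (0 < v) = 'C(l + v, v))%N.
Proof.
elim: l v => [|l IHl] v vl; first by case: v vl.
have sz w : (w <= l)%N -> size (chains l.+1 w) = (\sum_(0 <= x < w.+1) size (chains l x))%N.
  move=> wl; rewrite chainsS size_flatten /shape -map_comp (minn_idPl wl) sumnE big_map.
  by rewrite /index_iota subn0; apply: eq_bigr => x _; rewrite /= size_map.
have H w : (w <= l)%N -> (size (chains l.+1 w) + 'C(l.+1 + w, w.-1) * (0 < w) = 'C(l.+1 + w, w))%N.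
  elim: w => [|w IHw] wl; rewrite sz //.
    by rewrite big_nat1 -[size _]addn0 -[X in (_ + X + _)%N](muln0 'C(l + 0, 0)) IHl // !bin0.
  rewrite big_nat_recr //= -sz ?(ltnW wl) // muln1.
  have := IHw (ltnW wl); have := IHl w.+1 wl; rewrite /= muln1.
  rewrite !addSn !addnS !binS.
  case: w wl IHw => [|w] wl IHw /=.
    by rewrite !bin0 !muln0 addn0; lia.
  by rewrite muln1 !binS; lia.
move: vl; rewrite leq_eqVlt => /predU1P[->|]; last exact: H.
have -> : chains l.+1 l.+1 = chains l.+1 l by rewrite !chainsS (minn_idPr (leqnSn l)) minnn.
have := H l (leqnn l); move: (size (chains l.+1 l)) => S.
rewrite muln1 -pred_Sn [(l.+1 + l.+1)%N]addnS.
case: l {IHl sz H} => [|l]; first by rewrite muln0 addn0 => ->.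
rewrite muln1 -pred_Sn; set N := (l.+2 + l.+1)%N => e.
have sym : 'C(N, l.+2) = 'C(N, l.+1).
  by rewrite -bin_sub; [congr ('C(_, _)); rewrite /N; lia | rewrite /N; lia].
by rewrite (binS N l.+1) (binS N l) sym -e; lia.
Qed.

Lemma size_chains_binomial m : (m * size (chains m m) = 'C(m + m, m.-1) * (0 < m))%N.
Proof.
case: m => [|m] //; have := size_chains (leqnn m.+1); rewrite muln1 /= => e.
have := mul_bin_left (m.+1 + m.+1) m.+1.
have -> : 'C(m.+1 + m.+1, m.+2) = 'C(m.+1 + m.+1, m).
  by rewrite -bin_sub; [congr ('C(_, _)); lia | lia].
by rewrite -e addnK; move: 'C(_, _) (size _) => x y; nia.
Qed.

(** * Toric degeneration and row degree *)

Section InitialForm.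
Variables (k n : nat) (nu : Wedge2 n -> nat).
Local Notation A := {mpoly CC[nvars k n]}.
Implicit Types (p : A) (M : frame k n).

(** The weight of a variable ignores its row: the grading comes from a torus acting on /\^2 V. *)
Definition wt (mm : 'X_{1..nvars k n}) := (\sum_(i < nvars k n) mm i * nu (enum_val i).2)%N.
Definition topwt p := (\max_(mm <- msupp p) wt mm)%N.
Definition initial p : A := \sum_(mm <- msupp p | wt mm == topwt p) p@_mm *: 'X_[mm].

Lemma wt_le p mm : mm \in msupp p -> (wt mm <= topwt p)%N.
Proof. by move=> h; exact: leq_bigmax_seq. Qed.

Lemma mcoeff_initial p mm :
  (initial p)@_mm = if wt mm == topwt p then p@_mm else 0.
Proof.
rewrite /initial raddf_sum /=.
have [mp|mp] := boolP (mm \in msupp p).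
  have E x : (p@_x *: 'X_[x])@_mm = p@_mm *+ (x == mm).
    by rewrite mcoeffZ mcoeffX; case: eqP => [->|]; rewrite ?mulr1 ?mulr0.
  rewrite big_mkcond (bigD1_seq mm) ?msupp_uniq //= E eqxx mulr1n big1 ?addr0 //.
  by move=> x /negPf xm; case: ifP => // _; rewrite E xm.
rewrite big1_seq => [|x /andP[_ xp]].
  by rewrite memN_msupp_eq0 // if_same.
rewrite mcoeffZ mcoeffX; case: eqP => [xm|]; last by rewrite mulr0.
by rewrite xm (negPf mp) in xp.
Qed.

Lemma initial_neq0 p : p != 0 -> initial p != 0.
Proof.
move=> p0; have s0 : (0 < size (msupp p))%N by rewrite lt0n size_eq0 msupp_eq0.
have [mm mp mE] : exists2 mm, mm \in msupp p & wt mm = topwt p.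
  rewrite /topwt; case: (msupp p) s0 => // x s _.
  elim: s x => [|y s IHs] x; first by exists x; rewrite ?inE // big_seq1.
  rewrite big_cons; case: (leqP (wt x) (\max_(j <- y :: s) wt j)) => [le|lt].
    have [z zs zE] := IHs y; exists z; first by rewrite inE zs orbT.
    by rewrite zE.
  by exists x; rewrite ?inE ?eqxx.
apply/eqP => i0; have := mcoeff_initial p mm; rewrite i0 mcoeff0 mE eqxx => /eqP.
by rewrite eq_sym mcoeff_eq0 mp.
Qed.

Lemma fcurveE (c : 'I_k -> Wedge2 n -> {poly CC}) p :
  fcurve c p = \sum_(mm <- msupp p) p@_mm *: \prod_(i < nvars k n) (c (enum_val i).1 (enum_val i).2) ^+ mm i.
Proof.
by rewrite /fcurve /mcurve /mmap; apply: eq_bigr => mm _; rewrite mul_polyC.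
Qed.

Lemma ev_sum p M :
  ev p M = \sum_(mm <- msupp p) p@_mm * \prod_(i < nvars k n) (frame_pt M i) ^+ mm i.
Proof. exact: mevalE. Qed.

Lemma ev_initial p M : ev (initial p) M =
  \sum_(mm <- msupp p | wt mm == topwt p) p@_mm * \prod_(i < nvars k n) (frame_pt M i) ^+ mm i.
Proof.
rewrite /ev /initial raddf_sum; apply: eq_bigr => mm _.
by rewrite /= mevalZ mevalX.
Qed.

(** Multiplied by t^(topwt p), the value of [p] on the curve is a polynomial in t whose value at 0
    only keeps the terms of top weight. *)
Lemma initial_curve (c : 'I_k -> Wedge2 n -> {poly CC}) p :
  (forall t, t != 0 -> ev p (fun r w => (c r w).[t] / t ^+ nu w) = 0) ->
  ev (initial p) (fun r w => (c r w).[0]) = 0.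
Proof.
move=> pc; pose q := \sum_(mm <- msupp p) p@_mm *:
  ('X^(topwt p - wt mm) * \prod_(i < nvars k n) (c (enum_val i).1 (enum_val i).2) ^+ mm i).
have q0 : q = 0.
  suff : 'X * q = 0 by move/eqP; rewrite mulf_eq0 polyX_eq0 => /eqP.
  apply: poly_eq0_infinite => s; rewrite hornerM hornerX; move: (s%:R) => t.
  have [->|t0] := eqVneq t 0; first by rewrite mul0r.
  rewrite (_ : q.[t] = t ^+ topwt p * ev p (fun r w => (c r w).[t] / t ^+ nu w)); last first.
    rewrite ev_sum mulr_sumr /q horner_sum big_seq [in RHS]big_seq.
    apply: eq_bigr => mm mp; rewrite hornerZ hornerM hornerXn [RHS]mulrCA; congr (_ * _).
    set c' := \prod_i (c _ _) ^+ _.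
    transitivity (t ^+ topwt p * (c'.[t] / t ^+ wt mm)).
      rewrite [RHS]mulrCA [RHS]mulrC; congr (_ * _).
      by rewrite -{2}(subnK (wt_le mp)) exprD mulfK // expf_neq0.
    congr (_ * _); rewrite horner_prod /wt -prodrXr -prodfV -big_split; apply: eq_bigr => i _ /=.
    by rewrite /frame_pt exprMn horner_exp exprVn -exprM mulnC.
  by rewrite pc // !mulr0.
have := congr1 (horner^~ 0) q0; rewrite horner0 => e; rewrite -[RHS]e ev_initial.
rewrite /q horner_sum [in LHS]big_mkcond big_seq [in RHS]big_seq.
apply: eq_bigr => mm mp /=; rewrite hornerZ hornerM hornerXn expr0n subn_eq0.
have -> : (topwt p <= wt mm)%N = (wt mm == topwt p) by rewrite eqn_leq wt_le.
case: eqP => _; rewrite ?mul0r ?mulr0 // mul1r; congr (_ * _).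
by rewrite horner_prod; apply: eq_bigr => i _; rewrite horner_exp.
Qed.

Definition line (M N : frame k n) (r : 'I_k) (w : Wedge2 n) : {poly CC} := (M r w)%:P + (N r w)%:P * 'X.

(** As a polynomial in s, the i-th coefficient of [p] along the rescaled line has that of the
    initial form as its coefficient of degree [topwt p]. *)
Lemma initial_line p M N i : (fcurve (line M N) (initial p))`_i != 0 ->
  exists s : CC, (fcurve (line (fun r w => s ^+ nu w * M r w)
                               (fun r w => s ^+ nu w * N r w)) p)`_i != 0.
Proof.
pose C (mm : 'X_{1..nvars k n}) : CC := (\prod_(i < nvars k n) (line M N (enum_val i).1 (enum_val i).2) ^+ mm i)`_i.
pose S := \sum_(mm <- msupp p) (p@_mm * C mm) *: 'X^(wt mm).
have SE s : S.[s] = (fcurve (line (fun r w => s ^+ nu w * M r w)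
                               (fun r w => s ^+ nu w * N r w)) p)`_i.
  rewrite fcurveE coef_sum /S horner_sum; apply: eq_bigr => mm _.
  rewrite hornerZ hornerXn coefZ -mulrA; congr (_ * _); rewrite mulrC /C.
  rewrite -coefZ; congr (_`_i); congr polyseq; rewrite /wt -prodrXr -scaler_prod; apply: eq_bigr => l _.
  by rewrite mulnC exprM -exprZn /line scalerDr -!mul_polyC !polyCM mulrA.
have Stop : (fcurve (line M N) (initial p))`_i = S`_(topwt p).
  have -> : fcurve (line M N) (initial p) = \sum_(mm <- msupp p | wt mm == topwt p)
      p@_mm *: \prod_(i < nvars k n) (line M N (enum_val i).1 (enum_val i).2) ^+ mm i.
    rewrite /initial /fcurve /mcurve raddf_sum; apply: eq_bigr => mm _.
    by rewrite /= mmapZ mmapX mul_polyC.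
  rewrite !coef_sum big_mkcond; apply: eq_bigr => mm _.
  by rewrite !coefZ coefXn eq_sym; case: eqP; rewrite ?mulr1 ?mulr0.
rewrite Stop => S0; apply: NNPP => nS; case/eqP: S0.
have -> : S = 0; last by rewrite coef0.
apply: poly_eq0_infinite => s; rewrite SE; apply/eqP/negPn/negP => h.
by apply: nS; exists s%:R.
Qed.
End InitialForm.

Section ToricCurve.
Variables (m : nat) (f : nat -> nat).
Hypothesis cf : chain_fun m f.
Local Notation n := m.+2.
Implicit Types (w : Wedge2 n) (I J c : nat).

Definition cell w := excess m f (val w).1 (val w).2 == 0%N.
Definition nu w : nat := ((val w).1 * (val w).2)%N.

Lemma wedge_ex I J : (I < J <= m.+1)%N ->
  exists w, (val w).1 = I :> nat /\ (val w).2 = J :> nat.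
Proof.
case/andP=> IJ Jm; have In : (I < n)%N by lia.
by exists (exist (fun p : 'I_n * 'I_n => p.1 < p.2)%N (Ordinal In, Ordinal (Jm : (J < n)%N)) IJ).
Qed.

Lemma wedge_inj w w' : (val w).1 = (val w').1 :> nat -> (val w).2 = (val w').2 :> nat -> w = w'.
Proof.
move=> e1 e2; apply: val_inj; case: (val w) (val w') e1 e2 => a b [c d] /=.
by move=> /val_inj-> /val_inj->.
Qed.

Lemma wedge_lt w : ((val w).1 < (val w).2 <= m.+1)%N.
Proof. by rewrite (valP w) -ltnS ltn_ord. Qed.

Variable om : Wedge2 n -> CC.
Hypothesis om_cell : forall w, (om w != 0) = cell w.

Let omn I J : CC := \sum_(w : Wedge2 n | ((val w).1 == I :> nat) && ((val w).2 == J :> nat)) om w.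

Let omnE w : omn (val w).1 (val w).2 = om w.
Proof.
rewrite /omn (bigD1 w) ?eqxx //= big1 ?addr0 // => w' /andP[/andP[/eqP e1 /eqP e2]].
by rewrite (wedge_inj e1 e2) eqxx.
Qed.

Let omn_neq0 I J : (I < J <= m.+1)%N -> excess m f I J = 0%N -> omn I J != 0.
Proof. by move=> /wedge_ex[w [<- <-]]; rewrite omnE om_cell /cell => ->. Qed.

Let flt c : (0 < c <= m -> f c < c)%N. Proof. by case: cf => _ _; apply. Qed.

(** Solves a_I b_J = om(I,J) on the cells. The cells (f c, c) and (f c, c + 1) share a row and fix
    the ratio of consecutive b; then a_I is read off at the first cell of row I. *)
Let bb J := \prod_(1 <= c < J) (omn (f c) c.+1 / omn (f c) c).
Let aa I := let s := [seq J <- iota 0 m.+2 | (I < J)%N && (excess m f I J == 0%N)] in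
  omn I (head 0%N s) / bb (head 0%N s).

Let bb_neq0 J : (J <= m.+1)%N -> bb J != 0.
Proof.
move=> Jm; rewrite /bb prodf_seq_neq0; apply/allP => c; rewrite mem_index_iota /= => cJ.
have cm : (0 < c <= m)%N by lia.
have fc := flt cm; apply: mulf_neq0; last rewrite invr_eq0; apply: omn_neq0;
  rewrite ?(cell_left cf) ?(cell_right cf) //; lia.
Qed.

Let row_const I J J' : (I < J)%N -> (J <= J')%N -> (J' <= m.+1)%N ->
  excess m f I J = 0%N -> excess m f I J' = 0%N -> omn I J / bb J = omn I J' / bb J'.
Proof.
move=> IJ; elim: J' => [|c IHc]; first by lia.
rewrite leq_eqVlt => /predU1P[-> //|Jc] cm e1 e2.
have fc : f c = I.
  move/eqP: e1; rewrite (excess_eq0 cf); last lia.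
  case/andP=> _ /implyP h1; move/eqP: e2; rewrite (excess_eq0 cf); last lia.
  case/andP=> /= h2 _; have : (f J <= f c)%N; last by have := h1; lia.
  by case: cf => _ fh _; apply: fh; rewrite ?inE; lia.
have cm' : (0 < c <= m)%N by lia.
have ec : excess m f I c = 0%N by rewrite -fc cell_left.
have Ic := flt cm'; rewrite fc in Ic.
rewrite IHc //; last by lia.
have o1 := omn_neq0 (_ : (I < c <= m.+1)%N) ec.
have o2 := omn_neq0 (_ : (I < c.+1 <= m.+1)%N) e2.
rewrite /bb [in RHS]big_nat_recr ?fc /=; last by lia.
rewrite -/(bb c); have b0 := bb_neq0 (ltnW cm).
by field; rewrite b0 o1 ?o2 //; lia.
Qed.

Let aaE I J : (I < J <= m.+1)%N -> excess m f I J = 0%N -> aa I * bb J = omn I J.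
Proof.
move=> IJ e; rewrite /aa; set s := [seq _ <- _ | _].
have Js : J \in s by rewrite mem_filter e eqxx mem_iota; case/andP: IJ => -> ?; lia.
have : head 0%N s \in s by case: (s) Js => //= a l _; rewrite inE eqxx.
rewrite mem_filter mem_iota => /andP[/andP[h1 /eqP h2] h3].
have [le|le] := leqP (head 0%N s) J.
  by rewrite (row_const h1 le _ h2 e) ?divfK ?bb_neq0 //; case/andP: IJ.
rewrite -(row_const _ (ltnW le) _ e h2) ?divfK ?bb_neq0 //; case/andP: IJ => //; lia.
Qed.

(** The zeros at [m.+1] here and at 0 in [b] remove the transposed products that [excess_transposed]
    does not cover. *)
Let a I := if (I == m.+1)%N then 0 else aa I.
Let b J := if (J == 0)%N then 0 else bb J.

(* Along the curve u_i = a_i t^(alpha i), v_j = b_j t^(beta j) the Pluecker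
   coordinate (i,j) has order at least [i * j], with equality on the cells only. *)
Lemma toric_curve : exists (u v : CC -> 'I_n -> CC) (pw : Wedge2 n -> {poly CC}),
  [/\ forall t w, pl (u t) (v t) w = t ^+ nu w * (pw w).[t],
      forall w, (pw w).[0] = om w &
      pw (w01 m) = (om (w01 m))%:P].
Proof.
pose pw w : {poly CC} := let I := (val w).1 : nat in let J := (val w).2 : nat in
  (a I * b J) *: 'X^(excess m f I J) - (a J * b I) *: 'X^(excess m f J I).
exists (fun t i => a i * t ^+ alpha m f i), (fun t j => b j * t ^+ beta f j), pw.
split=> [t w|w|].
- rewrite /pl /pw /nu hornerD hornerN !hornerZ !hornerXn.
  set I := nat_of_ord (val w).1; set J := nat_of_ord (val w).2.
  have Im : (I <= m.+1)%N by rewrite -ltnS ltn_ord.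
  have Jm : (J <= m.+1)%N by rewrite -ltnS ltn_ord.
  rewrite mulrACA -exprD alpha_beta // exprD.
  rewrite [X in _ - X](_ : _ = a J * b I * t ^+ (alpha m f J + beta f I)); last first.
    by rewrite exprD; ring.
  by rewrite alpha_beta // exprD [(J * I)%N]mulnC; ring.
- have := wedge_lt w; rewrite /pw hornerD hornerN !hornerZ !hornerXn.
  have := om_cell w; rewrite /cell -omnE.
  set I := nat_of_ord (val w).1; set J := nat_of_ord (val w).2 => oc IJ.
  have -> : a J * b I * 0 ^+ excess m f J I = 0.
    rewrite /a /b; case: (J =P m.+1) => [|Jn]; first by rewrite !mul0r.
    case: (I =P 0%N) => [|In]; first by rewrite mulr0 mul0r.
    have := @excess_transposed m f cf I J; rewrite expr0n.
    by case: (excess m f J I) => [|e]; rewrite ?mulr0 //; lia.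
  rewrite subr0 expr0n; move: oc; case: (excess m f I J =P 0%N) => e oc; last first.
    by rewrite mulr0; apply/esym/eqP; rewrite -[_ == _]negbK oc.
  rewrite mulr1 /a /b; case: (I =P m.+1) => [|_]; first by lia.
  by case: (J =P 0%N) => [|_]; [lia | apply: aaE].
(* This coordinate is exactly constant in t, so frames can later be corrected in column [w01]
   without leaving polynomials. *)
have e01 := excess01 cf.
rewrite /pw /= e01 /b /= mulr0 scale0r subr0 expr0 -mul_polyC mulr1; congr _%:P.
by rewrite /a /= aaE // -omnE.
Qed.
End ToricCurve.

Section InitialVanishing.
Variables (m k : nat) (f : nat -> nat).
Hypothesis cf : chain_fun m f.
Local Notation n := m.+2.
Variables (om : Wedge2 n -> CC) (p : {mpoly CC[nvars k n]}).
Hypothesis om_cell : forall w, (om w != 0) = cell f w.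

Lemma cell_w01 : cell f (w01 m).
Proof. by rewrite /cell /= (excess01 cf). Qed.

(** [M] is a limit of X under the torus: correcting column [w01] gives frames killed by [pw] at t,
    and division by t^nu makes them killed by the bivector of the toric curve. *)
Lemma initial_vanishing (M : frame k n) : vanishing p ->
  (forall r, \sum_w M r w * om w = 0) -> ev (initial (@nu m) p) M = 0.
Proof.
move=> vp Mom; have [u [v [pw [plE pw0 pw01]]]] := toric_curve cf om_cell.
have o0 : om (w01 m) != 0 by rewrite om_cell cell_w01.
pose S r := \sum_w M r w *: pw w.
pose c (r : 'I_k) (w : Wedge2 n) : {poly CC} :=
  (M r w)%:P - ((om (w01 m))^-1 *: S r) *+ (w == w01 m).
have cE t r w : (c r w).[t] = M r w - ((om (w01 m))^-1 * (S r).[t]) *+ (w == w01 m).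
  by rewrite /c hornerD hornerN hornerC hornerMn hornerZ.
have S0 r : (S r).[0] = 0.
  rewrite /S horner_sum -[RHS](Mom r); apply: eq_bigr => w _.
  by rewrite hornerZ pw0.
rewrite -[RHS](@initial_curve _ _ (@nu m) c p) => [|t t0].
  by apply: ev_ext => r w; rewrite cE S0 mulr0 mul0rn subr0.
apply: vp; apply/in_resP; exists (u t), (v t); split.
  by exists (w01 m); rewrite plE pw01 hornerC mulf_neq0 // expf_neq0.
move=> r; rewrite /pairing.
under eq_bigr do rewrite plE mulrA divfK ?expf_neq0 // cE mulrBl.
rewrite sumrB [X in _ - X](bigD1 (w01 m)) // eqxx mulr1n [X in _ - (_ + X)]big1 ?addr0; last first.
  by move=> w /negPf->; rewrite mulr0n mul0r.
rewrite pw01 hornerC mulrAC mulVf // mul1r /S horner_sum.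
by apply/eqP; rewrite subr_eq0; apply/eqP/eq_bigr => w _; rewrite hornerZ.
Qed.
End InitialVanishing.

Section Kernel.
Variables (m : nat) (r : 'I_(m + m).+1).
Local Notation n := m.+2.
Local Notation k := (m + m).+1.
Implicit Types (f : nat -> nat) (M : frame k n).

(** Cells are numbered by antidiagonals, independently of the path; for a path each number occurs,
    so the default in [nth_cell] is never reached. *)
Definition cell_idx (w : Wedge2 n) : 'I_k := inord ((val w).1 + (val w).2).-1.
Definition nth_cell f (j : 'I_k) : Wedge2 n :=
  odflt (w01 m) [pick w : Wedge2 n | cell f w && (cell_idx w == j)].

Lemma cell_idxE (w : Wedge2 n) : (cell_idx w).+1 = ((val w).1 + (val w).2)%N.
Proof.
have := wedge_lt w; rewrite /cell_idx; set I := nat_of_ord _; set J := nat_of_ord _ => IJ.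
by rewrite inordK; lia.
Qed.

Lemma cell_idx_inj f w w' : chain_fun m f -> cell f w -> cell f w' ->
  cell_idx w = cell_idx w' -> w = w'.
Proof.
move=> cf /eqP c1 /eqP c2 e.
have [e1 e2] := cell_sum_inj cf (wedge_lt w) (wedge_lt w') c1 c2
  (etrans (esym (cell_idxE w)) (etrans (congr1 (fun j : 'I_k => j.+1) e) (cell_idxE w'))).
exact: wedge_inj.
Qed.

Lemma nth_cellP f j : chain_fun m f -> cell f (nth_cell f j) /\ cell_idx (nth_cell f j) = j.
Proof.
move=> cf; rewrite /nth_cell; case: pickP => [w /andP[cw /eqP jw] //|no].
have jm : (j <= m + m)%N by rewrite -ltnS.
have [I [J [IJ e s]]] := cell_of_sum cf jm.
have [w [wI wJ]] := wedge_ex IJ.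
have := no w; rewrite /cell wI wJ e eqxx /= => /eqP[].
by apply/val_inj/succn_inj; rewrite /= cell_idxE wI wJ.
Qed.

Lemma nth_cellK f w : chain_fun m f -> cell f w -> nth_cell f (cell_idx w) = w.
Proof.
move=> cf cw; have [c1 e] := nth_cellP (cell_idx w) cf.
exact: (cell_idx_inj cf).
Qed.

Definition cell_mx f M : 'M[CC]_k := \matrix_(r', j) M r' (nth_cell f j).
(** Cramer's vector: supported on the cells, killed by the rows other than [r] and independent of
    row [r]. *)
Definition kervec f M w : CC := if cell f w then cofactor (cell_mx f M) r (cell_idx w) else 0.

Lemma kervecP f M r' : chain_fun m f -> r' != r -> \sum_w M r' w * kervec f M w = 0.
Proof.
move=> cf rr.
transitivity (\sum_(w | cell f w) M r' w * cofactor (cell_mx f M) r (cell_idx w)).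
  rewrite [RHS]big_mkcond; apply: eq_bigr => w _; rewrite /kervec.
  by case: ifP; rewrite ?mulr0.
rewrite (reindex_onto (nth_cell f) cell_idx) /=; last by move=> w; apply: nth_cellK.
have := congr1 (fun D : 'M_k => D r' r) (mul_mx_adj (cell_mx f M)).
rewrite !mxE (negPf rr) mulr0n => e; rewrite -[RHS]e.
apply: eq_big => [j|j _]; first by have [-> ->] := nth_cellP j cf; rewrite eqxx.
by have [_ ->] := nth_cellP j cf; rewrite !mxE.
Qed.

Lemma kervec_ext f M M' w : (forall r' w', r' != r -> M r' w' = M' r' w') ->
  kervec f M w = kervec f M' w.
Proof.
move=> MM; rewrite /kervec; case: (cell f w); last by []; rewrite /cofactor; congr (_ * \det _).
by apply/matrixP => i j; rewrite !mxE MM // eq_sym neq_lift.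
Qed.

Lemma kervec_generic f w : chain_fun m f -> cell f w -> exists M, kervec f M w != 0.
Proof.
move=> cf cw; set j := cell_idx w.
pose D : 'M[CC]_k := perm_mx (tperm r j).
exists (fun r' w' => D r' (cell_idx w')).
rewrite /kervec cw -/j; have -> : cell_mx f (fun r' w' => D r' (cell_idx w')) = D.
  by apply/matrixP => a b; rewrite mxE; have [_ ->] := nth_cellP b cf.
have := expand_det_row D r; rewrite (bigD1 j) //= big1 ?addr0 => [|l /negPf lj].
  rewrite /D !mxE tpermL eqxx mul1r => <-; rewrite det_perm.
  by rewrite signr_eq0.
by rewrite /D !mxE tpermL eq_sym lj mul0r.
Qed.

Lemma regular_kervec (I : Type) f (F : 'I_k -> Wedge2 n -> (I -> CC) -> CC) w :
  (forall r' w', regular (F r' w')) -> regular (fun z => kervec f (fun r' w' => F r' w' z) w).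
Proof.
move=> rF; rewrite /kervec; case: (cell f w); last exact: regular_const.
apply: regularM; first exact: regular_const.
apply: (@regular_ext _ _ (fun z => \det (\matrix_(i, j)
    F (lift r i) (nth_cell f (lift (cell_idx w) j)) z))) => [z|].
  by congr (\det _); apply/matrixP => i j; rewrite !mxE.
exact: regular_det.
Qed.

End Kernel.

Section DegreeBound.
Variables (m : nat) (r : 'I_(m + m).+1).
Local Notation n := m.+2.
Local Notation k := (m + m).+1.
Local Notation W := (Wedge2 n).
Local Notation Z := ('I_k * W + W)%type.
Implicit Types (f : nat -> nat) (z : Z -> CC).

Let zA z : frame k n := fun r' w => z (inl (r', w)).
Let zB z : frame k n := fun r' w => if r' == r then z (inr w) else 0.
Let LA f z := \sum_w zA z r w * kervec r f (zA z) w.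
Let LB f z := \sum_w z (inr w) * kervec r f (zA z) w.

Let regular_kv f w : regular (fun z => kervec r f (zA z) w).
Proof.
by apply: (@regular_kervec _ r _ f (fun r' w' z => z (inl (r', w')))) => *; apply: regular_coord.
Qed.

Let regular_LA f : regular (LA f).
Proof.
apply: (@regular_sum _ _ _ _ _ (fun w z => z (inl (r, w)) * kervec r f (zA z) w)) => w.
by apply: regularM; [apply: regular_coord | apply: regular_kv].
Qed.

Let regular_LB f : regular (LB f).
Proof.
apply: (@regular_sum _ _ _ _ _ (fun w z => z (inr w) * kervec r f (zA z) w)) => w.
by apply: regularM; [apply: regular_coord | apply: regular_kv].
Qed.

Let mk (M : frame k n) (a b : W) : Z -> CC := fun x =>
  match x with
  | inl (r', w) => if r' == r then (w == a)%:R else M r' w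
  | inr w => (w == b)%:R
  end.

Let kv_mk f M a b w : kervec r f (zA (mk M a b)) w = kervec r f M w.
Proof. by apply: kervec_ext => r' w' /negPf rr; rewrite /zA /mk rr. Qed.

Let LA_mk f M a b : LA f (mk M a b) = kervec r f M a.
Proof.
rewrite /LA (bigD1 a) //= big1 ?addr0 => [|w /negPf wa].
  by rewrite /zA {1}/mk !eqxx mul1r kv_mk.
by rewrite /zA {1}/mk eqxx wa mul0r.
Qed.

Let LB_mk f M a b : LB f (mk M a b) = kervec r f M b.
Proof.
rewrite /LB (bigD1 b) //= big1 ?addr0 => [|w /negPf wa].
  by rewrite eqxx mul1r kv_mk.
by rewrite wa mul0r.
Qed.

Let kv_generic f w : chain_fun m f -> cell f w -> exists z, kervec r f (zA z) w != 0.
Proof.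
move=> cf cw; have [M Mw] := kervec_generic r cf cw.
by exists (mk M (w01 m) (w01 m)); rewrite kv_mk.
Qed.

(** Along A + t B, with B concentrated in row r, the pairing of row r with [kervec] is LA + t LB.
    This determinant is nonzero when the roots for two paths differ. *)
Let cross f g z := LA f z * LB g z - LA g z * LB f z.

Let cross_generic f g c : chain_fun m f -> chain_fun m g -> (0 < c <= m)%N ->
  (f c < g c)%N -> exists z, cross f g z != 0.
Proof.
move=> cf cg cm fg; have fc : (f c < c)%N by case: cf => _ _; apply.
have [w [w1 w2]] := @wedge_ex m (f c) c.+1 ltac:(lia).
have cw : cell f w by rewrite /cell w1 w2 (cell_right cf).
have ncw : ~~ cell g w by rewrite /cell w1 w2 -lt0n chain_fun_separated.
have [z1 n1] := kv_generic cf cw; have [z2 n2] := kv_generic cg (cell_w01 cg).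
have [z [nf ng]] := regular_neq0_and (regular_kv f w) (regular_kv g (w01 m)) n1 n2.
have kw0 : kervec r g (zA z) w = 0 by rewrite /kervec (negPf ncw).
exists (mk (zA z) w (w01 m)); rewrite /cross !LA_mk !LB_mk kw0 mul0r subr0.
exact: mulf_neq0.
Qed.

(** On a general line moving row r only, each path contributes a root - LA / LB of the initial form,
    where the whole frame kills its [kervec]. Distinct paths give distinct roots, so the degree is
    at least the number of paths, and [initial_line] passes this on to [p]. *)
Lemma degree_bound (p : {mpoly CC[nvars k n]}) : p != 0 -> vanishing p ->
  exists (A B : frame k n) (i : nat),
    [/\ forall r' w, r' != r -> B r' w = 0, (size (chains m m) <= i)%N &
        (fcurve (line A B) p)`_i != 0].
Proof.
move=> p0 vp; set chs := chains m m; set N := size chs.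
pose fi (i : 'I_N) c := nth 0%N (nth [::] chs i) c.-1.
have fiP i : chain_fun m (fi i) by apply: chain_funP; apply: mem_nth.
have fi_inj i j : i != j -> exists2 c, (0 < c <= m)%N & fi i c != fi j c.
  move=> ij; apply: NNPP => no; case/eqP: ij; apply/val_inj/eqP.
  rewrite -(nth_uniq [::] (ltn_ord i) (ltn_ord j) (uniq_chains m m)).
  have si := size_chains_mem (mem_nth [::] (ltn_ord i)).
  have sj := size_chains_mem (mem_nth [::] (ltn_ord j)).
  apply/eqP/(@eq_from_nth _ 0%N) => [|c]; rewrite si // => cm.
  by apply/eqP/negPn/negP => ne; apply: no; exists c.+1.
(* All genericity conditions as one finite family, to be satisfied at a common point. *)
pose F (x : unit + 'I_N * W + 'I_N + 'I_N * 'I_N) z := match x with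
  | inl (inl (inl _)) => ev (initial (@nu m) p) (zA z)
  | inl (inl (inr (i, w))) => if cell (fi i) w then kervec r (fi i) (zA z) w else 1
  | inl (inr i) => LB (fi i) z
  | inr (i, j) => if i == j then 1 else cross (fi i) (fi j) z
  end.
have [z Fz] : exists z, forall x, F x z != 0.
  apply: regular_neq0_all.
    case=> [[[[]|[i w]]|i]|[i j]]; rewrite /F.
    - by apply: regular_meval => x; apply: regular_coord.
    - by case: (cell (fi i) w); [apply: regular_kv | apply: regular_const].
    - exact: regular_LB.
    case: (i == j); first exact: regular_const.
    by apply: regularB; apply: regularM.
  case=> [[[[]|[i w]]|i]|[i j]] /=.
  - have /mpoly_neq0_point /not_all_ex_not[x nx] := initial_neq0 (@nu m) p0.
    exists (fun y => if y is inl a then x (enum_rank a) else 0); apply/eqP => e; apply: nx.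
    rewrite -[RHS]e; apply: meval_eq => i; rewrite /frame_pt /zA.
    by rewrite -surjective_pairing enum_valK.
  - case: (boolP (cell (fi i) w)) => [cw|_]; first exact: kv_generic.
    by exists (fun=> 0); apply: oner_neq0.
  - have [M nM] := kervec_generic r (fiP i) (cell_w01 (fiP i)).
    by exists (mk M (w01 m) (w01 m)); rewrite LB_mk.
  case: (boolP (i == j)) => [_|ij]; first by exists (fun=> 0); apply: oner_neq0.
  have [c cm] := fi_inj i j ij; rewrite neq_ltn => /orP[] lt.
    exact: cross_generic lt.
  have [z nz] := cross_generic (fiP j) (fiP i) cm lt.
  by exists z; rewrite /cross -opprB oppr_eq0.
have kvz i w : (kervec r (fi i) (zA z) w != 0) = cell (fi i) w.
  have := Fz (inl (inl (inr (i, w)))); rewrite /=; case: ifP => // cw _.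
  by rewrite /kervec cw eqxx.
have LBz i : LB (fi i) z != 0 by apply: (Fz (inl (inr i))).
pose root_ i := - LA (fi i) z / LB (fi i) z.
have root_inj : injective root_.
  move=> i j e; apply/eqP/negPn/negP => ij.
  have := Fz (inr (i, j)); rewrite /= (negPf ij) /cross => /eqP; apply.
  have key (a b c d : CC) : b != 0 -> d != 0 -> - a / b = - c / d -> a * d - c * b = 0.
    move=> b0 d0 /eqP; rewrite eqr_div // !mulNr eqr_opp => /eqP->.
    exact: subrr.
  exact: key (LBz i) (LBz j) e.
pose g := fcurve (line (zA z) (zB z)) (initial (@nu m) p).
have gE t : g.[t] = ev (initial (@nu m) p) (fun r' w => zA z r' w + zB z r' w * t).
  by rewrite /g horner_fcurve; apply: ev_ext => r' w; rewrite /line !hornerE.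
have g0 : g != 0.
  apply/eqP => ge; have := Fz (inl (inl (inl tt))); rewrite /= => /eqP; apply.
  have <- : g.[0] = 0 by rewrite ge horner0.
  by rewrite gE; apply: ev_ext => r' w; rewrite mulr0 addr0.
have groot i : root g (root_ i).
  apply/rootP; rewrite gE; apply: (initial_vanishing (fiP i) (kvz i) vp) => r'.
  under eq_bigr do rewrite mulrDl.
  rewrite big_split /=; have [->|rr] := eqVneq r' r.
    have -> : \sum_w zB z r w * root_ i * kervec r (fi i) (zA z) w = root_ i * LB (fi i) z.
      rewrite /LB mulr_sumr; apply: eq_bigr => w _; rewrite /zB eqxx; ring.
    by rewrite /root_ divfK // subrr.
  rewrite kervecP // add0r big1 // => w _.
  by rewrite /zB (negPf rr) !mul0r.
have sg : (N < size g)%N.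
  have := max_poly_roots g0 (rs := [seq root_ i | i <- enum 'I_N]).
  rewrite size_map size_enum_ord; apply; last by rewrite map_inj_uniq ?enum_uniq.
  by apply/allP => _ /mapP[i _ ->].
have gl : g`_(size g).-1 != 0 by rewrite -[g`_ _]/(lead_coef g) lead_coef_eq0.
have [s sP] := initial_line gl.
do 3 eexists; split; last exact: sP; last by move: sg; case: (size g).
by move=> r' w /negPf rr; rewrite /zB rr mulr0.
Qed.
End DegreeBound.

Lemma card_Mon n q : #|Mon n.+1 q| = 'C(n + q, n).
Proof.
rewrite card_sig -card_ord_partitions -[LHS]cardsE.
pose g (t : n.+1.-tuple 'I_q.+1) := [ffun i => tnth t i].
have gbij : bijective g.
  exists (fun a : {ffun 'I_n.+1 -> 'I_q.+1} => [tuple a i | i < n.+1]) => [t|a].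
    by apply: eq_from_tnth => i; rewrite tnth_mktuple ffunE.
  by apply/ffunP => i; rewrite ffunE tnth_mktuple.
rewrite -(on_card_preimset (onW_bij _ gbij)); congr #|pred_of_set _|.
apply/setP => t; rewrite !inE big_tuple; congr (_ == _).
by apply: eq_bigr => i _; rewrite ffunE.
Qed.

(** * Maximal minors as powers of one polynomial *)

Section LineCoefficients.
Variables (k n : nat) (I : Type).
Implicit Types (c d : (I -> CC) -> {poly CC}).

Definition regular_coef c := forall i, regular (fun z => (c z)`_i).

Lemma regular_coefM c d : regular_coef c -> regular_coef d -> regular_coef (fun z => c z * d z).
Proof.
move=> rc rd i; apply: (@regular_ext _ _ (fun z => \sum_(j < i.+1) (c z)`_j * (d z)`_(i - j))).
  by move=> z; rewrite coefM.
by apply: regular_sum => j; apply: regularM.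
Qed.

Lemma regular_coef_const p : regular_coef (fun=> p).
Proof. by move=> i; apply: regular_const. Qed.

Lemma regular_fcurve (F : 'I_k -> Wedge2 n -> (I -> CC) -> {poly CC}) p :
  (forall r w, regular_coef (F r w)) -> regular_coef (fun z => fcurve (fun r w => F r w z) p).
Proof.
move=> rF i; apply: (@regular_ext _ _ (fun z => \sum_(mm <- msupp p) p@_mm *
    (\prod_(i < nvars k n) F (enum_val i).1 (enum_val i).2 z ^+ mm i)`_i)).
  by move=> z; rewrite fcurveE coef_sum; apply: eq_bigr => mm _; rewrite coefZ.
apply: regular_sum => mm; apply: regularM; first exact: regular_const.
elim: (index_enum _) i => [|l r IHr] i.
  by apply: (@regular_ext _ _ (fun=> (1 : {poly CC})`_i)) => [z|]; [rewrite big_nil | apply: regular_const].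
apply: (@regular_ext _ _ (fun z => (F (enum_val l).1 (enum_val l).2 z ^+ mm l *
   \prod_(j <- r) F (enum_val j).1 (enum_val j).2 z ^+ mm j)`_i)) => [z|].
  by rewrite big_cons.
apply: regular_coefM => //.
elim: (mm l) => [|e IHe]; first exact: regular_coef_const.
move=> j; apply: (@regular_ext _ _ (fun z => (F (enum_val l).1 (enum_val l).2 z *
  F (enum_val l).1 (enum_val l).2 z ^+ e)`_j)) => [z|]; first by rewrite exprS.
exact: regular_coefM.
Qed.
End LineCoefficients.

Lemma det_row_degree s (D : 'M[{poly CC}]_s) (S : pred 'I_s) :
  (forall i j, (size (D i j) <= (S i).+1)%N) -> (size (\det D) <= #|S|.+1)%N.
Proof.
move=> sD; rewrite /determinant; apply: (leq_trans (size_sum _ _ _)).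
apply/bigmax_leqP => t _; rewrite -signr_odd mulr_sign.
have sP : (size (\prod_i D i (t i))%R <= #|S|.+1)%N.
  apply: (leq_trans (size_prod_leq _ _)); rewrite leq_subLR card_ord.
  have : (\sum_i size (D i (t i)) <= \sum_i (S i).+1)%N by apply: leq_sum => i _; apply: sD.
  have -> : (\sum_(i < s) (S i).+1 = #|S| + s)%N.
    rewrite -[X in (_ + X)%N]card_ord -!sum1_card [X in (X + _)%N]big_mkcond -big_split /=.
    by apply: eq_bigr => i _; rewrite unfold_in; case: (S i).
  by move=> le; rewrite addnC; apply: leq_trans (leq_add (leqnn 1) le) _; lia.
by case: (odd _); rewrite ?size_polyN.
Qed.

Section MinorPower.
Variable q : nat.
Local Notation m := q.+1.
Local Notation k := (m + m).+1.
Local Notation n := m.+2.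
Local Notation rows := {: 'I_k * Mon n q}.
Local Notation W := (Wedge2 n).
Local Notation U := (upd ord0 (w01 m)).
Variables (c : nat) (P : 'M[CC]_(#|{: 'I_n * Mon n q.+1}|, c)).
Hypothesis rP : \rank (Delta2 n q *m P) = \rank (Delta2 n q).
Variables (s : nat) (f : 'I_s -> 'I_#|rows|) (Y : 'M[CC]_(c, s)).
Hypothesis f_inj : injective f.
Hypothesis rank_le : forall M : frame k n, (\rank (gamma_mx q M *m P) <= s)%N.
Let X : 'M[CC]_(s, #|rows|) := rowsub f 1%:M.
Variable M1 : frame k n.
Hypothesis minor1 : \det (X *m (gamma_mx q M1 *m P) *m Y) != 0.

Let row_of (j : 'I_s) : 'I_k := (enum_val (f j)).1.

Let rows_in r := [pred j | row_of j == r].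

Let card_rows_in r : (#|rows_in r| <= #|Mon n q|)%N.
Proof.
rewrite -(card_in_imset (f := fun j => (enum_val (f j)).2) (D := rows_in r)).
  exact: max_card.
move=> i j; rewrite !inE /row_of => /eqP ri /eqP rj e; apply/f_inj/enum_val_inj.
by rewrite [LHS]surjective_pairing [RHS]surjective_pairing ri rj e.
Qed.

Let mon_count : #|Mon n q| = (m * size (chains m m))%N.
Proof.
rewrite size_chains_binomial card_Mon muln1 /= -bin_sub; last lia.
by congr ('C(_, _)); lia.
Qed.

Let line_degree (p : {mpoly CC[nvars k n]}) (A B : frame k n) r :
  (forall M, ev p M = \det (X *m (gamma_mx q M *m P) *m Y)) ->
  (forall r' w, r' != r -> B r' w = 0) ->
  (size (fcurve (line A B) p) <= #|rows_in r|.+1)%N.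
Proof.
move=> pE Br; pose Q := P *m Y.
pose D : 'M[{poly CC}]_s := \matrix_(i, j)
  (((X *m (gamma_mx q A *m P) *m Y) i j)%:P + ((X *m (gamma_mx q B *m P) *m Y) i j)%:P * 'X).
have -> : fcurve (line A B) p = \det D.
  apply/eqP; rewrite -subr_eq0; apply/eqP/poly_eq0_infinite => t.
  rewrite hornerD hornerN horner_fcurve.
  rewrite -[(\det D).[_]]/(horner_eval t%:R (\det D)) -det_map_mx.
  apply/eqP; rewrite subr_eq0; apply/eqP.
  rewrite (_ : ev _ _ = ev p (fun r w => A r w + t%:R * B r w)); last first.
    by apply: ev_ext => r' w; rewrite /line !hornerE mulrC.
  rewrite pE gamma_mxD mulmxDl mulmxDr mulmxDl; congr (\det _).
  apply/matrixP => i j; rewrite -scalemxAl -scalemxAr -scalemxAl [LHS]mxE !(mxE, hornerE) /=.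
  by rewrite /horner_eval !hornerE [(t%:R * _)%R]mulrC.
apply: det_row_degree => i j; rewrite mxE /=.
have B0 : row_of i != r -> (X *m (gamma_mx q B *m P) *m Y) i j = 0.
  move=> ri; rewrite -mulmxA /X mul_rowsub_mx mul1mx -mulmxA mxE [LHS]mxE big1 // => l _.
  by rewrite mxE big1 ?mul0r // => w _; rewrite Br ?mul0r.
move: B0; move: ((X *m _ *m Y) i j) ((X *m _ *m Y) i j) => a b B0.
case: eqP => [_|/eqP /B0->]; last by rewrite mul0r addr0 size_polyC_leq1.
apply: (leq_trans (size_polyD _ _)); rewrite geq_max; apply/andP; split.
  exact: (leq_trans (size_polyC_leq1 _)).
have [->|b0] := eqVneq b 0; first by rewrite mul0r size_poly0.
by rewrite size_Cmul // size_polyX.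
Qed.

(* [R] has degree at least the Catalan number in each row, and [m] times that
   number is the number of monomials: the minor must use every row. *)
Lemma minor_power : s = #|rows| /\
  exists (R : {mpoly CC[nvars k n]}) (a : CC),
    [/\ irred_elt R, vanishing R, a != 0 &
        forall M, \det (X *m (gamma_mx q M *m P) *m Y) = a * ev R M ^+ m].
Proof.
have [mm mmE] := polyfun_minor P X Y.
have mm0 : mm != 0.
  by apply: contraNneq minor1 => mm0; rewrite -mmE mm0 /ev meval0.
have order z : pl (zu z) (zv z) (w01 m) != 0 ->
    \det (transv (Phi (w01 m) z) (zu z) (zv z)) != 0 ->
    exists Q : {poly CC}, forall t,
       ev mm (fun r w => Phi (w01 m) z r w + t * U r w) = t ^+ m * Q.[t].
  move=> zpl ztr; have [_ zres] := Phi_res zpl.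
  have [Q QE] := transversal_order zpl zres ztr rP X Y rank_le.
  by exists Q => t; rewrite mmE QE.
have vmm : vanishing mm.
  have [z1 z1tr] := @transv_neq0 m.
  apply: (vanishing_chart (@regular_transv m) z1tr) => z zpl ztr.
  have [Q QE] := order z zpl ztr; have := QE 0; rewrite expr0n mul0r => e; rewrite -[RHS]e.
  by apply: ev_ext => r w; rewrite mul0r addr0.
have [R [h0 [iR vR _]]] := vanishing_prime_factor mm0 vmm.
have [h hE] := power_divides iR vR order.
have R0 : R != 0 by case: iR.
have h_neq0 : h != 0 by apply: contraNneq mm0 => h0E; rewrite hE h0E mulr0.
pose zA (z : 'I_k * W + W -> CC) : frame k n := fun r' w => z (inl (r', w)).
pose zB r (z : 'I_k * W + W -> CC) : frame k n := fun r' w => if r' == r then z (inr w) else 0.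
have regl r p i : regular (fun z => (fcurve (line (zA z) (zB r z)) p)`_i).
  apply: (@regular_fcurve k n _ (fun r' w z => line (zA z) (zB r z) r' w)) => r' w j.
  apply: (@regular_ext _ _ (fun z => (zA z r' w) * (j == 0)%N%:R + zB r z r' w * (j == 1)%N%:R)) => [z|].
    by rewrite /line coefD coefC coefCM coefX; case: j => [|j] /=; rewrite ?mulr1 ?mulr0.
  apply: regularD; apply: regularM; try exact: regular_const; rewrite /zB.
    exact: regular_coord.
  by case: (r' == r); [apply: regular_coord | apply: regular_const].
have regh : regular (fun z => ev h (zA z)).
  by apply: regular_meval => i; apply: regular_coord.
have [zh nzh] : exists z, ev h (zA z) != 0.
  have /mpoly_neq0_point /not_all_ex_not[x nx] := h_neq0.
  exists (fun y => if y is inl a then x (enum_rank a) else 0); apply/eqP => e; apply: nx.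
  rewrite -[RHS]e; apply: meval_eq => i; rewrite /frame_pt /zA.
  by rewrite -surjective_pairing enum_valK.
(* Degrees in t along row r: R^m contributes at least m C_m, the minor has at most one per chosen
   row of gamma over [r], hence at most dim Sym^q V = m C_m. Equality leaves degree 0 to the
   cofactor [h]. *)
have line_sizes r z i : (size (chains m m) <= i)%N ->
    (fcurve (line (zA z) (zB r z)) R)`_i != 0 -> ev h (zA z) != 0 ->
    #|rows_in r| = #|Mon n q| /\ (size (fcurve (line (zA z) (zB r z)) h) <= 1)%N.
  move=> iN Ri hz; have Br r' w : r' != r -> zB r z r' w = 0 by move=> /negPf rr; rewrite /zB rr.
  have := line_degree (zA z) mmE Br.
  rewrite hE /fcurve mcurveM mcurveXn -!/(fcurve _ _).
  set RL := fcurve _ R; set hL := fcurve _ h.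
  have sR : (i < size RL)%N by rewrite ltnNge; apply: contraNN Ri => ?; rewrite nth_default.
  have RL0 : RL != 0 by rewrite -size_poly_gt0; apply: leq_ltn_trans sR.
  have hL0 : hL != 0.
    apply: contraNneq hz => hL0; have : hL.[0] = 0 by rewrite hL0 horner0.
    rewrite /hL horner_fcurve => e.
    apply/eqP; rewrite -[RHS]e; apply/ev_ext => r' w.
    by rewrite /line !hornerE.
  rewrite size_mul ?expf_neq0 //; have := size_exp RL m; have := card_rows_in r.
  have : (0 < size (RL ^+ m))%N by rewrite size_poly_gt0 expf_neq0.
  have : (0 < size hL)%N by rewrite size_poly_gt0.
  have : (m * size (chains m m) <= (size RL).-1 * m)%N.
    rewrite mulnC leq_mul2r; apply/orP; right; apply: (leq_trans iN).
    by rewrite -ltnS prednK // (leq_trans _ sR).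
  rewrite -mon_count.
  move: (size (RL ^+ m)) (size hL) #|rows_in r| #|Mon n q| ((size RL).-1 * m)%N => a b x y w.
  by clear; lia.
have coefR r : exists z i, [/\ (size (chains m m) <= i)%N,
    (fcurve (line (zA z) (zB r z)) R)`_i != 0 & ev h (zA z) != 0].
  have [A [B [i [Br iN Ri]]]] := degree_bound r R0 vR.
  pose z (x : 'I_k * W + W) := match x with inl (r', w) => A r' w | inr w => B r w end.
  have [|z' [nz' hz']] := regular_neq0_and (regl r R i) regh (a := z) _ nzh; last by exists z', i.
  have zBE : zB r z = B.
    apply: functional_extensionality => r'; apply: functional_extensionality => w.
    by rewrite /zB; case: eqP => [->|/eqP /Br].
  by rewrite zBE; apply: Ri.
have cardR r : #|rows_in r| = #|Mon n q|.
  by have [z [i [iN Ri hz]]] := coefR r; have [] := line_sizes r z i iN Ri hz.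
(* By density from the general lines: [h] does not depend on row r. *)
have hr r z : ev h (fun r' w => zA z r' w + zB r z r' w) = ev h (zA z).
  have [z0 [i [iN Ri0 hz0]]] := coefR r; apply/eqP; rewrite -subr_eq0; apply/eqP.
  move: z; apply: (@regular_dense _ _ (fun z => ev h (fun r' w => zA z r' w + zB r z r' w) - ev h (zA z))
     (fun z => (fcurve (line (zA z) (zB r z)) R)`_i * ev h (zA z)) z0).
  - apply: regularB => //; apply: (@regular_meval _ _ _ _ (fun j z =>
      zA z (enum_val j).1 (enum_val j).2 + zB r z (enum_val j).1 (enum_val j).2)) => j.
    apply: regularD; first exact: regular_coord.
    by rewrite /zB; case: (_ == r); [apply: regular_coord | apply: regular_const].
  - exact: regularM.
  - by rewrite mulf_neq0.
  move=> z; rewrite mulf_eq0 negb_or => /andP[Ri hz].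
  have [_ /size1_polyC hC] := line_sizes r z i iN Ri hz.
  have hE' t : ev h (fun r' w => zA z r' w + zB r z r' w * t) =
      (fcurve (line (zA z) (zB r z)) h).[t].
    by rewrite horner_fcurve; apply: ev_ext => r' w; rewrite /line !hornerE.
  apply/eqP; rewrite subr_eq0; apply/eqP.
  transitivity ((fcurve (line (zA z) (zB r z)) h).[1]).
    by rewrite -hE'; apply: ev_ext => r' w; rewrite mulr1.
  transitivity ((fcurve (line (zA z) (zB r z)) h).[0]); first by rewrite hC !hornerC.
  by rewrite -hE'; apply: ev_ext => r' w; rewrite mulr0 addr0.
have h_const M : ev h M = ev h (fun _ _ => 0).
  (* The rows are set to zero one at a time. *)
  pose Mj j : frame k n := fun r w => if (r < j)%N then 0 else M r w.
  have Mj_ev j : ev h (Mj j) = ev h M.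
    elim: j => [|j <-]; first exact: ev_ext.
    have [jk|kj] := ltnP j k; last first.
      apply: ev_ext => r w; rewrite /Mj; have rk := ltn_ord r.
      by rewrite !(leq_trans rk) // leqW.
    pose z (x : 'I_k * W + W) := match x with inl (r', w) => Mj j r' w | inr w => - Mj j (Ordinal jk) w end.
    rewrite -(hr (Ordinal jk) z); apply: ev_ext => r w; rewrite /zB /zA /z /Mj ltnS leq_eqVlt.
    rewrite -val_eqE /=; case: (ltngtP r j) => [||e]; rewrite ?addr0 //=.
    by have -> : r = Ordinal jk by [apply: val_inj]; rewrite /= ltnn subrr.
  by rewrite -(Mj_ev k); apply: ev_ext => r w; rewrite /Mj ltn_ord.
split.
  have -> : s = (\sum_(r < k) #|rows_in r|)%N.
    rewrite -[LHS]card_ord -sum1_card (partition_big row_of xpredT) //=.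
    by apply: eq_bigr => r _; rewrite -sum1_card.
  rewrite (eq_bigr (fun=> #|Mon n q|)) => [|r _]; last exact: cardR.
  by rewrite sum_nat_const card_prod card_ord.
exists R, (ev h (fun _ _ => 0)); split=> // [|M].
  by rewrite -(h_const (zA zh)).
by rewrite -mmE hE evM evX h_const mulrC.
Qed.
End MinorPower.

(** * Zeros of the resultant *)

Section SmoothPoints.
Variable m : nat.
Local Notation k := (m + m).+1.
Local Notation n := m.+2.
Local Notation A := {mpoly CC[nvars k n]}.
Local Notation o0 := (ord0 : 'I_n).
Local Notation o1 := (lift ord0 ord0 : 'I_n).
Variable R : A.
Hypotheses (iR : irred_elt R) (vR : vanishing R).

(** The alternating extension to all pairs (i, j), for polynomials as well as for their values. *)
Definition skew (T : zmodType) (d : Wedge2 n -> T) (i j : 'I_n) : T :=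
  \sum_w (d w *+ (val w == (i, j)) - d w *+ (val w == (j, i))).

Lemma skewE (T : zmodType) (d : Wedge2 n -> T) w : skew d (val w).1 (val w).2 = d w.
Proof.
have sw (w' : Wedge2 n) : (val w' == ((val w).2, (val w).1)) = false.
  apply/negP => /eqP e; have lt' : ((val w').1 < (val w').2)%N := valP w'.
  have lt : ((val w).1 < (val w).2)%N := valP w.
  by move: lt'; rewrite e ltnNge ltnW.
rewrite /skew (bigD1 w) // sw -surjective_pairing eqxx mulr1n mulr0n subr0.
rewrite big1 => [|w' ww']; first exact: addr0.
by rewrite sw val_eqE (negPf ww') subrr.
Qed.

Lemma skew_pl (a : CC) u v i j :
  skew (fun w => a * pl u v w) i j = a * (u i * v j - u j * v i).
Proof.
have sw (x y : 'I_n) : (x < y)%N -> skew (fun w => a * pl u v w) x y = a * (u x * v y - u y * v x).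
  move=> xy; pose w : Wedge2 n := exist _ (x, y) xy.
  exact: (skewE (fun w => a * pl u v w) w).
have [ij|ji|/val_inj->] := ltngtP i j; first exact: sw.
  have -> : skew (fun w => a * pl u v w) i j = - skew (fun w => a * pl u v w) j i.
    by rewrite /skew -sumrN; apply: eq_bigr => w _; rewrite opprB.
  by rewrite sw //; ring.
by rewrite /skew big1 ?subrr ?mulr0 // => w _; rewrite subrr.
Qed.

Lemma skew_ev (d : Wedge2 n -> A) M i j : ev (skew d i j) M = skew (fun w => ev (d w) M) i j.
Proof.
by rewrite /ev /skew raddf_sum; apply: eq_bigr => w _; rewrite /= mevalB !mevalMn.
Qed.

Local Notation d w := (dM ord0 w R).

Lemma grad_pl M u v : in_res M u v -> exists a, forall w, ev (d w) M = a * pl u v w.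
Proof.
move=> Muv; have v0 := proj2 (vanishing_at0 R) vR.
have [[w0 pl0] _] := Muv; exists (ev (d w0) M / pl u v w0) => w.
have := grad_proportional ord0 w0 w v0 Muv.
rewrite !(@ev_ext _ _ _ (fun r w => M r w + 0) M) => [e||]; try by move=> *; rewrite addr0.
by rewrite mulrAC -[_ * pl u v w]mulrC e mulrC mulKf.
Qed.

Lemma smooth_res M : ev R M = 0 -> ev (d (w01 m)) M != 0 -> res_locus M.
Proof.
move=> RM d0.
have RV g : vanishing g -> ev g M = 0.
  by case/(vanishing_rdvd iR vR) => h ->; rewrite evM RM mul0r.
have contract s : \sum_w M s w * ev (d w) M = 0.
  pose g : A := \sum_w 'X_(enum_rank (s, w)) * d w.
  have gE M' : ev g M' = \sum_w M' s w * ev (d w) M'.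
    rewrite /ev /g raddf_sum; apply: eq_bigr => w _.
    by rewrite /= mevalM mevalXU /frame_pt enum_rankK.
  rewrite -gE; apply: RV => M' /in_resP[u [v Muv]]; rewrite gE.
  have [a aE] := grad_pl Muv; under eq_bigr do rewrite aE mulrCA.
  by rewrite -mulr_sumr; apply: (etrans (congr1 ( *%R a) (proj2 Muv s)) (mulr0 a)).
pose D i j := skew (fun w => d w) i j.
(* The Pluecker relation through the pair (0, 1) holds on X, hence wherever [R] vanishes; it
   exhibits the gradient as decomposable, with factors its column 1 and its row 0. *)
have plucker i j : ev (D i o1) M * ev (D o0 j) M - ev (D j o1) M * ev (D o0 i) M =
   ev (d (w01 m)) M * ev (D i j) M.
  apply/eqP; rewrite -subr_eq0; apply/eqP.
  transitivity (ev (D i o1 * D o0 j - D j o1 * D o0 i - d (w01 m) * D i j) M).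
    by rewrite /ev !mevalB !mevalM.
  apply: RV => M' /in_resP[u [v Muv]]; have [a aE] := grad_pl Muv.
  have DE x y : ev (D x y) M' = a * (u x * v y - u y * v x).
    by rewrite /D skew_ev -skew_pl; apply: eq_bigr => w _; rewrite aE.
  rewrite /ev !mevalB !mevalM -!/(ev _ _) !DE aE /pl /=; ring.
have plE w : pl (fun i => ev (D i o1) M) (fun j => ev (D o0 j) M) w =
    ev (d (w01 m)) M * ev (d w) M.
  by rewrite /pl plucker /D skewE.
apply/in_resP; exists (fun i => ev (D i o1) M), (fun j => ev (D o0 j) M); split.
  by exists (w01 m); rewrite plE mulf_neq0.
move=> s; rewrite /pairing; under eq_bigr do rewrite plE mulrCA.
by rewrite -mulr_sumr contract mulr0.
Qed.
End SmoothPoints.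

(** * Limits and compactness over the complex numbers *)

Section ComplexLimits.
Local Notation RR := Rdefinitions.R.
Implicit Types (z : nat -> CC) (l e : CC) (phi : nat -> nat).

(** In the partial order of [CC], [0 < e] already makes [e] a positive real. *)
Definition cvgC z l := forall e : CC, 0 < e -> exists J : nat, forall j, (J <= j)%N -> `|z j - l| < e.

Lemma cvgC_const l : cvgC (fun=> l) l.
Proof. by move=> e e0; exists 0%N => j _; rewrite subrr normr0. Qed.

Lemma cvgC_ext z z' l : (forall j, z j = z' j) -> cvgC z l -> cvgC z' l.
Proof. by move=> zz zl e /zl[J zJ]; exists J => j /zJ; rewrite zz. Qed.

Lemma cvgCD z z' l l' : cvgC z l -> cvgC z' l' -> cvgC (fun j => z j + z' j) (l + l').
Proof.
move=> zl zl' e e0; have e2 : 0 < e / 2 by rewrite divr_gt0.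
have [J zJ] := zl _ e2; have [J' zJ'] := zl' _ e2; exists (maxn J J') => j.
rewrite geq_max => /andP[/zJ h /zJ' h'].
rewrite (_ : _ - _ = (z j - l) + (z' j - l')); last by ring.
apply: (le_lt_trans (ler_normD _ _)); rewrite [e](splitr e).
exact: ltrD.
Qed.

Lemma cvgC_bounded z l : cvgC z l ->
  exists2 B : CC, 0 < B & exists J, forall j, (J <= j)%N -> `|z j| < B.
Proof.
move=> zl; exists (1 + `|l|); first by rewrite ltr_pwDl.
have [J zJ] := zl 1 ltr01; exists J => j /zJ h.
rewrite -[z j](subrK l); apply: (le_lt_trans (ler_normD _ _)).
by rewrite ltrD2r.
Qed.

Lemma cvgC0M z z' l : cvgC z 0 -> cvgC z' l -> cvgC (fun j => z j * z' j) 0.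
Proof.
move=> z0 /cvgC_bounded[B B0 [J zB]] e e0.
have eB : 0 < e / B by rewrite divr_gt0.
have [J' zJ'] := z0 _ eB; exists (maxn J J') => j; rewrite geq_max => /andP[/zB h /zJ' h'].
move: h'; rewrite !subr0 => h'; rewrite normrM (_ : e = e / B * B); last by rewrite divfK // gt_eqF.
by apply: ltr_pM.
Qed.

Lemma cvgC_sub0 z l : cvgC z l <-> cvgC (fun j => z j - l) 0.
Proof.
by split=> zl e /zl[J zJ]; exists J => j /zJ; rewrite subr0.
Qed.

Lemma cvgCM z z' l l' : cvgC z l -> cvgC z' l' -> cvgC (fun j => z j * z' j) (l * l').
Proof.
move=> zl zl'; have h := cvgCD (cvgC0M (proj1 (cvgC_sub0 _ _) zl) zl')
   (cvgC0M (proj1 (cvgC_sub0 _ _) zl') (cvgC_const l)).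
apply/cvgC_sub0; rewrite addr0 in h; apply: cvgC_ext h => j; ring.
Qed.

Lemma cvgC_sum (I : Type) (r : seq I) (P : pred I) (z : I -> nat -> CC) (l : I -> CC) :
  (forall i, cvgC (z i) (l i)) ->
  cvgC (fun j => \sum_(i <- r | P i) z i j) (\sum_(i <- r | P i) l i).
Proof.
move=> zl; elim: r => [|i r IHr].
  by rewrite big_nil; apply: cvgC_ext (cvgC_const 0) => j; rewrite big_nil.
rewrite big_cons; case Pi: (P i); last first.
  by apply: cvgC_ext IHr => j; rewrite big_cons Pi.
by apply: cvgC_ext (cvgCD (zl i) IHr) => j; rewrite big_cons Pi.
Qed.

Lemma cvgC_unique z l l' : cvgC z l -> cvgC z l' -> l = l'.
Proof.
move=> zl zl'; apply/eqP; rewrite -subr_eq0 -normr_eq0; apply/negPn/negP => n0.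
have e0 : 0 < `|l - l'| / 2 by rewrite divr_gt0 // lt_def n0 normr_ge0.
have [J zJ] := zl _ e0; have [J' zJ'] := zl' _ e0.
have := zJ (maxn J J') (leq_maxl _ _); have := zJ' (maxn J J') (leq_maxr _ _).
move: (z _) => x h' h; have : `|l - l'| < `|l - l'| / 2 + `|l - l'| / 2.
  rewrite {1}(_ : l - l' = (l - x) + (x - l')); last by ring.
  by apply: (le_lt_trans (ler_normD _ _)); rewrite distrC ltrD.
by rewrite -splitr ltxx.
Qed.

(** The bound [j <= phi j] stands in for strict monotonicity and is stable under composition. *)
Lemma cvgC_subseq z l phi : (forall j, (j <= phi j)%N) -> cvgC z l -> cvgC (z \o phi) l.
Proof.
move=> phij zl e /zl[J zJ]; exists J => j Jj; apply: zJ.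
exact: leq_trans Jj (phij j).
Qed.

Lemma cvgC_horner z l (p : {poly CC}) : cvgC z l -> cvgC (fun j => p.[z j]) p.[l].
Proof.
move=> zl; elim/poly_ind: p => [|p c IHp].
  by rewrite horner0; apply: cvgC_ext (cvgC_const 0) => j; rewrite horner0.
rewrite !hornerE; apply: cvgC_ext (cvgCD (cvgCM IHp zl) (cvgC_const c)) => j.
by rewrite !hornerE.
Qed.

Lemma cvgC_squeeze z l (b : nat -> CC) : cvgC b 0 -> (forall j, `|z j - l| <= b j) -> cvgC z l.
Proof.
move=> b0 zb e /b0[J bJ]; exists J => j /bJ; rewrite subr0.
move=> h; apply: le_lt_trans h; apply: (le_trans (zb j)); apply: real_ler_norm.
by apply: ger0_real; apply: le_trans (normr_ge0 _) (zb j).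
Qed.

Lemma posC_real (e : CC) : 0 < e -> exists2 r : RR, 0 < r & e = r%:C%C.
Proof.
by case: e => a b; rewrite ltcE /= => /andP[/eqP b0 a0]; exists a => //; rewrite b0.
Qed.

Lemma cvgC_inv : cvgC (fun j => j.+1%:R^-1) 0.
Proof.
move=> e /posC_real[r r0 ->]; exists (Num.bound r^-1) => j jb.
rewrite subr0 ger0_norm ?invr_ge0 ?ler0n //.
have -> : j.+1%:R^-1 = (j.+1%:R^-1 : RR)%:C%C :> CC by rewrite fmorphV rmorph_nat.
rewrite ltcR invf_plt ?posrE ?ltr0n //.
apply: (lt_le_trans (archi_boundP _)); first by rewrite invr_ge0 ltW.
by rewrite ler_nat; apply: leqW.
Qed.

Lemma bolzano_weierstrass_real (x : nat -> RR) : (forall j, `|x j| <= 1) ->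
  exists (l : RR) (phi : nat -> nat), (forall j, (j <= phi j)%N) /\
    forall d : RR, 0 < d -> exists J, forall j, (J <= j)%N -> `|x (phi j) - l| < d.
Proof.
move=> xb.
have xin j : Rdefinitions.Rle (-1) (x j) /\ Rdefinitions.Rle (x j) 1.
  by have := xb j; rewrite ler_norml => /andP[/RleP h1 /RleP h2].
have [l lP] := Rtopology.Bolzano_Weierstrass x _ (Rtopology.compact_P3 (-1) 1) xin.
have step j : exists p, (j <= p)%N /\ `|x p - l| < j.+1%:R^-1.
  have d0 : Rdefinitions.Rlt 0 (j.+1%:R^-1) by apply/RltP; rewrite invr_gt0 ltr0n.
  have nb : Rtopology.neighbourhood
      (fun y => Rdefinitions.Rlt (Rbasic_fun.Rabs (Rdefinitions.Rminus y l)) (j.+1%:R^-1)) l.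
    by exists (RIneq.mkposreal _ d0) => y.
  have [p [/ssrnat.leP jp pl]] := lP _ j nb; exists p; split => //.
  by move/RltP: pl; rewrite RabsE RminusE.
pose phi j := sval (constructive_indefinite_description _ (step j)).
have phiP j : (j <= phi j)%N /\ `|x (phi j) - l| < j.+1%:R^-1.
  exact: (svalP (constructive_indefinite_description _ (step j))).
exists l, phi; split=> [j|d d0]; first by case: (phiP j).
exists (Num.bound d^-1) => j jb; have [_ /lt_trans] := phiP j; apply.
rewrite invf_plt ?posrE ?ltr0n //.
apply: (lt_le_trans (archi_boundP _)); first by rewrite invr_ge0 ltW.
by rewrite ler_nat; apply: leqW.
Qed.

Lemma cvgC_real (x : nat -> RR) (l : RR) :
  (forall d : RR, 0 < d -> exists J, forall j, (J <= j)%N -> `|x j - l| < d) ->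
  cvgC (fun j => (x j)%:C%C) l%:C%C.
Proof.
move=> xl e /posC_real[d d0 ->]; have [J xJ] := xl d d0; exists J => j /xJ.
by rewrite -rmorphB normc_def /= expr0n /= addr0 sqrtr_sqr ltcR.
Qed.

Lemma bolzano_weierstrass z : (forall j, `|z j| <= 1) ->
  exists l phi, (forall j, (j <= phi j)%N) /\ cvgC (z \o phi) l.
Proof.
move=> zb; have reb j : `|complex.Re (z j)| <= 1.
  by rewrite -lecR; apply: le_trans (normc_ge_Re _) (zb j).
have imb j : `|complex.Im (z j)| <= 1.
  rewrite -lecR; apply: le_trans _ (zb j); rewrite normc_def lecR -sqrtr_sqr ler_wsqrtr //.
  by rewrite lerDr sqr_ge0.
have [a [phi [phij ha]]] := bolzano_weierstrass_real reb.
have [b [psi [psij hb]]] := bolzano_weierstrass_real (fun j => imb (phi j)).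
exists (a%:C + 'i * b%:C)%C, (phi \o psi); split=> [j|].
  exact: leq_trans (psij j) (phij _).
have ca := cvgC_subseq psij (cvgC_real ha).
have cb := cvgC_real (x := fun j => complex.Im (z (phi (psi j)))) hb.
apply: cvgC_ext (cvgCD ca (cvgCM (cvgC_const 'i%C) cb)) => j /=.
by rewrite -complexE.
Qed.

Lemma bolzano_weierstrass_family (I : finType) (z : I -> nat -> CC) :
  (forall i j, `|z i j| <= 1) ->
  exists (l : I -> CC) phi, (forall j, (j <= phi j)%N) /\ forall i, cvgC (z i \o phi) (l i).
Proof.
move=> zb; suff [phi [phij zphi]] : exists phi, (forall j, (j <= phi j)%N) /\
    forall i, i \in enum I -> exists l, cvgC (z i \o phi) l.
  have zl i : exists l, cvgC (z i \o phi) l by apply: zphi; rewrite mem_enum.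
  exists (fun i => sval (constructive_indefinite_description _ (zl i))), phi; split=> // i.
  exact: (svalP (constructive_indefinite_description _ (zl i))).
elim: (enum I) => [|i r [phi [phij zphi]]]; first by exists id.
have [l [psi [psij zl]]] := @bolzano_weierstrass (z i \o phi) (fun j => zb i _).
exists (phi \o psi); split=> [j|i']; first exact: leq_trans (psij j) (phij _).
rewrite inE => /predU1P[->|/zphi[l' zl']]; first by exists l.
by exists l'; apply: cvgC_subseq zl'.
Qed.

Lemma pigeonhole (I : finType) (c : nat -> I) :
  exists i phi, (forall j, (j <= phi j)%N) /\ forall j, c (phi j) = i.
Proof.
have [i iP] : exists i, forall J, exists j, (J <= j)%N /\ c j = i.
  apply: NNPP => no.
  have bnd i : exists J, forall j, (J <= j)%N -> c j <> i.
    apply: NNPP => nb; apply: no; exists i => J; apply: NNPP => nJ; apply: nb.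
    by exists J => j Jj cj; apply: nJ; exists j.
  pose B i := sval (constructive_indefinite_description _ (bnd i)).
  have BP i : forall j, (B i <= j)%N -> c j <> i.
    exact: (svalP (constructive_indefinite_description _ (bnd i))).
  pose J := (\max_i B i)%N; apply: (BP (c J) J) => //.
  exact: (leq_bigmax (c J)).
exists i, (fun J => sval (constructive_indefinite_description _ (iP J))).
by split=> J; case: (svalP (constructive_indefinite_description _ (iP J))).
Qed.
End ComplexLimits.

Section SmallRoots.
Implicit Types (P : {poly CC}).

Lemma infinitely_nonzero P : P != 0 -> forall J, exists j, (J <= j)%N /\ P.[j.+1%:R^-1] != 0.
Proof.
move=> P0 J; apply: NNPP => no.
pose s := [seq (j.+1%:R^-1 : CC) | j <- iota J (size P)].
have : (size s < size P)%N.
  apply: max_poly_roots => //.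
    apply/allP => _ /mapP[j + ->]; rewrite mem_iota => /andP[Jj _].
    by apply/rootP/eqP/negPn/negP => n0; apply: no; exists j.
  rewrite map_inj_uniq ?iota_uniq // => i j /invr_inj/eqP.
  by rewrite eqr_nat eqSS => /eqP.
by rewrite size_map size_iota ltnn.
Qed.

(* If all roots have modulus at least [|y|] then each factor satisfies
   [|y - a| <= 2 |a|]. *)
Lemma root_bound P (y : CC) : P != 0 -> (forall a, root P a -> `|y| <= `|a|) ->
  `|P.[y]| <= 2 ^+ (size P).-1 * `|P.[0]|.
Proof.
move=> P0 ya; have [r rE] := closed_field_poly_normal P.
have l0 : lead_coef P != 0 by rewrite lead_coef_eq0.
have sr : (size P).-1 = size r.
  by rewrite rE size_scale // size_prod_XsubC.
have ra a : a \in r -> root P a.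
  by move=> ar; rewrite rE rootZ // root_prod_XsubC.
rewrite sr [in P.[y]]rE [in P.[0]]rE !hornerZ !horner_prod !normrM mulrCA.
apply: ler_wpM2l; first exact: normr_ge0.
elim: r ra {rE sr} => [|a r IHr] ra; first by rewrite !big_nil expr0 mul1r.
rewrite !big_cons !normrM /= exprS mulrACA.
apply: ler_pM => //; last by apply: IHr => b br; apply: ra; rewrite inE br orbT.
rewrite !hornerE ?sub0r normrN mulr_natl mulr2n.
apply: le_trans (ler_normB _ _) _; rewrite lerD2r.
by apply: ya; apply: ra; rewrite inE eqxx.
Qed.
End SmallRoots.

Lemma size_fcurve_line k n (A B : frame k n) p : (size (fcurve (line A B) p) <= msize p)%N.
Proof.
rewrite fcurveE; apply: (leq_trans (size_sum _ _ _)).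
apply/bigmax_leqP_seq => mm mp _; apply: (leq_trans (size_scale_leq _ _)).
apply: leq_trans (msize_mdeg_lt mp); apply: (leq_trans (size_prod_leq _ _)).
rewrite leq_subLR card_ord mdegE.
have : (\sum_(i < nvars k n) size (line A B (enum_val i).1 (enum_val i).2 ^+ mm i)%R
        <= \sum_(i < nvars k n) (mm i + 1))%N.
  apply: leq_sum => i _; apply: (leq_trans (size_poly_exp_leq _ _)).
  rewrite addn1 ltnS; case: (mm i) => [|e]; first by rewrite muln0.
  rewrite -[X in (_ <= X)%N]mul1n leq_mul2r; apply/orP; right.
  have : (size (line A B (enum_val i).1 (enum_val i).2) <= 2)%N; last by lia.
  apply: (leq_trans (size_polyD _ _)); rewrite geq_max; apply/andP; split.
    by apply: (leq_trans (size_polyC_leq1 _)).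
  have [->|c0] := eqVneq (B (enum_val i).1 (enum_val i).2) 0.
    by rewrite mul0r size_poly0.
  by rewrite size_Cmul // size_polyX.
rewrite big_split /= sum_nat_const card_ord muln1 => le.
by rewrite addnC addSn ltnS.
Qed.

(** Division by a Pluecker coordinate of largest modulus; u' and v' are themselves made of Pluecker
    coordinates, so they are bounded by 1. *)
Lemma in_res_normalized k n (M : frame k n) : res_locus M ->
  exists (w : Wedge2 n) (u v : 'I_n -> CC),
    [/\ pl u v w = 1, forall r, pairing (M r) u v = 0,
        forall i, `|u i| <= 1 & forall i, `|v i| <= 1].
Proof.
move/in_resP=> [u [v [[w0 pl0] Muv]]].
pose F (w : Wedge2 n) := complex.Re `|pl u v w|.
have FE w : `|pl u v w| = (F w)%:C%C by rewrite /F normc_def.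
have [w wmax] : exists w, forall w', `|pl u v w'| <= `|pl u v w|.
  have [w _ wmax] := @Order.TotalTheory.arg_maxP _ _ _ w0 xpredT F isT.
  by exists w => w'; rewrite !FE lecR; apply: wmax.
have om0 : pl u v w != 0.
  by rewrite -normr_gt0; apply: lt_le_trans (wmax w0); rewrite normr_gt0.
have bnd i j : `|(u i * v j - u j * v i) / pl u v w| <= 1.
  rewrite normf_div ler_pdivrMr ?normr_gt0 // mul1r.
  have [ij|ji|/val_inj->] := ltngtP i j.
  - exact: (wmax (exist (fun p : 'I_n * 'I_n => p.1 < p.2)%N (i, j) ij)).
  - rewrite distrC; exact: (wmax (exist (fun p : 'I_n * 'I_n => p.1 < p.2)%N (j, i) ji)).
  by rewrite subrr normr0.
pose u' i := (u i * v (val w).2 - u (val w).2 * v i) / pl u v w.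
pose v' i := (u (val w).1 * v i - u i * v (val w).1) / pl u v w.
have plE w' : pl u' v' w' = (pl u v w)^-1 * pl u v w'.
  have plucker : (u (val w').1 * v (val w).2 - u (val w).2 * v (val w').1) *
     (u (val w).1 * v (val w').2 - u (val w').2 * v (val w).1) -
     (u (val w').2 * v (val w).2 - u (val w).2 * v (val w').2) *
     (u (val w).1 * v (val w').1 - u (val w').1 * v (val w).1) = pl u v w * pl u v w'.
    by rewrite /pl; ring.
  rewrite -[pl u v w'](mulKf om0) -plucker /u' /v' {1}/pl.
  by move: (pl u v w)^-1 => c; ring.
exists w, u', v'; split=> [|r|i|i]; rewrite ?plE ?mulVf //; try exact: bnd.
rewrite /pairing; under eq_bigr do rewrite plE mulrCA.
by rewrite -mulr_sumr; apply: (etrans (congr1 ( *%R _) (Muv r)) (mulr0 _)).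
Qed.

(** Along a subsequence the normalising coordinate [w] is constant and the bounded u, v converge;
    the value 1 at [w] keeps the limit bivector nonzero. *)
Lemma res_locus_closed k n (Mj : nat -> frame k n) (M : frame k n) :
  (forall j, res_locus (Mj j)) -> (forall r w, cvgC (fun j => Mj j r w) (M r w)) ->
  res_locus M.
Proof.
move=> Mres Mcvg.
have ex j : exists x : Wedge2 n * (('I_n -> CC) * ('I_n -> CC)),
    [/\ pl x.2.1 x.2.2 x.1 = 1, forall r, pairing (Mj j r) x.2.1 x.2.2 = 0,
        forall i, `|x.2.1 i| <= 1 & forall i, `|x.2.2 i| <= 1].
  by have [w [u [v H]]] := in_res_normalized (Mres j); exists (w, (u, v)).
pose x j := sval (constructive_indefinite_description _ (ex j)).
have xP j : [/\ pl (x j).2.1 (x j).2.2 (x j).1 = 1,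
    forall r, pairing (Mj j r) (x j).2.1 (x j).2.2 = 0,
    forall i, `|(x j).2.1 i| <= 1 & forall i, `|(x j).2.2 i| <= 1].
  exact: (svalP (constructive_indefinite_description _ (ex j))).
have [w [phi [phij wE]]] := pigeonhole (fun j => (x j).1).
pose z (i : 'I_n + 'I_n) j := match i with
  | inl i => (x (phi j)).2.1 i | inr i => (x (phi j)).2.2 i end.
have zb i j : `|z i j| <= 1 by case: (xP (phi j)) => _ _ h1 h2; case: i => i; [apply: h1 | apply: h2].
have [l [psi [psij zl]]] := bolzano_weierstrass_family zb.
pose u i := l (inl i); pose v i := l (inr i).
have plcvg w' : cvgC (fun j => pl (x (phi (psi j))).2.1 (x (phi (psi j))).2.2 w') (pl u v w').
  rewrite /pl -[- (u _ * _)]mulN1r.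
  apply: cvgC_ext (cvgCD (cvgCM (zl (inl (val w').1)) (zl (inr (val w').2)))
    (cvgCM (cvgC_const (-1)) (cvgCM (zl (inl (val w').2)) (zl (inr (val w').1))))) => j /=.
  by rewrite mulN1r.
apply/in_resP; exists u, v; split.
  exists w; rewrite (_ : pl u v w = 1) ?oner_neq0 //.
  apply: (cvgC_unique (plcvg w)); apply: cvgC_ext (cvgC_const 1) => j.
  by have [h _ _ _] := xP (phi (psi j)); rewrite -h wE.
move=> r; have Mphi w' : cvgC (fun j => Mj (phi (psi j)) r w') (M r w').
  by apply: (cvgC_subseq (phi := phi \o psi)) (Mcvg r w') => j; apply: leq_trans (psij j) (phij _).
apply: (@cvgC_unique (fun j => pairing (Mj (phi (psi j)) r) (x (phi (psi j))).2.1 (x (phi (psi j))).2.2)).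
  by rewrite /pairing; apply: cvgC_sum => w'; apply: cvgCM (Mphi w') (plcvg w').
by apply: cvgC_ext (cvgC_const 0) => j; have [_ h _ _] := xP (phi (psi j)); rewrite h.
Qed.

Section ZeroLocus.
Variable m : nat.
Local Notation k := (m + m).+1.
Local Notation n := m.+2.
Local Notation A := {mpoly CC[nvars k n]}.
Variable R : A.
Hypotheses (iR : irred_elt R) (vR : vanishing R).

Lemma mpoly_neq0_frame (p : A) : p != 0 -> exists M, ev p M != 0.
Proof.
move/mpoly_neq0_point/not_all_ex_not=> [x nx].
exists (fun r w => x (enum_rank (r, w))); apply/eqP => e; apply: nx.
rewrite -[RHS]e; apply: meval_eq => i; rewrite /frame_pt.
by rewrite -surjective_pairing enum_valK.
Qed.

(** [R] is not zero along [C], and the elimination polynomial [r] for [R] and its derivative in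
    direction [C] is not zero along [B]. A small step along [B] avoids the zeros of [r]; a root of
    [R] near 0 in the direction [C] then has nonzero derivative [g]. *)
Lemma smooth_points_dense M : ev R M = 0 -> exists B C : frame k n,
  forall d : CC, 0 < d -> exists s y : CC,
    [/\ `|s| < d, `|y| < d & res_locus (fun r w => M r w + s * B r w + C r w * y)].
Proof.
move=> RM; have R0 : R != 0 by case: iR.
have [N RN] := mpoly_neq0_frame R0.
pose C : frame k n := fun r w => N r w - M r w.
pose g := dM ord0 (w01 m) R.
have nRg : ~ rdvd R g.
  case=> h gE; apply: (deriv_not_vanishing iR vR) => M' M'res.
  by rewrite -/g gE evM vR // mul0r.
have mv : R.@[fun i => frame_pt M i + frame_pt C i * 1] <> R.@[frame_pt M].
  rewrite -!/(ev _ _) [RHS]RM => e; case/eqP: RN; rewrite -[RHS]e.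
  by apply: meval_eq => i; rewrite /frame_pt /C; ring.
have [r r0 rz] := irred_no_common_zero iR nRg mv.
have [N2 rN2] := mpoly_neq0_frame r0.
pose B : frame k n := fun r w => N2 r w - M r w.
pose phi s := fcurve (line (fun r w => M r w + s * B r w) C) R.
pose psi y := fcurve (line (fun r w => M r w + C r w * y) B) R.
have phiE s y : (phi s).[y] = ev R (fun r w => M r w + s * B r w + C r w * y).
  by rewrite /phi horner_fcurve; apply: ev_ext => r' w; rewrite /line !hornerE.
have psiE s y : (psi y).[s] = (phi s).[y].
  by rewrite phiE /psi horner_fcurve; apply: ev_ext => r' w; rewrite /line !hornerE; ring.
pose rho := fcurve (line M B) r.
have rhoE s : rho.[s] = ev r (fun r w => M r w + s * B r w).
  by rewrite /rho horner_fcurve; apply: ev_ext => r' w; rewrite /line !hornerE mulrC.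
have rho0 : rho != 0.
  apply: contraNneq rN2 => rhoz; have := rhoE 1; rewrite rhoz horner0 => e.
  by apply/eqP; rewrite [RHS]e; apply: ev_ext => r' w; rewrite /B; ring.
have phi0 : phi 0 != 0.
  apply: contraNneq RN => phiz; have := phiE 0 1; rewrite phiz horner0 => e.
  by apply/eqP; rewrite [RHS]e; apply: ev_ext => r' w; rewrite /C; ring.
exists B, C => d d0.
have inv_norm j : `|(j.+1%:R^-1 : CC)| = j.+1%:R^-1 by rewrite ger0_norm ?invr_ge0 ?ler0n.
have [J JP] := cvgC_inv d0.
have [j1 [Jj1 n1]] := infinitely_nonzero phi0 J; set y1 := j1.+1%:R^-1 in n1.
have y1d : `|y1| < d by have := JP j1 Jj1; rewrite subr0.
pose D := msize R.
have e0 : 0 < `|(phi 0).[y1]| / 2 by rewrite divr_gt0 // normr_gt0.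
have c1 := cvgC_horner (psi y1) cvgC_inv.
have c0 := cvgCM (cvgC_const (2 ^+ D)) (cvgC_horner (psi 0) cvgC_inv).
have [J1 h1] := c1 _ e0; have [J0 h0] := c0 _ e0.
have [j [Jj rj]] := infinitely_nonzero rho0 (maxn J (maxn J1 J0)).
set s := j.+1%:R^-1 in rj; exists s.
have sd : `|s| < d.
  by have := JP j (leq_trans (leq_maxl _ _) Jj); rewrite subr0.
(* As s tends to 0, the left side tends to a multiple of R(M) = 0 and the right side to a nonzero
   limit. By [root_bound] this forces a root of modulus below that of [y1]. *)
have lt01 : 2 ^+ D * `|(phi s).[0]| < `|(phi s).[y1]|.
  have Jj1' : (J1 <= j)%N by move: Jj; rewrite !geq_max => /and3P[].
  have Jj0' : (J0 <= j)%N by move: Jj; rewrite !geq_max => /and3P[].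
  have := h0 j Jj0'; have := h1 j Jj1'; rewrite (psiE s y1) (psiE s 0) (psiE 0 y1) (psiE 0 0).
  have -> : (phi 0).[0] = 0.
    by rewrite phiE -[RHS]RM; apply: ev_ext => r' w; ring.
  rewrite mulr0 subr0 normrM ger0_norm ?exprn_ge0 ?ler0n // => a b.
  apply: (lt_trans b).
  have := ler_normD ((phi s).[y1]) ((phi 0).[y1] - (phi s).[y1]).
  rewrite addrC subrK distrC => tri.
  have : `|(phi 0).[y1]| < `|(phi s).[y1]| + `|(phi 0).[y1]| / 2.
    by apply: (le_lt_trans tri); rewrite ltrD2l.
  by rewrite -ltrBlDr {1}[`|(phi 0).[y1]|]splitr addrK.
have [a ra ay] : exists2 a, root (phi s) a & `|a| < `|y1|.
  apply: NNPP => no.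
  have all_big a : root (phi s) a -> `|y1| <= `|a|.
    move=> ra; rewrite real_leNgt ?normr_real //; apply/negP => lt.
    by apply: no; exists a.
  have ps0 : phi s != 0.
    by apply: contraTneq lt01 => ->; rewrite !horner0 normr0 mulr0 ltxx.
  have := root_bound ps0 all_big; apply/negP; rewrite -real_ltNge ?realM ?realX ?realn ?normr_real //.
  apply: le_lt_trans lt01; apply: ler_wpM2r; first exact: normr_ge0.
  rewrite ler_weXn2l ?ler1n //; apply: leq_trans (leq_pred _) _.
  exact: size_fcurve_line.
exists a; split=> //; first exact: lt_trans ay y1d.
apply: (smooth_res iR vR); first by rewrite -phiE; apply/rootP.
apply: contraNneq rj => gz; apply/eqP; rewrite rhoE; apply: (rz _ a).
  rewrite -[RHS](rootP ra) phiE; exact: meval_eq.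
by rewrite -[RHS]gz; apply: meval_eq.
Qed.

Lemma zero_res M : ev R M = 0 -> res_locus M.
Proof.
move/smooth_points_dense=> [B [C dense]].
have ex j : exists sy : CC * CC, [/\ `|sy.1| < j.+1%:R^-1, `|sy.2| < j.+1%:R^-1 &
    res_locus (fun r w => M r w + sy.1 * B r w + C r w * sy.2)].
  have [|s [y H]] := dense (j.+1%:R^-1); first by rewrite invr_gt0 ltr0n.
  by exists (s, y).
pose sy j := sval (constructive_indefinite_description _ (ex j)).
have syP j : [/\ `|(sy j).1| < j.+1%:R^-1, `|(sy j).2| < j.+1%:R^-1 &
    res_locus (fun r w => M r w + (sy j).1 * B r w + C r w * (sy j).2)].
  exact: (svalP (constructive_indefinite_description _ (ex j))).
have s0 : cvgC (fun j => (sy j).1) 0.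
  by apply: (cvgC_squeeze cvgC_inv) => j; rewrite subr0 ltW //; case: (syP j).
have y0 : cvgC (fun j => (sy j).2) 0.
  by apply: (cvgC_squeeze cvgC_inv) => j; rewrite subr0 ltW //; case: (syP j).
apply: (@res_locus_closed _ _ (fun j r w => M r w + (sy j).1 * B r w + C r w * (sy j).2)) => [j|r w].
  by case: (syP j).
have := cvgCD (cvgCD (cvgC_const (M r w)) (cvgCM s0 (cvgC_const (B r w))))
  (cvgCM (cvgC_const (C r w)) y0).
by rewrite mul0r mulr0 !addr0.
Qed.
End ZeroLocus.

(** * The rank of the Koszul differential *)

Section Delta2Rank.
Variables n q : nat.

Definition koszul_delta1 (kb : 'I_n * Mon n q.+1) (c : Mon n q.+2) : CC :=
  [forall l, expo c l == expo kb.2 l + (l == kb.1)]%N%:R.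

Definition Delta1 := mxT koszul_delta1.

Lemma mon_mul (c : Mon n q.+2) (b : Mon n q.+1) i x :
  (forall l, expo c l = expo b l + (l == i))%N -> mon c x = x i * mon b x.
Proof.
move=> cb; rewrite /mon; under eq_bigr do rewrite cb exprD.
rewrite big_split /= mulrC; congr (_ * _).
by rewrite (bigD1 i) //= eqxx expr1 big1 ?mulr1 // => l /negPf->.
Qed.

Lemma Delta1_mon x : Delta1 *m colT (fun c => mon c x) = evcol q.+1 x x.
Proof.
rewrite mul_mxT_colT; apply: eq_colT => -[i b] /=.
have [c cE] : exists c : Mon n q.+2, forall l, expo c l = (expo b l + (l == i))%N.
  apply: mk_mon; rewrite big_split /= expo_sum (bigD1 i) //= eqxx big1 ?addn0 ?addn1 //.
  by move=> l /negPf->.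
rewrite (bigD1 c) //= big1 ?addr0 => [|c' cc'].
  rewrite /koszul_delta1 /= (_ : [forall l, _] = true) ?mul1r ?(mon_mul x cE) //.
  by apply/forallP => l; rewrite cE.
rewrite /koszul_delta1 /=; case: forallP => [eb|]; last by rewrite mul0r.
case/eqP: cc'; apply: expo_inj => l.
by rewrite cE; apply/eqP/eb.
Qed.

Lemma Delta2_Delta1 : Delta2 n q *m Delta1 = 0.
Proof.
apply/matrixP => i j; rewrite [RHS]mxE -(enum_valK j).
move: (enum_val j); apply: (mon_free (c := fun c => (Delta2 n q *m Delta1) i (enum_rank c))) => x.
have := congr1 (fun C : 'cV_ _ => C i 0) (Delta2_evcol q x x).
rewrite -Delta1_mon mulmxA [RHS]mxE /pl [X in X - _]mulrC subrr mul0r => e; rewrite -[RHS]e.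
rewrite [RHS]mxE (reindex (@enum_rank (Mon n q.+2))) //=; last exact/onW_bij/enum_rank_bij.
by apply: eq_bigr => c _; congr (_ * _); rewrite mxE enum_rankK.
Qed.

(** Splitting off one chosen variable from each monomial gives a one-sided inverse. *)
Lemma Delta1_full : row_full Delta1.
Proof.
have ex (c : Mon n q.+2) : exists kb : 'I_n * Mon n q.+1,
    forall l, expo c l = (expo kb.2 l + (l == kb.1))%N.
  have [i ci] : exists i, (0 < expo c i)%N.
    apply/existsP; apply: contraT; rewrite negb_exists => /forallP c0.
    have := expo_sum c; rewrite big1 // => i _.
    by apply/eqP; rewrite -leqn0 leqNgt; apply: c0.
  have [b bE] : exists b : Mon n q.+1, forall l, expo b l = (expo c l - (l == i))%N.
    apply: mk_mon; have := expo_sum c; rewrite (bigD1 i) //= [in X in _ -> X](bigD1 i) //= eqxx.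
    rewrite [X in _ -> (_ + X)%N = _](eq_bigr (fun l => expo c l)) => [|l /negPf->]; last by rewrite subn0.
    by move: (bigop _ _ _) ci => x; lia.
  exists (i, b) => l /=; rewrite bE; case: eqP => [->|]; lia.
pose h c := sval (constructive_indefinite_description _ (ex c)).
have hP c : forall l, expo c l = (expo (h c).2 l + (l == (h c).1))%N.
  exact: (svalP (constructive_indefinite_description _ (ex c))).
apply/row_fullP; exists (mxT (fun c kb => (kb == h c)%:R)).
apply/matrixP => i j; rewrite !mxE (bigD1 (enum_rank (h (enum_val i)))) //= big1 ?addr0.
  rewrite !mxE enum_rankK eqxx mul1r /koszul_delta1; congr (nat_of_bool _)%:R.
  apply/forallP/eqP => [eb|-> l]; last by rewrite hP.
  by apply/enum_val_inj/esym/expo_inj => l; rewrite (eqP (eb l)) hP.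
move=> l lh; rewrite !mxE (_ : _ == _ = false) ?mul0r //.
by apply: contraNF lh => /eqP <-; rewrite enum_valK.
Qed.

Lemma rank_Delta2_le : (\rank (Delta2 n q) + #|Mon n q.+2| <= n * #|Mon n q.+1|)%N.
Proof.
have /eqP fullE : \rank Delta1 == #|Mon n q.+2| := Delta1_full.
have cardE : #|{: 'I_n * Mon n q.+1}| = (n * #|Mon n q.+1|)%N by rewrite card_prod card_ord.
by rewrite -[X in (_ + X)%N]fullE -cardE; apply: mulmx0_rank_max Delta2_Delta1.
Qed.
End Delta2Rank.

(** The numerical coincidence behind q = n - 3: the upper bound for the rank of delta_2 equals the
    dimension of the source of gamma. *)
Lemma koszul_dimension q :
  (q.+3 * #|Mon q.+3 q.+1| = (q.+1 + q.+1).+1 * #|Mon q.+3 q| + #|Mon q.+3 q.+2|)%N.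
Proof.
rewrite !card_Mon.
have -> : (q.+2 + q.+1 = (q.+1 + q.+1).+1)%N by lia.
have -> : (q.+2 + q.+2 = (q.+1 + q.+1).+2)%N by lia.
have -> : (q.+2 + q = q.+1 + q.+1)%N by lia.
have sym : 'C((q.+1 + q.+1).+1, q.+1) = 'C((q.+1 + q.+1).+1, q.+2).
  by rewrite -bin_sub; [congr ('C(_, _)); lia | lia].
have := mul_bin_left (q.+1 + q.+1) q.+1; rewrite addnK.
rewrite (binS (q.+1 + q.+1).+1 q.+1) sym !(binS (q.+1 + q.+1) q.+1).
move: 'C(_, _) 'C(_, _) => a b; nia.
Qed.

(** * The determinant of gamma *)

Section Core.
Variable q : nat.
Local Notation m := q.+1.
Local Notation k := (m + m).+1.
Local Notation n := m.+2.
Local Notation rows := {: 'I_k * Mon n q}.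

Lemma max_rank_frame c (P : 'M[CC]_(#|{: 'I_n * Mon n q.+1}|, c)) :
  exists M : frame k n, forall M' : frame k n,
    (\rank (gamma_mx q M' *m P) <= \rank (gamma_mx q M *m P))%N.
Proof.
apply: NNPP => no.
have step (M : frame k n) : exists M' : frame k n,
    (\rank (gamma_mx q M *m P) < \rank (gamma_mx q M' *m P))%N.
  apply: NNPP => nM; apply: no; exists M => M'; rewrite leqNgt; apply/negP => lt.
  by apply: nM; exists M'.
have unb j : exists M : frame k n, (j <= \rank (gamma_mx q M *m P))%N.
  elim: j => [|j [M jM]]; first by exists (fun _ _ => 0).
  by have [M' lt] := step M; exists M'; apply: leq_trans lt.
have [M] := unb #|rows|.+1; rewrite leqNgt ltnS => /negP; apply.
exact: rank_leq_row.
Qed.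

(** At a frame of largest rank some minor of that size is nonzero, and [minor_power] forces it to
    use all rows. *)
Lemma full_rank_exists c (P : 'M[CC]_(#|{: 'I_n * Mon n q.+1}|, c)) :
  \rank (Delta2 n q *m P) = \rank (Delta2 n q) ->
  exists M : frame k n, \rank (gamma_mx q M *m P) = #|rows|.
Proof.
move=> rP; have [M Mmax] := max_rank_frame P; exists M.
set G := gamma_mx q M *m P in Mmax *; pose f := maxrankfun G.
pose Y := pinvmx (rowsub f G).
have minorM : \det (rowsub f 1%:M *m G *m Y) != 0; last first.
  by have [] := minor_power rP (@maxrankfun_inj _ _ _ G) Mmax minorM.
by rewrite mul_rowsub_mx mul1mx mulmxVp ?det1 ?oner_neq0 // maxrowsub_free.
Qed.

Lemma rank_Delta2 : \rank (Delta2 n q) = #|rows|.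
Proof.
apply/eqP; rewrite eqn_leq; apply/andP; split.
  have cardE : #|rows| = (k * #|Mon n q|)%N by rewrite card_prod card_ord.
  by have := rank_Delta2_le n q; rewrite koszul_dimension leq_add2r cardE.
have rP : \rank (Delta2 n q *m 1%:M) = \rank (Delta2 n q) by rewrite mulmx1.
have [M <-] := full_rank_exists rP.
by rewrite mulmx1 gamma_Delta2 mxrankM_maxr.
Qed.

Lemma det_gamma (P : 'M[CC]_(#|{: 'I_n * Mon n q.+1}|, #|rows|)) :
  \rank (Delta2 n q *m P) = \rank (Delta2 n q) ->
  exists (a : CC) (R : {mpoly CC[nvars k n]}),
    [/\ a != 0, mirreducible R,
        forall M : frame k n, full_rank_frame M -> (R.@[frame_pt M] == 0) <-> res_locus M &
        forall M : frame k n, \det (gamma_mx q M *m P) = a * R.@[frame_pt M] ^+ m].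
Proof.
move=> rP; have [M1 rM1] := full_rank_exists rP.
have detX (M : frame k n) : \det (rowsub id 1%:M *m (gamma_mx q M *m P) *m 1%:M) =
    \det (gamma_mx q M *m P).
  rewrite mulmx1 mul_rowsub_mx mul1mx; congr (\det _).
  by apply/matrixP => i j; rewrite mxE.
have minor1 : \det (rowsub id 1%:M *m (gamma_mx q M1 *m P) *m 1%:M) != 0.
  by rewrite detX -unitfE -unitmxE -row_free_unit /row_free rM1.
have [_ [R [a [iR vR a0 detE]]]] := minor_power rP (@inj_id _) (fun M => rank_leq_row _) minor1.
exists a, R; split => //.
- have [R0 Ru RI] := iR; rewrite mpoly_unit_msize in Ru; split.
    by move: Ru; have := msize_poly_eq0 R; rewrite (negPf R0); case: (msize R) => [|[|]].
  by move=> b c /RI[]; rewrite mpoly_unit_msize => /eqP ->; [left | right].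
- by move=> M _; split=> [/eqP /(zero_res iR vR) | /vR /eqP].
by move=> M; rewrite -detX; apply: detE.
Qed.
End Core.

(** With [n] and [k] as variables the equations can be substituted throughout the dependent matrix
    types. *)
Lemma det_gamma_cast (n k q : nat) : n = q.+3 -> k = (q.+1 + q.+1).+1 ->
  \rank (Delta2 n q) = #|{: 'I_k * Mon n q}| /\
  forall P : 'M[CC]_(#|{: 'I_n * Mon n q.+1}|, #|{: 'I_k * Mon n q}|),
    \rank (Delta2 n q *m P) = \rank (Delta2 n q) ->
    exists (c : CC) (R : {mpoly CC[nvars k n]}),
      [/\ c != 0, mirreducible R,
          (forall M : frame k n, full_rank_frame M -> (R.@[frame_pt M] == 0) <-> res_locus M) &
          (forall M : frame k n,
              \det (gamma_mx q M *m P) = c * (R.@[frame_pt M]) ^+ q.+1)].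
Proof.
move=> -> ->; split; first exact: rank_Delta2.
exact: det_gamma.
Qed.

Theorem theorem3p4 (n : nat) (hn : (3 <= n)%N) :
  (* the two bundles in gamma have equal rank: dim Im(delta_{2,n-3}) = rk(U (x) Sym^{n-3} V) *)
  \rank (Delta2 n (n - 3)) = #|{: 'I_(2 * n - 3) * Mon n (n - 3)}|
  /\
  (* for any identification P of Im(delta_{2,n-3}) with the target coordinate
     space (P injective on the image), det(gamma) = c * R^(n-2), where R is the
     (irreducible) equation of the Cayley-Chow divisor D_Res. *)
  forall P : 'M[CC]_(#|{: 'I_n * Mon n (n - 3).+1}|, #|{: 'I_(2 * n - 3) * Mon n (n - 3)}|),
    \rank (Delta2 n (n - 3) *m P) = \rank (Delta2 n (n - 3)) ->
    exists (c : CC) (R : {mpoly CC[nvars (2 * n - 3) n]}),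
      [/\ c != 0,
          mirreducible R,
          (forall M : frame (2 * n - 3) n, full_rank_frame M ->
              (R.@[frame_pt M] == 0) <-> res_locus M) &
          (forall M : frame (2 * n - 3) n,
              \det (gamma_mx (n - 3) M *m P) = c * (R.@[frame_pt M]) ^+ (n - 2))].
Proof.
have nE : n = (n - 3).+3 by lia.
have kE : (2 * n - 3 = ((n - 3).+1 + (n - 3).+1).+1)%N by lia.
by have -> : (n - 2 = (n - 3).+1)%N; [lia | exact: det_gamma_cast].
Qed.
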